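(* Let $G=(G_{j,j'})_{1\le j,j'\le d}$ be a non-atomic matrix valued spectral measure on $E$ ($E=\mathbb{R}^\nu$ or $E=[-\pi,\pi)^\nu$), let $Z_G=(Z_{G,1},\dots,Z_{G,d})$ be a vector valued random spectral measure corresponding to it, and for $n\ge1$ and $j_1,\dots,j_n\in\{1,\dots,d\}$ let $I_n(f|j_1,\dots,j_n)$ denote the $n$-fold Wiener--Itô integral of simple functions $f\in\hat{\mathcal{K}}_{n,j_1,\dots,j_n}$. The map $f\mapsto I_n(f|j_1,\dots,j_n)$ is linear and extends from $\hat{\mathcal{K}}_{n,j_1,\dots,j_n}$ by $L_2$-continuity to all $f\in\mathcal{K}_{n,j_1,\dots,j_n}$, and the following relations hold both for simple functions and for this extension: (1) $I_n(f|j_1,\dots,j_n)$ is a real valued random variable for all $f\in\mathcal{K}_{n,j_1,\dots,j_n}$. (2) $EI_n(f|j_1,\dots,j_n)=0$ for all $f\in\mathcal{K}_{n,j_1,\dots,j_n}$, $n\ge1$. (3) For $f\in\mathcal{K}_{n,j_1,\dots,j_n}$ and $h\in\mathcal{K}_{n,j'_1,\dots,j'_n}$, $$EI_n(f|j_1,\dots,j_n)I_n(h|j'_1,\dots,j'_n)=\sum_{\pi\in\Pi(n)}\int f(x_1,\dots,x_n)\overline{h(x_{\pi(1)},\dots,x_{\pi(n)})}\,G_{j_1,j'_{\pi^{-1}(1)}}(dx_1)\dots G_{j_n,j'_{\pi^{-1}(n)}}(dx_n),$$ where $\Pi(n)$ is the set of all permutations of $\{1,\dots,n\}$. (4) If $n\ne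 n'$, $f\in\mathcal{K}_{n,j_1,\dots,j_n}$ and $h\in\mathcal{K}_{n',j'_1,\dots,j'_{n'}}$, then $EI_n(f|j_1,\dots,j_n)I_{n'}(h|j'_1,\dots,j'_{n'})=0$. (5) For $f\in\mathcal{K}_{n,j_1,\dots,j_n}$, $$E|I_n(f|j_1,\dots,j_n)|^2\le n!\int|f(x_1,\dots,x_n)|^2G_{j_1,j_1}(dx_1)\dots G_{j_n,j_n}(dx_n)=n!\,\|f\|^2 .$$
   Context: Setting. $E$ denotes either $\mathbb{R}^\nu$ or the torus $[-\pi,\pi)^\nu$ (coordinates modulo $2\pi$). $G=(G_{j,j'})_{1\le j,j'\le d}$ is a matrix valued spectral measure on $E$: the $G_{j,j'}$ are complex measures, of finite total variation if $E$ is the torus, and of locally finite total variation (i.e. defined on bounded Borel sets, with finite total variation on each cube $[-T,T]^\nu$) if $E=\mathbb{R}^\nu$; there is a $\sigma$-finite positive measure $\mu$ on $E$ dominating all $G_{j,j'}$ such that the matrix $(g_{j,j'}(x))$, $g_{j,j'}=\frac{dG_{j,j'}}{d\mu}$, is Hermitian positive semidefinite for $\mu$-almost all $x$; $G_{j,j'}(-A)=\overline{G_{j,j'}(A)}$ for all bounded measurable $A$; and if $E=\mathbb{R}^\nu$, $\int(1+|x|)^{-r}G_{j,j}(dx)<\infty$ for all $j$ with some $r>0$. Non-atomic means $\mu(\{x\})=0$ for all $x\in E$. Integrals with respect to $G_{j,j'}(dx)$ mean integrals with respect to $g_{j,j'}(x)\mu(dx)$. $Z_G=(Z_{G,1},\dots,Z_{G,d})$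 is a vector valued random spectral measure corresponding to $G$: complex valued random variables $Z_{G,j}(A)$, $1\le j\le d$, $A\subset E$ bounded Borel, such that (i) the real and imaginary parts of any finitely many of them are jointly Gaussian; (ii) $EZ_{G,j}(A)=0$; (iii) $EZ_{G,j}(A)\overline{Z_{G,j'}(B)}=G_{j,j'}(A\cap B)$; (iv) $\sum_{s=1}^nZ_{G,j}(A_s)=Z_{G,j}(\bigcup_{s=1}^nA_s)$ for disjoint $A_1,\dots,A_n$; (v) $Z_{G,j}(A)=\overline{Z_{G,j}(-A)}$. $\mathcal{K}_{n,j_1,\dots,j_n}$ is the real Hilbert space of complex valued functions $f$ on $E^n$ with (a) $f(-x_1,\dots,-x_n)=\overline{f(x_1,\dots,x_n)}$ and (b) $\|f\|^2=\int|f(x_1,\dots,x_n)|^2G_{j_1,j_1}(dx_1)\dots G_{j_n,j_n}(dx_n)<\infty$ (functions equal almost everywhere are identified). A regular system is a finite collection $\mathcal{D}=\{\Delta_k: k=\pm1,\dots,\pm N\}$ of bounded measurable sets in $E$ with $\Delta_k=-\Delta_{-k}$ and $\Delta_k\cap\Delta_l=\emptyset$ for $k\ne l$. $\hat{\mathcal{K}}_{n,j_1,\dots,j_n}$ is the class of simple functions: those $f\in\mathcal{K}_{n,j_1,\dots,j_n}$ for which there is a regular system such that $f$ is constant on each set $\Delta_{k_1}\times\dots\times\Delta_{k_n}$, vanishes outside these sets, and vanishes on those of them with $k_l=\pm k_{l'}$ for some $l\ne l'$. For such $f$, $$I_n(f|j_1,\dots,j_n)=\sum_{k_1,\dots,k_n\in\{\pm1,\dots,\pm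 N\}}f(u_{k_1},\dots,u_{k_n})Z_{G,j_1}(\Delta_{k_1})\cdots Z_{G,j_n}(\Delta_{k_n}),\quad u_k\in\Delta_k,$$ which does not depend on the choice of the regular system. *)

(* Defs.v *)
From HB Require Import structures.
From mathcomp Require Import all_boot all_order all_fingroup all_algebra.
From mathcomp Require complex.
From mathcomp Require Import all_classical all_reals all_analysis.
Import complex.

Set Implicit Arguments.
Unset Strict Implicit.
Unset Printing Implicit Defensive.

Import Order.TTheory GRing.Theory Num.Theory.
Import numFieldNormedType.Exports.

Local Open Scope classical_set_scope.
Local Open Scope ring_scope.

(* R[i] carries no measurable structure in the library: measurability and
   integrals of complex functions go through real and imaginary parts. *)
Section complex_integration.
Context {R : realType} {d} {T : measurableType d}.
Implicit Types (mu : {measure set T -> \bar R}) (D : set T) (f : T -> R[i]).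

Definition cmeasurable D f :=
  measurable_fun D (fun x => complex.Re (f x)) /\
  measurable_fun D (fun x => complex.Im (f x)).

Definition cintegrable mu D f :=
  mu.-integrable D (fun x => (complex.Re (f x))%:E) /\
  mu.-integrable D (fun x => (complex.Im (f x))%:E).

Definition cintegral mu D f : R[i] :=
  Complex (Rintegral mu D (fun x => complex.Re (f x)))
          (Rintegral mu D (fun x => complex.Im (f x))).

End complex_integration.

Definition cmod {R : realType} : R[i] -> R := @ComplexField.Normc.normc R.

(* The n-fold product mu(dx_1) ... mu(dx_n), which the library only has for two
   factors; see power_measure_box. *)
Section power_measure.
Context {d} {T : measurableType d} {R : realType}.

Definition cons_pair n (p : T * n.-tuple T) : n.+1.-tuple T :=
  [tuple of p.1 :: p.2].

Lemma measurable_cons_pair n : measurable_fun setT (@cons_pair n).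
Proof. by apply: measurable_cons; [exact: measurable_fst|exact: measurable_snd]. Qed.

Section step.
Variables (mu : {sigma_finite_measure set T -> \bar R}) (n : nat).
Variable mun : {sigma_finite_measure set (n.-tuple T) -> \bar R}.
Local Open Scope ereal_scope.

Definition power_step : set (n.+1.-tuple T) -> \bar R :=
  pushforward (mu \x mun) (@cons_pair n).

Let step0 : power_step set0 = 0.
Proof. by rewrite /power_step /pushforward preimage_set0 measure0. Qed.

Let mpre A : measurable A -> measurable (@cons_pair n @^-1` A).
Proof. by move=> mA; rewrite -[X in measurable X]setTI; exact: measurable_cons_pair. Qed.

Let step_ge0 A : 0 <= power_step A.
Proof. by rewrite /power_step /pushforward; exact: measure_ge0. Qed.

Let step_sigma_additive : semi_sigma_additive power_step.
Proof.
move=> F mF tF mUF; rewrite /power_step /pushforward preimage_bigcup.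
apply: measure_semi_sigma_additive.
- by move=> i; exact: mpre.
- apply/trivIsetP => /= i j _ _ ij; rewrite -preimage_setI.
  by move/trivIsetP : tF => /(_ _ _ _ _ ij) ->//; rewrite preimage_set0.
- by rewrite -preimage_bigcup; exact: mpre.
Qed.

HB.instance Definition _ := isMeasure.Build _ _ _
  power_step step0 step_ge0 step_sigma_additive.

Let step_sigma_finite : sigma_finite setT power_step.
Proof.
have /sigma_finiteP[F [FT ndF Foo]] := sigma_finiteT mu.
have /sigma_finiteP[H [HT ndH Hoo]] := sigma_finiteT mun.
pose split_tuple (t : n.+1.-tuple T) := (thead t, [tuple of behead t]).
exists (fun k => split_tuple @^-1` (F k `*` H k)).
  apply/seteqP; split => // t _.
  have [k _ Fk] : (\bigcup_k F k) (thead t) by rewrite -FT.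
  have [l _ Hl] : (\bigcup_k H k) [tuple of behead t] by rewrite -HT.
  exists (maxn k l) => //; split => /=.
    by move: Fk; exact/subsetPset/ndF/leq_maxl.
  by move: Hl; exact/subsetPset/ndH/leq_maxr.
move=> k; have [mF Fk] := Foo k; have [mH Hk] := Hoo k; split.
  rewrite -[X in measurable X]setTI.
  have : measurable_fun setT split_tuple.
    by apply: measurable_fun_pair; [exact: measurable_tnth|exact: measurable_behead].
  by apply => //; exact: measurableX.
rewrite /power_step /pushforward -comp_preimage (_ : _ @^-1` _ = F k `*` H k).
  by rewrite product_measure1E// lte_mul_pinfty// ge0_fin_numE.
have splitK p : split_tuple (@cons_pair n p) = p.
  by case: p => x t; congr pair; exact/val_inj.
have -> : split_tuple \o @cons_pair n = id by apply/funext => p; exact: splitK.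
by [].
Qed.

HB.instance Definition _ := Measure_isSigmaFinite.Build _ _ _
  power_step step_sigma_finite.

End step.

Fixpoint power_measure (mu : {sigma_finite_measure set T -> \bar R}) n :
    {sigma_finite_measure set (n.-tuple T) -> \bar R} :=
  match n with
  | 0 => dirac [tuple]
  | m.+1 => power_step mu (power_measure mu m)
  end.

Lemma power_measure_box (mu : {sigma_finite_measure set T -> \bar R}) n
    (A : 'I_n -> set T) : (forall i, measurable (A i)) ->
  power_measure mu n [set t | forall i, A i (tnth t i)] =
  (\prod_(i < n) mu (A i))%E.
Proof.
elim: n A => [|n IHn] A mA.
  by rewrite big_ord0 /= diracE mem_set//= => -[].
rewrite big_ord_recl /= /power_step /pushforward.
pose B := [set t : n.-tuple T | forall i, A (lift ord0 i) (tnth t i)].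
have mB : measurable B.
  rewrite (_ : B = \bigcap_(i in [set: 'I_n]) ((@tnth n T)^~ i @^-1` A (lift ord0 i))).
    apply: fin_bigcap_measurable => // i _.
    by rewrite -[X in measurable X]setTI; exact: measurable_tnth.
  by apply/seteqP; split=> t Bt; [move=> i _; exact: Bt|move=> i; exact: Bt].
rewrite (_ : _ @^-1` _ = A ord0 `*` B).
  by rewrite product_measure1E// -IHn.
apply/seteqP; split=> [[x t] /= h|[x t] [/= Ax Bt] i].
  split=> /=; first exact: (h ord0).
  by move=> i; have := h (lift ord0 i); rewrite tnthS.
by case: (unliftP ord0 i) => [l ->|->//]; rewrite tnthS; exact: Bt.
Qed.

End power_measure.

Inductive space_kind := Euclidean | Torus.

Section space.
Variables (R : realType) (k : space_kind) (nu : nat).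
Local Notation point := (nu.-tuple R).

(* E as a set of points of R^nu.  A measure on the torus is represented by a
   measure on R^nu of which only the restriction to this set is used. *)
Definition space : set point :=
  match k with
  | Euclidean => setT
  | Torus => [set x | forall i, - pi <= tnth x i < pi]
  end.

(* On the torus - (- pi) = pi is identified with - pi. *)
Definition neg1 (t : R) : R :=
  match k with
  | Euclidean => - t
  | Torus => if t == - pi then - pi else - t
  end.

Definition neg (x : point) : point := [tuple neg1 (tnth x i) | i < nu].

Definition neg_tuple n (x : n.-tuple point) : n.-tuple point :=
  [tuple neg (tnth x i) | i < n].

Definition space_pow n : set (n.-tuple point) :=
  [set x | forall i, space (tnth x i)].

Definition cube (T : R) : set point := [set x | forall i, `|tnth x i| <= T].

Definition bounded_borel (A : set point) :=
  [/\ measurable A, A `<=` space & exists T, A `<=` cube T].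

Definition enorm (x : point) : R := Num.sqrt (\sum_(i < nu) tnth x i ^+ 2).

Definition total_variation (m : set point -> R[i]) (A : set point) : \bar R :=
  ereal_sup [set s | exists p (B : 'I_p -> set point),
    [/\ forall i, measurable (B i) /\ B i `<=` A,
        forall i j, i != j -> B i `&` B j = set0
      & s = (\sum_(i < p) cmod (m (B i)))%:E]].

(* Countable additivity within the bounded Borel sets, and finite total
   variation on each cube.  All Borel subsets of the torus are bounded and the
   torus lies in a cube: there, m is a complex measure of finite variation. *)
Record locally_finite_complex_measure (m : set point -> R[i]) : Prop := {
  lfcm_sigma_additive : forall A : nat -> set point,
    (forall p, bounded_borel (A p)) -> trivIset setT A ->
    bounded_borel (\bigcup_p A p) ->
    (\sum_(p < q) complex.Re (m (A p)) @[q --> \oo]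
      --> complex.Re (m (\bigcup_p A p))) /\
    (\sum_(p < q) complex.Im (m (A p)) @[q --> \oo]
      --> complex.Im (m (\bigcup_p A p)));
  lfcm_variation : forall T, (total_variation m (cube T `&` space) < +oo)%E
}.

End space.

Arguments space : clear implicits.
Arguments space_pow : clear implicits.
Arguments neg {R} k {nu} x.
Arguments neg_tuple {R} k {nu n} x.
Arguments bounded_borel {R} k {nu} A.
Arguments locally_finite_complex_measure {R} k {nu} m.

Definition hermitian_psd {R : realType} {d} (M : 'I_d -> 'I_d -> R[i]) :=
  (forall j j', M j' j = conjc (M j j')) /\
  (forall v : 'I_d -> R[i],
     0 <= \sum_(j < d) \sum_(j' < d) v j * M j j' * conjc (v j')).

(* G together with a dominating measure mu and the densities g = dG/dmu. *)
Record spectral_measure (R : realType) (k : space_kind) (nu d : nat) := {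
  sm_G : 'I_d -> 'I_d -> set (nu.-tuple R) -> R[i];
  sm_mu : {sigma_finite_measure set (nu.-tuple R) -> \bar R};
  sm_g : 'I_d -> 'I_d -> nu.-tuple R -> R[i];
  sm_complex_measure : forall j j',
    locally_finite_complex_measure k (sm_G j j');
  sm_dominated : forall j j' A, bounded_borel k A ->
    sm_mu A = 0%E -> sm_G j j' A = 0;
  sm_g_measurable : forall j j', cmeasurable (space R k nu) (sm_g j j');
  sm_density : forall j j' A, bounded_borel k A ->
    cintegrable sm_mu A (sm_g j j') /\
    sm_G j j' A = cintegral sm_mu A (sm_g j j');
  sm_psd : {ae sm_mu, forall x, space R k nu x ->
    hermitian_psd (fun j j' => sm_g j j' x)};
  sm_even : forall j j' A, bounded_borel k A ->
    sm_G j j' (neg k @` A) = conjc (sm_G j j' A);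
  sm_growth : k = Euclidean -> exists2 r : R, 0 < r &
    forall j, (\int[sm_mu]_(x in space R k nu)
      ((1 + enorm x) `^ (- r) * complex.Re (sm_g j j x))%:E < +oo)%E
}.

Section function_spaces.
Context {R : realType} {k : space_kind} {nu d : nat}.
Variable G : spectral_measure R k nu d.
Local Notation point := (nu.-tuple R).
Local Notation E := (space R k nu).
Local Notation En := (space_pow R k nu).

Definition nonatomic := forall x, E x -> sm_mu G [set x] = 0%E.

(* The density of G_{j_1,j'_1}(dx_1) ... G_{j_n,j'_n}(dx_n) with respect to
   mu(dx_1) ... mu(dx_n). *)
Definition prod_density n (j j' : 'I_n -> 'I_d) (x : n.-tuple point) : R[i] :=
  \prod_(i < n) sm_g G (j i) (j' i) (tnth x i).

(* ||f||^2; the density is real and nonnegative almost everywhere on E^n. *)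
Definition sqnorm n (j : 'I_n -> 'I_d) (f : n.-tuple point -> R[i]) : \bar R :=
  (\int[power_measure (sm_mu G) n]_(x in En n)
     (cmod (f x) ^+ 2 * complex.Re (prod_density j j x))%:E)%E.

Record in_K n (j : 'I_n -> 'I_d) (f : n.-tuple point -> R[i]) : Prop := {
  K_measurable : cmeasurable (En n) f;
  K_even : forall x, En n x -> f (neg_tuple k x) = conjc (f x);
  K_norm : (sqnorm j f < +oo)%E
}.

(* The indices +-1, ..., +-N: (i, false) stands for i + 1 and (i, true) for
   - (i + 1), where i < N. *)
Definition sindex N : finType := ('I_N * bool)%type.
Definition sopp N (a : sindex N) : sindex N := (a.1, ~~ a.2).

Record regular_system N (D : sindex N -> set point) : Prop := {
  rs_bounded : forall a, bounded_borel k (D a);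
  rs_neg : forall a, D a = neg k @` D (sopp a);
  rs_disjoint : forall a b, a != b -> D a `&` D b = set0
}.

Definition box N n (D : sindex N -> set point) (a : 'I_n -> sindex N) :
    set (n.-tuple point) :=
  [set x | forall i, D (a i) (tnth x i)].

Record adapted N (D : sindex N -> set point) n (f : n.-tuple point -> R[i]) :
    Prop := {
  adapted_const : forall (a : 'I_n -> sindex N) x y,
    box D a x -> box D a y -> f x = f y;
  adapted_out : forall x, En n x ->
    (forall a : 'I_n -> sindex N, ~ box D a x) -> f x = 0;
  adapted_diag : forall (a : 'I_n -> sindex N) x, box D a x ->
    (exists l l', l != l' /\ (a l = a l' \/ a l = sopp (a l'))) -> f x = 0
}.

Definition in_Khat n (j : 'I_n -> 'I_d) (f : n.-tuple point -> R[i]) :=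
  in_K j f /\ exists N (D : sindex N -> set point),
    regular_system D /\ adapted D f.

End function_spaces.

Section random.
Context {R : realType} {dO} {Omega : measurableType dO}.
Variable P : probability Omega R.

(* A possibly degenerate normal law; the case s = 0 is separate because
   normal_prob m 0 is not the Dirac mass at m. *)
Definition gaussian (X : Omega -> R) :=
  measurable_fun setT X /\ exists m s : R, forall B : set R, measurable B ->
    P (X @^-1` B) = if s == 0 then dirac m B else normal_prob m s B.

Definition jointly_gaussian (I : finType) (X : I -> Omega -> R) :=
  forall c : I -> R, gaussian (fun w => \sum_i c i * X i w).

Definition cexpectation (X : Omega -> R[i]) : R[i] := cintegral P setT X.

Definition second_moment (X : Omega -> R[i]) : \bar R :=
  (\int[P]_w (cmod (X w) ^+ 2)%:E)%E.

Context {k : space_kind} {nu d : nat}.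
Variable G : spectral_measure R k nu d.
Local Notation point := (nu.-tuple R).
Variable Z : 'I_d -> set point -> Omega -> R[i].

(* Identities between random variables hold almost surely. *)
Record random_spectral_measure : Prop := {
  rsm_measurable : forall j A, bounded_borel k A -> cmeasurable setT (Z j A);
  rsm_gaussian : forall p (j : 'I_p -> 'I_d) (A : 'I_p -> set point),
    (forall i, bounded_borel k (A i)) ->
    jointly_gaussian (fun (ib : 'I_p * bool) w =>
      if ib.2 then complex.Re (Z (j ib.1) (A ib.1) w)
      else complex.Im (Z (j ib.1) (A ib.1) w));
  rsm_mean : forall j A, bounded_borel k A -> cexpectation (Z j A) = 0;
  rsm_cov : forall j j' A B, bounded_borel k A -> bounded_borel k B ->
    cexpectation (fun w => Z j A w * conjc (Z j' B w)) = sm_G G j j' (A `&` B);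
  rsm_additive : forall j p (A : 'I_p -> set point),
    (forall i, bounded_borel k (A i)) ->
    (forall i i', i != i' -> A i `&` A i' = set0) ->
    {ae P, forall w, \sum_(i < p) Z j (A i) w = Z j (\bigcup_i A i) w};
  rsm_even : forall j A, bounded_borel k A ->
    {ae P, forall w, Z j A w = conjc (Z j (neg k @` A) w)}
}.

(* I_n(f | j_1, ..., j_n) for f adapted to the regular system D, with u_a a
   point of D_a.  If D_a is empty then u_a is arbitrary, and Z_j(D_a) = 0 a.s. *)
Definition simple_integral N (D : sindex N -> set point) (u : sindex N -> point)
    n (j : 'I_n -> 'I_d) (f : n.-tuple point -> R[i]) (w : Omega) : R[i] :=
  \sum_(a : {ffun 'I_n -> sindex N})
    f [tuple u (a i) | i < n] * \prod_(i < n) Z (j i) (D (a i)) w.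

Definition integral_map :=
  forall n, ('I_n -> 'I_d) -> (n.-tuple point -> R[i]) -> Omega -> R[i].

(* On simple functions I is the defining sum, for every admissible choice of
   the regular system and of the points u_a. *)
Definition extends_simple_integral (I : integral_map) :=
  forall n (j : 'I_n -> 'I_d) f, (0 < n)%N -> in_K G j f ->
  forall N (D : sindex N -> set point) (u : sindex N -> point),
    regular_system (k := k) D -> adapted (k := k) D f ->
    (forall a, D a !=set0 -> D a (u a)) ->
    {ae P, forall w, I n j f w = simple_integral D u j f w}.

(* Simple functions are dense in K, and I(f) is the L_2 limit of the integrals
   of every sequence of simple functions converging to f; this determines I(f)
   almost surely by its values on simple functions. *)
Definition extends_by_L2_continuity (I : integral_map) :=
  forall n (j : 'I_n -> 'I_d) f, (0 < n)%N -> in_K G j f ->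
    (exists2 h : nat -> n.-tuple point -> R[i], (forall m, in_Khat G j (h m)) &
       sqnorm G j (fun x => h m x - f x) @[m --> \oo] --> 0%E) /\
    (forall h : nat -> n.-tuple point -> R[i], (forall m, in_Khat G j (h m)) ->
       sqnorm G j (fun x => h m x - f x) @[m --> \oo] --> 0%E ->
       second_moment (fun w => I n j (h m) w - I n j f w) @[m --> \oo] --> 0%E).

End random.

(* Main.v *)
Require Import Defs.

(* The space of simple functions is a linear space because two regular systems
   have a common regular refinement.  For simple f and h the expectation
   E I(f) I(h) is expanded into moments of the Gaussian variables Z_j(A), which
   Wick's formula expresses by covariances: since f and h vanish on the cells
   with k_l = +- k_l', only the pairings of a variable of I(f) with one of I(h)
   survive, and these are indexed by permutations.  The resulting bilinear form
   on K is bounded by n! ||f|| ||h||, by the Cauchy-Schwarz inequality for the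
   positive semidefinite matrices g(x).  Simple functions are dense in K:
   finite sums of indicators of boxes are dense, they can be made even by
   symmetrization, and cutting off the cells near the diagonals x_l = +- x_l'
   costs little, these diagonals being null sets of the non-atomic measure.
   So I extends to an L_2 limit, and all relations follow from
   E I(f) I(h) = form f h, which passes to the limit. *)

From HB Require Import structures.
From mathcomp Require Import all_boot all_order all_fingroup all_algebra.
From mathcomp Require complex.
From mathcomp Require Import all_classical all_reals all_analysis.
From mathcomp Require Import measurable_realfun.
From mathcomp Require Import ring lra.
Import complex.

Import Order.TTheory GRing.Theory Num.Theory.
Import numFieldNormedType.Exports.

Local Open Scope classical_set_scope.
Local Open Scope ring_scope.

Set Implicit Arguments.
Unset Strict Implicit.
Unset Printing Implicit Defensive.
Local Notation space := Defs.space.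
Local Notation Re := complex.Re.
Local Notation Im := complex.Im.

(** * Complex-valued functions *)

Section complex_square.
Context {R : realType}.
Implicit Types x y z : R[i].

(** Joint Gaussianity is given only through the laws of real linear combinations, so Wick's formula
    has to be derived from one-dimensional laws. Integrating the derivative of x^k times the normal
    density gives E X^(p+2) = (p+1) E X^2 E X^p. Since E (X + t W)^m is a polynomial in t, comparing
    coefficients polarizes this recursion to products of different variables, and the value t = i
    passes to complex combinations. The dominating measure is not assumed invariant under x |-> -x,
    so approximation is carried out for integrands added to their reflections. The extension is
    described by a relation, [approximated]: a function and a random variable are approximated
    together by a simple function and its integral. Identities are proved for all pairs in this
    relation, which also yields uniqueness, linearity and continuity. Estimates use (r a + b / r) /
    2 with a free r > 0 instead of the square root of a b, so that only squared norms occur. *)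

Definition csq z : R := Re z ^+ 2 + Im z ^+ 2.

Lemma cmod_sq z : cmod z ^+ 2 = csq z.
Proof. by case: z => a b; rewrite sqr_sqrtr// addr_ge0 ?sqr_ge0. Qed.

Lemma csq_ge0 z : 0 <= csq z.
Proof. by rewrite addr_ge0 ?sqr_ge0. Qed.

Lemma ReD x y : Re (x + y) = Re x + Re y.
Proof. by case: x y => [a b] [c e]. Qed.

Lemma ImD x y : Im (x + y) = Im x + Im y.
Proof. by case: x y => [a b] [c e]. Qed.

Lemma ReN x : Re (- x) = - Re x.
Proof. by case: x. Qed.

Lemma ImN x : Im (- x) = - Im x.
Proof. by case: x. Qed.

Lemma ReM x y : Re (x * y) =
  Re x * Re y - Im x * Im y.
Proof. by case: x y => [a b] [c e]. Qed.

Lemma ImM x y : Im (x * y) =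
  Re x * Im y + Im x * Re y.
Proof. by case: x y => [a b] [c e]. Qed.

Lemma ReJ x : Re (conjc x) = Re x.
Proof. by case: x. Qed.

Lemma ImJ x : Im (conjc x) = - Im x.
Proof. by case: x. Qed.

Lemma Re_sum I (s : seq I) (Q : pred I) (F : I -> R[i]) :
  Re (\sum_(i <- s | Q i) F i) = \sum_(i <- s | Q i) Re (F i).
Proof. by rewrite (big_morph (@complex.Re R) ReD (erefl _)). Qed.

Lemma Im_sum I (s : seq I) (Q : pred I) (F : I -> R[i]) :
  Im (\sum_(i <- s | Q i) F i) = \sum_(i <- s | Q i) Im (F i).
Proof. by rewrite (big_morph (@complex.Im R) ImD (erefl _)). Qed.

Lemma complexP x y :
  Re x = Re y -> Im x = Im y -> x = y.
Proof. by case: x y => [a b] [c e] /= -> ->. Qed.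

Lemma csqM x y : csq (x * y) = csq x * csq y.
Proof. by rewrite /csq ReM ImM; ring. Qed.

Lemma csq0 : csq 0 = 0.
Proof. by rewrite /csq /= expr0n addr0. Qed.

Lemma csqJ x : csq (conjc x) = csq x.
Proof. by rewrite /csq ReJ ImJ sqrrN. Qed.

Lemma csqN x : csq (- x) = csq x.
Proof. by rewrite /csq ReN ImN !sqrrN. Qed.

Lemma csq_real (a : R) : csq (a%:C)%C = a ^+ 2.
Proof. by rewrite /csq /= expr0n addr0. Qed.

Lemma csqD_le x y : csq (x + y) <= 2 * csq x + 2 * csq y.
Proof.
rewrite /csq ReD ImD -subr_ge0.
set a := Re x; set b := Re y.
set c := Im x; set e := Im y.
have -> : 2 * (a ^+ 2 + c ^+ 2) + 2 * (b ^+ 2 + e ^+ 2) -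
  ((a + b) ^+ 2 + (c + e) ^+ 2) = (a - b) ^+ 2 + (c - e) ^+ 2 by ring.
by rewrite addr_ge0 ?sqr_ge0.
Qed.

(** A bound without square roots: on a probability space it derives integrability of a complex
    variable from that of its squared modulus. *)
Lemma normr_Re_csq x : `|Re x| <= (1 + csq x).
Proof.
rewrite /csq; set a := Re x; set b := Im x.
have := sqr_ge0 (`|a| - 1); have := sqr_ge0 b; have := normr_ge0 a.
have : `|a| ^+ 2 = a ^+ 2 by rewrite real_normK ?num_real.
move=> <- ? ? ?; nra.
Qed.

Lemma normr_Im_csq x : `|Im x| <= (1 + csq x).
Proof.
rewrite /csq; set a := Re x; set b := Im x.
have := sqr_ge0 (`|b| - 1); have := sqr_ge0 a; have := normr_ge0 b.
have : `|b| ^+ 2 = b ^+ 2 by rewrite real_normK ?num_real.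
move=> <- ? ? ?; nra.
Qed.

Lemma Re_sq_le x : Re x ^+ 2 <= csq x.
Proof. by rewrite lerDl sqr_ge0. Qed.

Lemma Im_sq_le x : Im x ^+ 2 <= csq x.
Proof. by rewrite lerDr sqr_ge0. Qed.

End complex_square.

Section cmeasurable.
Context {R : realType} {d} {T : measurableType d}.
Implicit Types (D : set T) (f g : T -> R[i]).

Lemma cmeasurable_cst D (c : R[i]) : cmeasurable D (fun=> c).
Proof. by split; exact: measurable_cst. Qed.

Lemma cmeasurableD D f g : cmeasurable D f -> cmeasurable D g ->
  cmeasurable D (fun x => f x + g x).
Proof.
move=> [fr fi] [gr gi]; split.
  by under eq_fun do rewrite ReD; exact: measurable_funD.
by under eq_fun do rewrite ImD; exact: measurable_funD.
Qed.

Lemma cmeasurableM D f g : cmeasurable D f -> cmeasurable D g ->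
  cmeasurable D (fun x => f x * g x).
Proof.
move=> [fr fi] [gr gi]; split.
  by under eq_fun do rewrite ReM; apply: measurable_funB; exact: measurable_funM.
by under eq_fun do rewrite ImM; apply: measurable_funD; exact: measurable_funM.
Qed.

Lemma cmeasurableJ D f : cmeasurable D f -> cmeasurable D (fun x => conjc (f x)).
Proof.
move=> [fr fi]; split; first by under eq_fun do rewrite ReJ.
by under eq_fun do rewrite ImJ; exact: measurable_funN.
Qed.

Lemma cmeasurableB D f g : cmeasurable D f -> cmeasurable D g ->
  cmeasurable D (fun x => f x - g x).
Proof.
move=> mf mg; under eq_fun do rewrite -mulN1r.
by apply: cmeasurableD => //; apply: cmeasurableM => //; exact: cmeasurable_cst.
Qed.

Lemma cmeasurable_prod I (s : seq I) (Q : pred I) D (f : I -> T -> R[i]) :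
  (forall i, Q i -> cmeasurable D (f i)) ->
  cmeasurable D (fun x => \prod_(i <- s | Q i) f i x).
Proof.
move=> mf; elim: s => [|i s IHs].
  by under eq_fun do rewrite big_nil; exact: cmeasurable_cst.
under eq_fun do rewrite big_cons.
by case: (boolP (Q i)) => // Qi; apply: cmeasurableM => //; exact: mf.
Qed.

Lemma measurable_csq D f : cmeasurable D f -> measurable_fun D (fun x => csq (f x)).
Proof. by move=> [fr fi]; apply: measurable_funD; exact: measurable_funX. Qed.

Lemma cmeasurable_comp d' (T' : measurableType d') (D : set T) (D' : set T')
    (phi : T' -> T) f : measurable D -> phi @` D' `<=` D ->
  measurable_fun D' phi -> cmeasurable D f -> cmeasurable D' (f \o phi).
Proof.
move=> mD sD mphi [fr fi]; split.
  exact: (@measurable_comp _ _ _ _ _ _ D (fun x => Re (f x))).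
exact: (@measurable_comp _ _ _ _ _ _ D (fun x => Im (f x))).
Qed.

End cmeasurable.

Section cintegral.
Context {R : realType} {d} {T : measurableType d}.
Variables (mu : {measure set T -> \bar R}) (D : set T).
Hypothesis mD : measurable D.
Implicit Types f g : T -> R[i].

Lemma cintegrableD f g : cintegrable mu D f -> cintegrable mu D g ->
  cintegrable mu D (fun x => f x + g x).
Proof.
move=> [fr fi] [gr gi]; split.
  by under eq_fun do rewrite ReD EFinD; exact: integrableD.
by under eq_fun do rewrite ImD EFinD; exact: integrableD.
Qed.

Lemma cintegralD f g : cintegrable mu D f -> cintegrable mu D g ->
  cintegral mu D (fun x => f x + g x) = cintegral mu D f + cintegral mu D g.
Proof.
move=> [fr fi] [gr gi]; apply: complexP => /=.
  by rewrite -RintegralD//; apply: eq_Rintegral => x _; rewrite ReD.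
by rewrite -RintegralD//; apply: eq_Rintegral => x _; rewrite ImD.
Qed.

Lemma cintegrableZ c f : cintegrable mu D f ->
  cintegrable mu D (fun x => c * f x).
Proof.
move=> [fr fi]; split.
  under eq_fun do rewrite ReM EFinB !EFinM.
  by apply: integrableB => //; exact: integrableZl.
under eq_fun do rewrite ImM EFinD !EFinM.
by apply: integrableD => //; exact: integrableZl.
Qed.

Lemma cintegralZ c f : cintegrable mu D f ->
  cintegral mu D (fun x => c * f x) = c * cintegral mu D f.
Proof.
move=> [fr fi].
have I (a : R) (h : T -> R) : mu.-integrable D (EFin \o h) ->
    mu.-integrable D (EFin \o (fun x => a * h x)).
  by move=> ih; rewrite (_ : _ \o _ = (fun x => a%:E * (h x)%:E)%E)//; exact: integrableZl.
apply: complexP; rewrite ?ReM ?ImM /=.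
  rewrite -!RintegralZl// -RintegralB//; try exact: I.
  by apply: eq_Rintegral => x _; rewrite ReM.
rewrite -!RintegralZl// -RintegralD//; try exact: I.
by apply: eq_Rintegral => x _; rewrite ImM.
Qed.

Lemma cintegrable0 : cintegrable mu D (fun=> 0).
Proof. by split; exact: integrable0. Qed.

Lemma cintegrable_sum I (s : seq I) (Q : pred I) (f : I -> T -> R[i]) :
  (forall i, Q i -> cintegrable mu D (f i)) ->
  cintegrable mu D (fun x => \sum_(i <- s | Q i) f i x).
Proof.
move=> mf; elim: s => [|i s IHs].
  by under eq_fun do rewrite big_nil; exact: cintegrable0.
under eq_fun do rewrite big_cons.
by case: (boolP (Q i)) => // Qi; apply: cintegrableD => //; exact: mf.
Qed.

Lemma cintegral0 : cintegral mu D (fun=> 0) = 0.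
Proof. by rewrite /cintegral /Rintegral /= !integral0. Qed.

Lemma cintegral_sum I (s : seq I) (Q : pred I) (f : I -> T -> R[i]) :
  (forall i, Q i -> cintegrable mu D (f i)) ->
  cintegral mu D (fun x => \sum_(i <- s | Q i) f i x) =
  \sum_(i <- s | Q i) cintegral mu D (f i).
Proof.
move=> mf; elim: s => [|i s IHs].
  by under eq_fun do rewrite big_nil; rewrite big_nil cintegral0.
under [X in cintegral _ _ X]eq_fun do rewrite big_cons.
rewrite big_cons; case: (boolP (Q i)) => // Qi; rewrite cintegralD ?IHs//; first exact: mf.
exact: cintegrable_sum.
Qed.

Lemma eq_cintegral f g : (forall x, D x -> f x = g x) ->
  cintegral mu D f = cintegral mu D g.
Proof.
move=> fg; apply: complexP => /=; apply: eq_Rintegral => x /[!inE] Dx;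
  by rewrite fg.
Qed.

Lemma cintegrable_measurable f : cintegrable mu D f -> cmeasurable D f.
Proof.
by move=> [/measurable_int fr /measurable_int fi]; split; exact/measurable_EFinP.
Qed.

Lemma ae_eq_cintegral f g : cmeasurable D f -> cmeasurable D g ->
  {ae mu, forall x, D x -> f x = g x} -> cintegral mu D f = cintegral mu D g.
Proof.
move=> [fr fi] [gr gi] fg; apply: complexP => /=; congr fine.
  apply: ae_eq_integral => //; [exact/measurable_EFinP|exact/measurable_EFinP|].
  by apply: filterS fg => x h Dx; rewrite h.
apply: ae_eq_integral => //; [exact/measurable_EFinP|exact/measurable_EFinP|].
by apply: filterS fg => x h Dx; rewrite h.
Qed.

End cintegral.

Section restricted_cintegral.
Context {R : realType} {d} {T : measurableType d}.
Variable mu : {measure set T -> \bar R}.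
Implicit Types (D : set T) (f : T -> R[i]).

(** Extension by zero reduces integrals over a set to integrals over the whole space, where the
    product formula for powers of a measure is proved. *)
Definition crestrict D f x : R[i] := if x \in D then f x else 0.

Let ReR D f : (fun x => Re (crestrict D f x)) = (fun x => Re (f x)) \_ D.
Proof. by apply/funext => x; rewrite patchE /crestrict; case: ifP. Qed.

Let ImR D f : (fun x => Im (crestrict D f x)) = (fun x => Im (f x)) \_ D.
Proof. by apply/funext => x; rewrite patchE /crestrict; case: ifP. Qed.

Lemma cintegral_mkcond D f : cintegral mu D f = cintegral mu setT (crestrict D f).
Proof.
apply: complexP => /=; rewrite Rintegral_mkcond; congr Rintegral; apply/esym.
  exact: ReR.
exact: ImR.
Qed.

Lemma cintegrable_mkcond D f : measurable D ->
  cintegrable mu D f <-> cintegrable mu setT (crestrict D f).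
Proof.
move=> mD; rewrite /cintegrable.
have E (h : T -> R) : mu.-integrable D (EFin \o h) <->
    mu.-integrable setT (EFin \o (h \_ D)).
  by rewrite -restrict_EFin; apply: integrable_mkcond.
have -> : (fun x => (Re (crestrict D f x))%:E) = EFin \o ((fun x => Re (f x)) \_ D).
  by rewrite -ReR.
have -> : (fun x => (Im (crestrict D f x))%:E) = EFin \o ((fun x => Im (f x)) \_ D).
  by rewrite -ImR.
by split=> -[/E ? /E ?].
Qed.

End restricted_cintegral.

(** * Moments of normal variables *)

Section density.
Context d (T : measurableType d) (R : realType).
Variables (mu : {sigma_finite_measure set T -> \bar R}).
Variables (nu : {finite_measure set T -> \bar R}) (phi : T -> R).
Hypothesis mphi : measurable_fun setT phi.
Hypothesis phi0 : forall x, 0 <= phi x.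
Hypothesis numu : nu `<< mu.
Hypothesis nuE : forall A, measurable A ->
  nu A = (\int[mu]_(x in A) (phi x)%:E)%E.
Local Open Scope ereal_scope.

(** [phi] and the Radon-Nikodym derivative of [nu] have the same integral over every measurable set,
    hence agree almost everywhere; for the latter the change of variables is known. *)
Lemma ge0_integral_density (f : T -> \bar R) : measurable_fun setT f ->
  (forall x, 0 <= f x) ->
  \int[nu]_x f x = \int[mu]_x (f x * (phi x)%:E).
Proof.
move=> mf f0; have iRN := Radon_Nikodym_SigmaFinite.f_integrable numu.
have mE : measurable_fun setT (EFin \o phi) by exact/measurable_EFinP.
rewrite -(Radon_Nikodym_SigmaFinite.change_of_variables numu)//.
apply: ae_eq_integral => //.
- by apply: emeasurable_funM => //; exact: measurable_int iRN.
- exact: emeasurable_funM.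
apply: ae_eqe_mul2l; apply: integral_ae_eq => // A _ mA.
by rewrite -Radon_Nikodym_SigmaFinite.f_integral// nuE.
Qed.

(** Since [phi] is nonnegative, multiplication by it commutes with taking positive and negative
    parts, which reduces the claim to nonnegative functions. *)
Lemma integral_density (f : T -> R) : measurable_fun setT f ->
  mu.-integrable setT (fun x => (f x * phi x)%:E) ->
  nu.-integrable setT (EFin \o f) /\
  \int[nu]_x (f x)%:E = \int[mu]_x (f x * phi x)%:E.
Proof.
move=> mf fi; have mEf : measurable_fun setT (EFin \o f) by exact/measurable_EFinP.
split.
  apply/integrableP; split => //; rewrite ge0_integral_density//; last first.
    exact: measurableT_comp.
  move/integrableP : fi => [_]; apply: le_lt_trans.
  apply: ge0_le_integral => //.
  - by move=> x _; rewrite mule_ge0// lee_fin.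
  - by apply: emeasurable_funM; [exact: measurableT_comp|exact/measurable_EFinP].
  - by apply: measurableT_comp => //; exact/measurable_EFinP/measurable_funM.
  - by move=> x _ /=; rewrite -EFinM lee_fin normrM (ger0_norm (phi0 x)).
rewrite [LHS]integralE [RHS]integralE; congr (_ - _).
  rewrite ge0_integral_density//; last exact: measurable_funepos.
  apply: eq_integral => x _; rewrite !funeposE /= -!EFin_max -EFinM.
  by rewrite maxr_pMl ?mul0r.
rewrite ge0_integral_density//; last exact: measurable_funeneg.
apply: eq_integral => x _; rewrite !funenegE /= -!EFin_max -EFinM.
by rewrite maxr_pMl ?mul0r// mulNr.
Qed.

End density.

Section normal_moments.
Context {R : realType}.
Variables (m s : R).
Hypothesis s0 : s != 0.
Local Notation mu := (@lebesgue_measure R).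
Local Notation phi := (normal_pdf m s).

Let s2_neq0 : s ^+ 2 *+ 2 != 0.
Proof. by rewrite mulrn_eq0 /= sqrf_eq0. Qed.

(** Completing the square: tilting by e^(+-x) shifts the mean by +-s^2. The condition [e ^+ 2 = 1]
    treats both signs at once. *)
Lemma normal_pdf_tilt (e x : R) : e ^+ 2 = 1 ->
  expR (e * x) * phi x =
  expR (e * m + s ^+ 2 / 2) * normal_pdf (m + e * s ^+ 2) s x.
Proof.
move=> e2; rewrite !normal_pdfE//= /normal_fun.
rewrite mulrCA [RHS]mulrCA; congr (_ * _); rewrite -!expRD; congr expR.
rewrite -[e * x](mulfK s2_neq0) -[e * m + _](mulfK s2_neq0) -!mulrDl.
congr (_ / _).
have -> : (e * m + s ^+ 2 / 2) * (s ^+ 2 *+ 2) =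
   e * m * (s ^+ 2 *+ 2) + e ^+ 2 * s ^+ 4.
  by rewrite e2 mul1r; field.
by ring.
Qed.

(* Since e^|x| <= e^x + e^-x and e^(+-x) tilts a normal density into a multiple
   of another one, this integrable function dominates all moments. *)
Definition normal_dom (x : R) : R :=
  expR (m + s ^+ 2 / 2) * normal_pdf (m + s ^+ 2) s x
  + expR (- m + s ^+ 2 / 2) * normal_pdf (m - s ^+ 2) s x.

(** The power is absorbed by a single term of the exponential series: |x|^k <= k! e^|x|. *)
Lemma normal_moment_bound k x : `|x ^+ k * phi x| <= k`!%:R * normal_dom x.
Proof.
have p0 : 0 <= phi x by exact: normal_pdf_ge0.
rewrite normrM (ger0_norm p0) normrX.
have h : `|x| ^+ k <= k`!%:R * (expR x + expR (- x)).
  have h1 : `|x| ^+ k <= k`!%:R * expR `|x|.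
    case: k => [|k].
      by rewrite expr0 mul1r -expR0 ler_expR.
    rewrite mulrC -ler_pdivrMr ?ltr0n ?fact_gt0//.
    apply: le_trans (expR_ge1Dxn k (normr_ge0 x)).
    by rewrite lerDr.
  apply: (le_trans h1); rewrite ler_wpM2l//.
  by case: (ger0P x) => _; rewrite ?lerDl ?lerDr expR_ge0.
apply: (le_trans (ler_wpM2r p0 h)).
rewrite -mulrA ler_wpM2l// mulrDl /normal_dom.
have := @normal_pdf_tilt 1 x; rewrite !mul1r => ->; last by rewrite expr1n.
have := @normal_pdf_tilt (-1) x; rewrite !mulN1r => ->//.
by rewrite sqrrN expr1n.
Qed.

Lemma integrable_normal_dom : mu.-integrable setT (EFin \o normal_dom).
Proof.
rewrite (_ : EFin \o _ = (fun x => (expR (m + s ^+ 2 / 2))%:E *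
    (normal_pdf (m + s ^+ 2) s x)%:E)%E \+
   (fun x => (expR (- m + s ^+ 2 / 2))%:E *
    (normal_pdf (m - s ^+ 2) s x)%:E)%E)//.
by apply: integrableD => //; apply: integrableZl => //;
  exact: integrable_normal_pdf.
Qed.

Lemma measurable_normal_moment k : measurable_fun setT (fun x : R => x ^+ k * phi x).
Proof.
by apply: measurable_funM; [exact: measurable_funX|exact: measurable_normal_pdf].
Qed.

Lemma integrable_normal_moment k :
  mu.-integrable setT (fun x : R => (x ^+ k * phi x)%:E).
Proof.
apply: (@le_integrable _ _ _ mu _ _ _ (fun x => (k`!%:R)%:E * (normal_dom x)%:E)%E) => //.
- by apply/measurable_EFinP; exact: measurable_normal_moment.
- move=> x _ /=; rewrite lee_fin.
  by apply: (le_trans (normal_moment_bound k x)); rewrite ler_norm.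
- by apply: integrableZl => //; exact: integrable_normal_dom.
Qed.

End normal_moments.

Section normal_stein.
Context {R : realType}.
Variables (m s : R).
Hypothesis s0 : s != 0.
Local Notation mu := (@lebesgue_measure R).
Local Notation phi := (normal_pdf m s).

(** The exponent of the density as a polynomial, so that its derivative is obtained by polynomial
    algebra. *)
Let quad : {poly R} := (- (s ^+ 2 *+ 2)^-1)%:P * ('X - m%:P) ^+ 2.
Lemma is_derive_poly_normal_pdf (p : {poly R}) (x : R) :
  is_derive x 1 (fun y : R => p.[y] * phi y)
   ((p^`() - (s ^+ 2)^-1%:P * ('X - m%:P) * p).[x] * phi x).
Proof.
have E y : phi y = normal_peak s * expR (horner quad y).
  rewrite normal_pdfE// /normal_fun; congr (_ * expR _).
  by rewrite /quad !hornerE /=; field.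
have -> : (fun y : R => p.[y] * phi y) =
   (horner p * (normal_peak s \*: (expR \o horner quad))) :> (R -> R).
  by apply/funext => y; rewrite E.
have he : is_derive x 1 (expR \o horner quad) (expR (quad.[x]) * quad^`().[x]).
  exact: is_derive1_comp.
have hz : is_derive x 1 (normal_peak s \*: (expR \o horner quad)) (normal_peak s *: (expR (quad.[x]) * quad^`().[x])).
  exact: is_deriveZ.
have hp : is_derive x 1 (horner p) (p^`().[x]) by exact: is_derive_poly.
have h := is_deriveM hp hz.
suff -> : (p^`() - (s ^+ 2)^-1%:P * ('X - m%:P) * p).[x] * phi x =
   p.[x] * (normal_peak s * (expR quad.[x] * quad^`().[x])) +
   (normal_peak s * expR quad.[x]) * p^`().[x] by exact: h.
rewrite E.
have -> : quad^`().[x] = - (s ^+ 2)^-1 * (x - m).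
  rewrite /quad deriv_mulC deriv_exp derivXsubC !hornerE /=.
  by field.
rewrite !hornerE /=. set e := expR _. set n_ := normal_peak s. set r := s ^- 2. ring.
Qed.

(** The derivative of [F k], that is, of x^k times the density. That its integral vanishes is the
    recursion between the moments. *)
Let f k (x : R) : R :=
  (('X^k)^`() - (s ^+ 2)^-1%:P * ('X - m%:P) * 'X^k).[x] * phi x.
Let F k (x : R) : R := ('X^k).[x] * phi x.

Let fE k x : f k x = (k%:R * (x ^+ k.-1 * phi x) - (s ^+ 2)^-1 * (x ^+ k.+1 * phi x))
   + (s ^+ 2)^-1 * m * (x ^+ k * phi x).
Proof.
rewrite /f derivXn !hornerE hornerMn !hornerE /=.
by set r := s ^- 2; rewrite -mulr_natl exprS; ring.
Qed.

Let integrable_f k : mu.-integrable setT (EFin \o f k).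
Proof.
rewrite (_ : _ \o _ = ((fun x : R => k%:R%:E * (x ^+ k.-1 * phi x)%:E)%E \+
   (fun x : R => (- (s ^+ 2)^-1)%:E * (x ^+ k.+1 * phi x)%:E)%E) \+
   (fun x : R => ((s ^+ 2)^-1 * m)%:E * (x ^+ k * phi x)%:E)%E).
  by apply: integrableD => //; [apply: integrableD => //|]; apply: integrableZl => //;
    exact: integrable_normal_moment.
by apply/funext => x /=; rewrite fE -mulNr !EFinD !EFinM.
Qed.

Let normal_dom_ub : exists2 C : R, 0 <= C & forall x, normal_dom m s x <= C.
Proof.
have hx u : 0 <= expR u * normal_peak s :> R.
  by rewrite mulr_ge0 ?expR_ge0 ?normal_peak_ge0.
exists (expR (m + s ^+ 2 / 2) * normal_peak s +
        expR (- m + s ^+ 2 / 2) * normal_peak s).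
  by rewrite addr_ge0 ?hx.
by move=> x; apply: lerD; rewrite ler_wpM2l ?expR_ge0 ?normal_pdf_ub.
Qed.

(** The bound on x^(k+1) times the density leaves a factor 1/n for x^k times the density. The sign
    [e] stands for the two ends of the line. *)
Let F_cvg k (e : R) : e ^+ 2 = 1 -> F k (e * n%:R) @[n --> \oo] --> (0 : R).
Proof.
move=> e2; have [C C0 hC] := normal_dom_ub.
have ne : `|e| = 1 by apply/eqP; rewrite -sqrp_eq1 ?real_normK ?num_real// e2.
apply/cvgr0Pnorm_lt => eps eps0; near=> n.
have n0 : 0 < n%:R :> R by rewrite ltr0n; near: n; exists 1%N.
have : `|(e * n%:R) ^+ k.+1 * phi (e * n%:R)| <= k.+1`!%:R * C.
  apply: le_trans (normal_moment_bound m s0 _ _) _.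
  by rewrite ler_wpM2l.
rewrite exprS -mulrA normrM normrM ne mul1r (ger0_norm (ltW n0)).
rewrite -ler_pdivlMl// => h.
rewrite /F hornerXn; apply: le_lt_trans h _.
rewrite mulrC ltr_pdivrMr// -ltr_pdivrMl//.
near: n; exact: nbhs_infty_gtr.
Unshelve. all: by end_near. Qed.

(** On bounded intervals the fundamental theorem of calculus leaves boundary values of [F k], which
    tend to 0, while dominated convergence yields the integral over the line. *)
Lemma integral_normal_deriv k : (\int[mu]_x (f k x)%:E = 0)%E.
Proof.
(* The endpoints n + 1, instead of n, keep the interval nondegenerate, as the fundamental theorem of
   calculus requires. *)
pose D (n : nat) := `[- (n.+1%:R : R), (n.+1%:R : R)]%classic.
have h1 : (\int[mu]_x ((f k \_ (D n)) x)%:E @[n --> \oo] --> \int[mu]_x (f k x)%:E)%E.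
  apply: (@dominated_cvg _ _ _ mu setT measurableT _ _ (fun x => `|f k x|%:E)) => //.
  - move=> n; apply/measurable_EFinP; apply/(measurable_restrictT _ _).1; first exact: measurable_itv.
    apply: measurable_funTS; apply/measurable_EFinP.
    by have /integrableP[] := integrable_f k.
  - move=> x _; apply: cvg_near_cst; near=> n; congr (_%:E).
    rewrite patchE mem_set// /D /= in_itv /= -ler_norml.
    near: n; exists (Num.truncn `|x|) => // n /= hn.
    by rewrite (le_trans (ltW (truncnS_gt _)))// ler_nat.
  - exact: integrable_norm.
  - by move=> n x _ /=; rewrite lee_fin patchE; case: ifP => // _; rewrite normr0.
have h2 : (\int[mu]_x ((f k \_ (D n)) x)%:E @[n --> \oo] --> (0%R)%:E)%E.
  rewrite [X in X @ _ --> _](_ : _ = (fun n : nat => (F k (1 * n.+1%:R) - F k (-1 * n.+1%:R))%:E)).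
    apply/cvg_EFin; first by near=> n.
    rewrite -(subr0 0); apply: cvgB.
      by have := F_cvg k (expr1n R 2); rewrite -cvg_shiftS.
    have := @F_cvg k (-1); rewrite sqrrN expr1n => /(_ erefl).
    by rewrite -cvg_shiftS.
  apply/funext => n.
  transitivity (\int[mu]_(x in D n) (f k x)%:E)%E.
    by rewrite [RHS]integral_mkcond; apply: eq_integral => x _; rewrite restrict_EFin.
  rewrite mul1r mulN1r.
  rewrite (@continuous_FTC2 R _ (F k)) //.
  - by rewrite -subr_gt0 opprK addr_gt0.
  - apply/continuous_subspaceT => x.
    apply: cvgM; last exact: continuous_normal_pdf.
    exact: continuous_horner.
  - have dF x : derivable (F k) x 1.
      exact: (@ex_derive _ _ _ _ _ _ _ (is_derive_poly_normal_pdf 'X^k x)).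
    have cF : continuous (F k).
      by move=> x; apply/differentiable_continuous/derivable1_diffP.
    split=> //; first by apply: cvg_at_right_filter; exact: cF.
    by apply: cvg_at_left_filter; exact: cF.
  - move=> x _; rewrite derive1E.
    exact: (@derive_val _ _ _ _ _ _ _ (is_derive_poly_normal_pdf 'X^k x)).
by rewrite -(cvg_lim _ h1)// (cvg_lim _ h2).
Unshelve. all: by end_near. Qed.

Definition normal_moment k : R := Rintegral mu setT (fun x => x ^+ k * phi x).

(** Stein's identity E (X - m) X^k = s^2 k E X^(k-1). At k = 0 the truncated predecessor is
    harmless, its coefficient being 0. *)
Lemma normal_moment_rec k :
  normal_moment k.+1 = m * normal_moment k + s ^+ 2 * k%:R * normal_moment k.-1.
Proof.
have I j c : mu.-integrable setT (EFin \o (fun x : R => c * (x ^+ j * phi x))).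
  rewrite (_ : _ \o _ = (fun x : R => c%:E * (x ^+ j * phi x)%:E)%E)//.
  by apply: integrableZl => //; exact: integrable_normal_moment.
have : Rintegral mu setT (fun x : R => (k%:R * (x ^+ k.-1 * phi x) +
    (- (s ^+ 2)^-1) * (x ^+ k.+1 * phi x))
   + (s ^+ 2)^-1 * m * (x ^+ k * phi x)) = 0.
  transitivity (Rintegral mu setT (f k)); last by rewrite /Rintegral integral_normal_deriv.
  by apply: eq_Rintegral => x _; rewrite -/(f k x) fE -mulNr.
rewrite RintegralD//; last exact: (integrableD measurableT (I _ _) (I _ _)).
rewrite RintegralD// !RintegralZl//; try exact: integrable_normal_moment.
rewrite -!/(normal_moment _) => h.
have s20 : s ^+ 2 != 0 by rewrite sqrf_eq0.
have : normal_moment k.+1 = m * normal_moment k + s ^+ 2 * k%:R * normal_moment k.-1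
  - s ^+ 2 * (k%:R * normal_moment k.-1 + - s ^- 2 * normal_moment k.+1 +
      s ^- 2 * m * normal_moment k) by field.
by rewrite h mulr0 subr0.
Qed.

Lemma normal_moment0 : normal_moment 0 = 1.
Proof.
transitivity (Rintegral mu setT phi); last by rewrite /Rintegral integral_normal_pdf.
by apply: eq_Rintegral => x _; rewrite expr0 mul1r.
Qed.

End normal_stein.

(** * Moments of centred Gaussian random variables *)

Section gaussian_moments.
Context {R : realType} {dO} {Omega : measurableType dO}.
Variable P : probability Omega R.

Lemma moment_law (X : Omega -> R) (nu : {measure set (measurableTypeR R) -> \bar R}) k :
  measurable_fun setT X ->
  (forall B : set R, measurable B -> P (X @^-1` B) = nu B) ->
  nu.-integrable setT (fun x : R => (x ^+ k)%:E) ->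
  P.-integrable setT (fun w => (X w ^+ k)%:E) /\
  Rintegral P setT (fun w => X w ^+ k) = Rintegral nu setT (fun x : R => x ^+ k).
Proof.
move=> mX hX ik.
have mk : measurable_fun setT (fun x : R => (x ^+ k)%:E).
  by apply/measurable_EFinP; exact: measurable_funX.
have mXk : measurable_fun setT (fun w => (X w ^+ k)%:E).
  by apply/measurable_EFinP; exact: measurable_funX.
pose X' := X : Omega -> measurableTypeR R.
have mX' : measurable_fun setT X' by [].
pose lawf : {measure set (measurableTypeR R) -> \bar R} := pushforward P X'.
pose law := lawf mX'.
have E (f : R -> \bar R) : (\int[nu]_x f x = \int[law]_x f x)%E.
  by apply: eq_measure_integral => A mA _; rewrite /law /lawf /= /pushforward hX.
have iP : P.-integrable setT (fun w => (X w ^+ k)%:E).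
  apply/integrableP; split => //.
  move/integrableP : ik => [_]; rewrite E ge0_integral_pushforward//.
  exact: measurableT_comp.
by split => //; rewrite /Rintegral E integral_pushforward.
Qed.

(** A degenerate law with mean 0 sits at 0 and both sides of the recursion vanish. Otherwise mean 0
    forces m = 0, and s^2 is the second moment in the recursion of the normal moments. *)
Lemma gaussian_moments (X : Omega -> R) : gaussian P X ->
  Rintegral P setT X = 0 ->
  (forall k, P.-integrable setT (fun w => (X w ^+ k)%:E)) /\
  (forall k, Rintegral P setT (fun w => X w ^+ k.+2) =
     k.+1%:R * Rintegral P setT (fun w => X w ^+ 2) * Rintegral P setT (fun w => X w ^+ k)).
Proof.
move=> [mX [m [s hX]]] EX.
have EX1 : Rintegral P setT (fun w => X w ^+ 1) = 0.
  by rewrite -EX; apply: eq_Rintegral => w _; rewrite expr1.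
have [s0|s0] := eqVneq s 0.
  have hX' (B : set R) : measurable B -> P (X @^-1` B) = dirac m B.
    by move=> mB; rewrite hX// s0 eqxx.
  pose nu : {measure set (measurableTypeR R) -> \bar R} := dirac (m : measurableTypeR R).
  have mk k : measurable_fun (setT : set (measurableTypeR R)) (fun x => ((x : R) ^+ k)%:E).
    by apply/measurable_EFinP; exact: measurable_funX.
  have ik k : nu.-integrable setT (fun x => ((x : R) ^+ k)%:E).
    apply/integrableP; split => //; rewrite integral_dirac//.
      by rewrite diracT mul1e ltry.
    exact: measurableT_comp.
  have I k : Rintegral P setT (fun w => X w ^+ k) = m ^+ k.
    have [_ ->] := moment_law (nu := nu) mX hX' (ik k).
    by rewrite /Rintegral integral_dirac// diracT mul1e.
  split=> [k|k]; first by have [] := moment_law (nu := nu) mX hX' (ik k).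
  have m0 : m = 0 by move: EX1; rewrite I expr1.
  by rewrite !I m0 !expr0n /= mulr0 mul0r.
have hX' (B : set R) : measurable B -> P (X @^-1` B) = normal_prob m s B.
  by move=> mB; rewrite hX// (negbTE s0).
have D k := @integral_density _ _ R lebesgue_measure (normal_prob m s)
  (normal_pdf m s) (measurable_normal_pdf m s) (fun x => normal_pdf_ge0 m s x)
  (normal_prob_dominates m s)
  (fun A _ => erefl) (fun x => x ^+ k) (measurable_funX _ (@measurable_id _ _ _))
  (integrable_normal_moment m s0 k).
have ik k : (normal_prob m s).-integrable setT (fun x : R => (x ^+ k)%:E).
  by have [] := D k.
have I k : Rintegral P setT (fun w => X w ^+ k) = normal_moment m s k.
  have [_ ->] := moment_law (nu := (normal_prob m s : {measure set (measurableTypeR R) -> \bar R})) mX hX' (ik k).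
  by rewrite /Rintegral; have [_ ->] := D k.
split=> [k|k]; first by have [] := moment_law (nu := (normal_prob m s : {measure set (measurableTypeR R) -> \bar R})) mX hX' (ik k).
have m0 : m = 0.
  by move: EX1; rewrite I normal_moment_rec// normal_moment0// mulr1 mulr0 mul0r addr0.
rewrite !I normal_moment_rec// m0 mul0r add0r /=.
rewrite [normal_moment _ _ 2]normal_moment_rec// mul0r add0r /= normal_moment0//.
by rewrite mulr1 mulr1 [s ^+ 2 * _]mulrC.
Qed.

End gaussian_moments.

(** * Wick's formula *)

(** In characteristic 0 the naturals are infinitely many distinct points, more than the roots of a
    nonzero polynomial. *)
Lemma poly_eq_nat (F : numFieldType) (p q : {poly F}) :
  (forall n : nat, p.[n%:R] = q.[n%:R]) -> p = q.
Proof.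
move=> h; apply/eqP; rewrite -subr_eq0; apply/negPn/negP => pq0.
pose s : seq F := [seq i%:R | i <- iota 0 (size (p - q))].
have us : uniq s.
  by rewrite map_inj_uniq ?iota_uniq// => i j /eqP; rewrite eqr_nat => /eqP.
have rs : all (root (p - q)) s.
  apply/allP => x /mapP[i _ ->].
  by rewrite /root !hornerE h subrr.
by have := max_poly_roots pq0 rs us; rewrite size_map size_iota ltnn.
Qed.

Lemma prod_ord_neq (A : comPzRingType) n (l : 'I_n.+1) (f : 'I_n.+1 -> A) :
  \prod_(i | i != l) f i = \prod_(i < n) f (lift l i).
Proof.
rewrite (reindex_omap (lift l) (unlift l)) /=; last first.
  by move=> i il; case: unliftP il => [j ->//|->]; rewrite eqxx.
by apply: eq_bigl => i; rewrite liftK eqxx andbT eq_sym neq_lift.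
Qed.

(** Expansion of a permanent along its first row: a permutation is determined by the image [l] of 0
    and by the permutation that it induces between the remaining indices. *)
Lemma sum_perm_expand (F : comPzRingType) n (C : 'I_n.+1 -> 'I_n.+1 -> F) :
  \sum_(s : 'S_n.+1) \prod_i C i (s i) =
  \sum_l C ord0 l * \sum_(s : 'S_n) \prod_i C (lift ord0 i) (lift l (s i)).
Proof.
rewrite (partition_big (fun s : 'S_n.+1 => s ord0) predT) //=.
apply: eq_bigr => l _; rewrite (reindex (lift_perm ord0 l)); last first.
  pose del (s : 'S_n.+1) (i : 'I_n) := odflt i (unlift l (s (lift ord0 i))).
  have delK (s : 'S_n.+1) (i : 'I_n) : s ord0 = l -> lift l (del s i) = s (lift ord0 i).
    move=> sl; rewrite /del; case: unliftP => [j ->//|/esym e].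
    by move: e; rewrite -{1}sl => /perm_inj e; have := neq_lift ord0 i; rewrite -e eqxx.
  have del_inj (s : 'S_n.+1) : s ord0 = l -> injective (del s).
    move=> sl i i' /(congr1 (lift l)); rewrite !delK//.
    by move/perm_inj/lift_inj.
  exists (fun s : 'S_n.+1 => if pselect (s ord0 = l) is left sl then perm (del_inj s sl) else 1%g).
    move=> s _; case: pselect => [sl|]; last by rewrite lift_perm_id.
    apply/permP => i; apply: (@lift_inj _ l).
    by rewrite permE delK// lift_perm_lift.
  move=> s /eqP sl; case: pselect => // sl'; apply/permP => i.
  case: (unliftP ord0 i) => [i'|] ->; last by rewrite lift_perm_id.
  by rewrite lift_perm_lift permE delK.
rewrite mulr_sumr; apply: eq_big => [s | s _]; first by rewrite lift_perm_id eqxx.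
rewrite big_ord_recl lift_perm_id; congr (_ * _).
by apply: eq_bigr => i _; rewrite lift_perm_lift.
Qed.

(** * Wick's formula for an abstract moment functional *)

Section moment_functional.
Context (F : numFieldType) (A : comPzRingType) (emb : {rmorphism F -> A}).
Variables (M : A -> Prop) (E : A -> F).
Hypothesis M_emb : forall c, M (emb c).
Hypothesis MD : forall x y, M x -> M y -> M (x + y).
Hypothesis MM : forall x y, M x -> M y -> M (x * y).
Hypothesis ED : forall x y, M x -> M y -> E (x + y) = E x + E y.
Hypothesis EZ : forall c x, M x -> E (emb c * x) = c * E x.
Hypothesis E1 : E 1 = 1.

Let M1 : M 1. Proof. by rewrite -(rmorph1 emb). Qed.
Let M0 : M 0. Proof. by rewrite -(rmorph0 emb). Qed.

Let E0 : E 0 = 0.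
Proof. by rewrite -(mul0r 0) -(rmorph0 emb) EZ ?mul0r// rmorph0. Qed.

Let MX x n : M x -> M (x ^+ n).
Proof. by move=> Mx; elim: n => [|n IHn]; rewrite ?expr0// exprS; exact: MM. Qed.

Let M_prod I (s : seq I) (P : pred I) (V : I -> A) :
  (forall i, M (V i)) -> M (\prod_(i <- s | P i) V i).
Proof. by move=> MV; elim/big_rec : _ => // i x _; exact: MM. Qed.

Let M_sum I (s : seq I) (P : pred I) (V : I -> A) :
  (forall i, M (V i)) -> M (\sum_(i <- s | P i) V i).
Proof. by move=> MV; elim/big_rec : _ => // i x _; exact: MD. Qed.

Let E_sum I (s : seq I) (P : pred I) (V : I -> A) : (forall i, M (V i)) ->
  E (\sum_(i <- s | P i) V i) = \sum_(i <- s | P i) E (V i).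
Proof.
move=> MV; elim: s => [|i s IHs]; first by rewrite !big_nil.
by rewrite !big_cons; case: ifP => _ //; rewrite ED ?IHs//; exact: M_sum.
Qed.

Let E_natmul x n : M x -> E (x *+ n) = E x *+ n.
Proof. by move=> Mx; rewrite -[x *+ n]mulr_natl -(rmorph_nat emb) EZ// mulr_natl. Qed.

Let M_natmul x n : M x -> M (x *+ n).
Proof. by move=> Mx; rewrite -[x *+ n]mulr_natl -(rmorph_nat emb); exact: MM. Qed.

(* E ((X + t W)^m U) is a polynomial in t: comparing its coefficients polarizes
   identities between moments of powers. *)
Definition pencil_poly (X W U : A) m : {poly F} :=
  \poly_(k < m.+1) (E (X ^+ (m - k) * W ^+ k * U) *+ 'C(m, k)).

Lemma pencil_polyE X W U m t : M X -> M W -> M U ->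
  E ((X + emb t * W) ^+ m * U) = (pencil_poly X W U m).[t].
Proof.
move=> MX' MW MU; rewrite exprDn mulr_suml.
have MT k : M (X ^+ (m - k) * W ^+ k * U) by apply: MM => //; apply: MM; exact: MX.
rewrite E_sum; last first.
  move=> i; apply: MM => //; apply: M_natmul; apply: MM; first exact: MX.
  by apply: MX; exact: MM.
rewrite horner_poly; apply: eq_bigr => k _.
rewrite mulrnAl E_natmul; last first.
  by apply: MM => //; apply: MM; [exact: MX|apply: MX; exact: MM].
have -> : X ^+ (m - k) * (emb t * W) ^+ k * U =
    emb (t ^+ k) * (X ^+ (m - k) * W ^+ k * U).
  by rewrite exprMn -(rmorphXn emb); ring.
by rewrite EZ// mulrC mulrnAl.
Qed.

Lemma coef0_pencil_poly X W U m : (pencil_poly X W U m)`_0 = E (X ^+ m * U).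
Proof. by rewrite coef_poly /= subn0 expr0 mulr1 bin0. Qed.

Lemma coef1_pencil_poly X W U m :
  (pencil_poly X W U m)`_1 = m%:R * E (X ^+ m.-1 * W * U).
Proof.
rewrite coef_poly; case: m => [|m]; first by rewrite mul0r.
by rewrite ltnS /= expr1 bin1 subSS subn0 mulr_natl.
Qed.

(** With E X = 0 this recursion determines all moments by the variance: odd ones vanish and E X^(2q)
    = (2q - 1)!! (E X^2)^q. *)
Definition gauss_rec X := forall p,
  E (X ^+ p.+2) = p.+1%:R * E (X ^+ 2) * E (X ^+ p).

(** The recursion for X + t W holds at every natural t, and both sides are polynomials in t. *)
Let pencil_rec X W p : M X -> M W ->
  (forall n : nat, gauss_rec (X + emb n%:R * W)) ->
  pencil_poly X W 1 p.+2 = p.+1%:R *: (pencil_poly X W 1 2 * pencil_poly X W 1 p).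
Proof.
move=> MX' MW h; apply: poly_eq_nat => n.
by rewrite !hornerE -!pencil_polyE// !mulr1 h ?mulrA.
Qed.

(** Extends the recursion from natural multiples of [W] to arbitrary ones; the case c = i leads from
    real to complex combinations of Gaussian variables. *)
Lemma gauss_rec_pencil X W c : M X -> M W ->
  (forall n : nat, gauss_rec (X + emb n%:R * W)) -> gauss_rec (X + emb c * W).
Proof.
move=> MX' MW h p; have := congr1 (fun q => q.[c]) (pencil_rec p MX' MW h).
by rewrite !hornerE -!pencil_polyE// !mulr1 ?mulrA.
Qed.

Section wick.
Variable Gs : A -> Prop.
Hypothesis GM : forall x, Gs x -> M x.
Hypothesis GD : forall x y (n : nat), Gs x -> Gs y -> Gs (x + emb n%:R * y).
Hypothesis G0 : forall x, Gs x -> E x = 0.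
Hypothesis Grec : forall x, Gs x -> gauss_rec x.

(** Comparison of the coefficients of t in the recursion for Y + t W. The comparison for exponent q
    + 2 refers to the claim for exponent q, so the induction carries two consecutive cases. *)
Let wick_power Y W m : Gs Y -> Gs W ->
  E (Y ^+ m * W) = m%:R * E (Y * W) * E (Y ^+ m.-1).
Proof.
move=> GY GW; have MY := GM GY; have MW := GM GW.
suff : E (Y ^+ m * W) = m%:R * E (Y * W) * E (Y ^+ m.-1) /\
   E (Y ^+ m.+1 * W) = m.+1%:R * E (Y * W) * E (Y ^+ m) by case.
elim: m => [|q [IH1 IH2]].
  by rewrite expr0 mul1r G0// !mul0r expr1 E1 mul1r mulr1.
split=> //; have q3 : q.+3%:R != 0 :> F by rewrite pnatr_eq0.
apply: (mulfI q3).
have h n : gauss_rec (Y + emb n%:R * W) by apply: Grec; exact: GD.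
have := congr1 (fun p : {poly F} => p`_1) (pencil_rec q.+1 MY MW h).
rewrite coefZ coefM !big_ord_recl big_ord0 addr0.
rewrite /= !coef0_pencil_poly !coef1_pencil_poly /= !mulr1 expr1 => ->.
rewrite IH1.
have -> : E (Y ^+ q.+1) = q%:R * E (Y ^+ 2) * E (Y ^+ q.-1).
  case: q {IH1 IH2 q3} => [|q]; first by rewrite expr1 G0// !mul0r.
  exact: Grec.
by rewrite -!natr1; ring.
Qed.

(** Gaussian integration by parts for [W] against a monomial in which [Y] may be repeated.
    Repetition makes the induction possible: a new factor is split off from a power of [Y] by
    replacing [Y] with Y + t V and taking the coefficient of t. *)
Lemma wick (I : eqType) (s : seq I) (V : I -> A) Y W m : uniq s ->
  (forall i, Gs (V i)) -> Gs Y -> Gs W ->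
  E (Y ^+ m * (W * \prod_(i <- s) V i)) =
    m%:R * E (Y * W) * E (Y ^+ m.-1 * \prod_(i <- s) V i) +
    \sum_(l <- s) E (W * V l) * E (Y ^+ m * \prod_(i <- s | i != l) V i).
Proof.
move=> + GV; elim: s Y m => [|v s IHs] Y m.
  by move=> _ GY GW; rewrite !big_nil addr0 !mulr1 wick_power.
rewrite cons_uniq => /andP[vs us] GY GW.
have MY := GM GY; have MW := GM GW.
have MV i : M (V i) by exact: GM.
set Q := \prod_(i <- s) V i; have MQ : M Q by exact: M_prod.
pose Ql l := \prod_(i <- s | i != l) V i.
have MQl l : M (Ql l) by exact: M_prod.
(* The induction hypothesis for the variable Y + n V_v with exponent m + 1, at all naturals n, read
   as an identity of polynomials. *)
have key : pencil_poly Y (V v) (W * Q) m.+1 =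
   m.+1%:R *: (pencil_poly Y (V v) W 1 * pencil_poly Y (V v) Q m) +
   \sum_(l <- s) E (W * V l) *: pencil_poly Y (V v) (Ql l) m.+1.
  apply: poly_eq_nat => n; rewrite !hornerE horner_sum.
  rewrite -!pencil_polyE//; last exact: MM.
  rewrite IHs//; last exact: GD.
  rewrite expr1 ?mulrA; congr (_ + _); apply: eq_bigr => l _.
  by rewrite !hornerE -pencil_polyE.
have m1 : m.+1%:R != 0 :> F by rewrite pnatr_eq0.
apply: (mulfI m1); have := congr1 (fun p : {poly F} => p`_1) key.
rewrite coef1_pencil_poly coefD coefZ coefM !big_ord_recl big_ord0 addr0.
rewrite /= !coef0_pencil_poly !coef1_pencil_poly coef_sum /= expr1 expr0 mul1r.
have -> : E (Y ^+ m * V v * (W * Q)) = E (Y ^+ m * (W * \prod_(i <- v :: s) V i)).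
  by congr E; rewrite big_cons -/Q; ring.
move=> ->.
rewrite [X in _ + X](_ : _ = m.+1%:R * \sum_(l <- s) E (W * V l) *
    E (Y ^+ m * \prod_(i <- v :: s | i != l) V i)); last first.
  rewrite mulr_sumr; apply: eq_big_seq => l ls.
  rewrite coefZ coef1_pencil_poly /= big_cons.
  have -> : v != l by apply/eqP => vl; move: vs; rewrite vl ls.
  by rewrite -/(Ql l) mulrCA -(mulrA (Y ^+ m)).
rewrite -mulrDr; congr (_ * _).
rewrite [\sum_(l <- v :: s) _]big_cons addrA; congr (_ + _).
rewrite [\prod_(i <- v :: s | i != v) _]big_cons eqxx /=.
have -> : \prod_(i <- s | i != v) V i = Q.
  rewrite /Q big_seq_cond [RHS]big_seq; apply: eq_bigl => i.
  by case: (boolP (i \in s)) => //= is_; apply/eqP => iv; move: vs; rewrite -iv is_.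
rewrite big_cons -/Q [W * V v]mulrC mul1r; congr (_ + _).
by rewrite (mulrA (Y ^+ m.-1)) mulrCA mulrA.
Qed.

Lemma wick_rec (I : finType) (V : I -> A) W : (forall i, Gs (V i)) -> Gs W ->
  E (W * \prod_i V i) = \sum_l E (W * V l) * E (\prod_(i | i != l) V i).
Proof.
move=> GV GW; have := @wick I (index_enum I) V W W 0 (index_enum_uniq _) GV GW GW.
rewrite expr0 !mul1r !mul0r add0r => ->.
by apply: eq_bigr => l _; rewrite mul1r.
Qed.

Let cross_expand n n' (X : 'I_n.+1 -> A) (Y : 'I_n'.+1 -> A) :
  (forall i, Gs (X i)) -> (forall i, Gs (Y i)) ->
  (forall i i', E (X i * X i') = 0) ->
  E (\prod_i X i * \prod_i Y i) = \sum_l E (X ord0 * Y l) *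
    E (\prod_i X (lift ord0 i) * \prod_i Y (lift l i)).
Proof.
move=> GX GY XX.
pose V (i : 'I_n + 'I_n'.+1) := match i with
  | inl a => X (lift ord0 a) | inr b => Y b end.
have GV i : Gs (V i) by case: i => ? /=.
have := wick_rec GV (GX ord0); rewrite !big_sumType /= => h.
rewrite big_ord_recl -mulrA h [X in X + _]big1 ?add0r; last first.
  by move=> i _; rewrite XX mul0r.
by apply: eq_bigr => l _; rewrite big_sumType /= -(prod_ord_neq l Y).
Qed.

Let wick_null n (X : 'I_n.+1 -> A) : (forall i, Gs (X i)) ->
  (forall i i', E (X i * X i') = 0) -> E (\prod_i X i) = 0.
Proof.
move=> GX XX; rewrite big_ord_recl.
rewrite (wick_rec (fun i => GX (lift ord0 i)) (GX ord0)).
by rewrite big1// => l _; rewrite XX mul0r.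
Qed.

(** Each step removes one factor of both products. When one product is exhausted, the factors left
    in the other have vanishing covariances, hence expectation 0. *)
Lemma wick_cross_neq n n' (X : 'I_n -> A) (Y : 'I_n' -> A) : n != n' ->
  (forall i, Gs (X i)) -> (forall i, Gs (Y i)) ->
  (forall i i', E (X i * X i') = 0) -> (forall i i', E (Y i * Y i') = 0) ->
  E (\prod_i X i * \prod_i Y i) = 0.
Proof.
elim: n n' X Y => [|n IHn] [|n'] X Y // nn' GX GY XX YY.
- by rewrite big_ord0 mul1r wick_null//.
- by rewrite [\prod_(i < 0) Y i]big_ord0 mulr1 wick_null//.
- by rewrite cross_expand// big1// => l _; rewrite IHn ?mulr0.
Qed.

(** The expectation obeys the same recursion as the permanent of the matrix of the E (X_i Y_l). *)
Lemma wick_cross n (X Y : 'I_n -> A) :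
  (forall i, Gs (X i)) -> (forall i, Gs (Y i)) ->
  (forall i i', E (X i * X i') = 0) -> (forall i i', E (Y i * Y i') = 0) ->
  E (\prod_i X i * \prod_i Y i) = \sum_(s : 'S_n) \prod_i E (X i * Y (s i)).
Proof.
elim: n X Y => [|n IHn] X Y GX GY XX YY.
  rewrite !big_ord0 mulr1 E1 (big_pred1 1%g) ?big_ord0// => s.
  by apply/esym/eqP/permP => -[].
rewrite cross_expand// (sum_perm_expand (fun i l => E (X i * Y l))).
by apply: eq_bigr => l _; rewrite IHn.
Qed.

End wick.
End moment_functional.

Section const_function_morphism.
Context (T : Type) (F : comPzRingType).
(** Scalars as constant random variables: the ring morphism [emb] that the abstract Wick formula
    takes as a parameter. *)
Definition const_fun (c : F) : T -> F := fun=> c.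

Lemma const_fun_is_additive : zmod_morphism const_fun.
Proof. by move=> x y; apply/funext. Qed.

Lemma const_fun_is_multiplicative : monoid_morphism const_fun.
Proof. by split => [|x y]; apply/funext. Qed.

HB.instance Definition _ :=
  GRing.isZmodMorphism.Build F (T -> F) const_fun const_fun_is_additive.
HB.instance Definition _ :=
  GRing.isMonoidMorphism.Build F (T -> F) const_fun const_fun_is_multiplicative.
End const_function_morphism.
Arguments const_fun T {F} c _ /.

(** * Wick's formula for Gaussian families *)

Section moments.
Context {R : realType} {dO} {Omega : measurableType dO}.
Variable P : probability Omega R.
Implicit Types X Y : Omega -> R[i].

(** Finiteness of all moments, unlike mere integrability, is stable under products; this class is
    the domain [M] of the moment functional. *)
Definition fin_moments X := cmeasurable setT X /\
  forall k, P.-integrable setT (fun w => (csq (X w) ^+ k)%:E).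

Let exprD_max (a b : R) k : 0 <= a -> 0 <= b ->
  (a + b) ^+ k <= 2 ^+ k * (a ^+ k + b ^+ k).
Proof.
move=> a0 b0; have [ab|ba] := leP a b.
  apply: (@le_trans _ _ ((2 * b) ^+ k)).
    by apply: lerXn2r; rewrite ?nnegrE; lra.
  by rewrite exprMn ler_wpM2l ?exprn_ge0// lerDr exprn_ge0.
apply: (@le_trans _ _ ((2 * a) ^+ k)).
  by apply: lerXn2r; rewrite ?nnegrE; lra.
by rewrite exprMn ler_wpM2l ?exprn_ge0// lerDl exprn_ge0.
Qed.

Lemma fin_moments_const c : fin_moments (const_fun Omega c).
Proof.
split=> [|k]; first exact: cmeasurable_cst.
exact: (@finite_measure_integrable_cst _ _ _ P setT (csq c ^+ k)).
Qed.

Lemma fin_momentsD X Y : fin_moments X -> fin_moments Y -> fin_moments (X + Y).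
Proof.
move=> [mX iX] [mY iY]; have mXY := cmeasurableD mX mY; split=> // k.
apply: (@le_integrable _ _ _ P setT measurableT _
    (fun w => (4 ^+ k)%:E * ((csq (X w) ^+ k)%:E + (csq (Y w) ^+ k)%:E))%E).
- by apply/measurable_EFinP/measurable_funX; exact: measurable_csq.
- move=> w _; rewrite -EFinD -EFinM /= lee_fin !ger0_norm ?exprn_ge0 ?csq_ge0//; last first.
    by rewrite mulr_ge0 ?addr_ge0 ?exprn_ge0 ?csq_ge0.
  apply: (@le_trans _ _ ((2 * csq (X w) + 2 * csq (Y w)) ^+ k)).
    apply: lerXn2r; [exact: csq_ge0| |exact: csqD_le].
    by rewrite nnegrE addr_ge0// mulr_ge0// csq_ge0.
  have -> : 4 ^+ k = 2 ^+ k * 2 ^+ k :> R by rewrite -exprMn; congr (_ ^+ _); ring.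
  rewrite -mulrDr exprMn -mulrA ler_wpM2l ?exprn_ge0//.
  by apply: exprD_max; exact: csq_ge0.
- by apply: integrableZl => //; exact: integrableD.
Qed.

Lemma fin_momentsM X Y : fin_moments X -> fin_moments Y -> fin_moments (X * Y).
Proof.
move=> [mX iX] [mY iY]; have mXY := cmeasurableM mX mY; split=> // k.
apply: (@le_integrable _ _ _ P setT measurableT _
    (fun w => (csq (X w) ^+ (k * 2))%:E + (csq (Y w) ^+ (k * 2))%:E)%E).
- by apply/measurable_EFinP/measurable_funX; exact: measurable_csq.
- move=> w _; rewrite -EFinD /= lee_fin !ger0_norm ?addr_ge0 ?exprn_ge0 ?csq_ge0//.
  rewrite csqM exprMn !exprM; set a := _ ^+ k; set b := _ ^+ k.
  have := sqr_ge0 (a - b); have := sqr_ge0 a; have := sqr_ge0 b; nra.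
- exact: integrableD.
Qed.

Lemma fin_momentsZ c X : fin_moments X -> fin_moments (fun w => c * X w).
Proof. by move=> fX; exact: (fin_momentsM (fin_moments_const c) fX). Qed.

Lemma fin_moments_prod I (s : seq I) (X : I -> Omega -> R[i]) :
  (forall i, fin_moments (X i)) -> fin_moments (fun w => \prod_(i <- s) X i w).
Proof.
move=> fX; elim: s => [|i s IHs].
  by under eq_fun do rewrite big_nil; exact: (fin_moments_const 1).
under eq_fun do rewrite big_cons.
exact: (fin_momentsM (fX i) IHs).
Qed.

Lemma fin_moments_sum I (s : seq I) (X : I -> Omega -> R[i]) :
  (forall i, fin_moments (X i)) -> fin_moments (fun w => \sum_(i <- s) X i w).
Proof.
move=> fX; elim: s => [|i s IHs].
  by under eq_fun do rewrite big_nil; exact: (fin_moments_const 0).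
under eq_fun do rewrite big_cons.
exact: (fin_momentsD (fX i) IHs).
Qed.

Lemma fin_moments_integrable X : fin_moments X -> cintegrable P setT X.
Proof.
move=> [[mr mi] iX].
have h : P.-integrable setT (fun w => (1 + csq (X w))%:E).
  under eq_fun do rewrite EFinD.
  apply: integrableD => //; first exact: (@finite_measure_integrable_cst _ _ _ P setT 1).
  by have := iX 1%N; under eq_fun do rewrite expr1.
split; (apply: le_integrable h => //; first exact/measurable_EFinP) => w _ /=;
  rewrite lee_fin (ger0_norm (addr_ge0 ler01 (csq_ge0 _))).
- exact: normr_Re_csq.
- exact: normr_Im_csq.
Qed.

Lemma cexpectation_real (f : Omega -> R) :
  cexpectation P (fun w => (f w)%:C%C) = (Rintegral P setT f)%:C%C.
Proof. by apply: complexP => //=; rewrite /Rintegral integral0. Qed.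

Lemma fin_moments_real (f : Omega -> R) : measurable_fun setT f ->
  (forall k, P.-integrable setT (fun w => (f w ^+ k)%:E)) ->
  fin_moments (fun w => (f w)%:C%C).
Proof.
move=> mf hf; split=> [|k]; first by split => //=.
by under eq_fun do rewrite csq_real -exprM.
Qed.

Section gaussian_family.
Variables (I : finType) (X : I -> Omega -> R).
Hypothesis gX : jointly_gaussian P X.
Hypothesis X0 : forall i, Rintegral P setT (X i) = 0.

(** The coefficients are complex because each Z_j(A) is a complex combination of its real and
    imaginary parts, which are the jointly Gaussian variables. *)
Definition gspan (c : I -> R[i]) : Omega -> R[i] :=
  fun w => \sum_i c i * (X i w)%:C%C.

Let gaussianX i : gaussian P (X i).
Proof.
have := gX (fun j => (j == i)%:R); congr (gaussian P _); apply/funext => w.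
rewrite (bigD1 i)//= eqxx mul1r big1 ?addr0// => j /negbTE ->.
by rewrite mul0r.
Qed.

Let fmX i : fin_moments (fun w => (X i w)%:C%C).
Proof.
by apply: fin_moments_real; [have [] := gaussianX i|
  have [] := gaussian_moments (gaussianX i) (X0 i)].
Qed.

Lemma fin_moments_gspan c : fin_moments (gspan c).
Proof. by apply: fin_moments_sum => i; exact: fin_momentsZ. Qed.

Lemma cexpectation_gspan c : cexpectation P (gspan c) = 0.
Proof.
rewrite /cexpectation cintegral_sum//; last first.
  by move=> i _; apply: cintegrableZ => //; exact: fin_moments_integrable.
rewrite big1// => i _; rewrite cintegralZ//; last exact: fin_moments_integrable.
by have := cexpectation_real (X i); rewrite /cexpectation => ->; rewrite X0 mulr0.
Qed.

Let E := cexpectation P.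
Let rec := gauss_rec E.

Let real_rec (a : I -> R) : rec (gspan (fun i => (a i)%:C%C)).
Proof.
have Ew w : gspan (fun i => (a i)%:C%C) w = (\sum_i a i * X i w)%:C%C.
  by rewrite /gspan rmorph_sum; apply: eq_bigr => i _; rewrite rmorphM.
have E0 : Rintegral P setT (fun w => \sum_i a i * X i w) = 0.
  have := cexpectation_gspan (fun i => (a i)%:C%C).
  by rewrite (funext Ew) cexpectation_real => -[].
have [_ h] := gaussian_moments (gX a) E0.
move=> p; rewrite (funext Ew).
have EX k : E ((fun w => (\sum_i a i * X i w)%:C%C) ^+ k) =
    (Rintegral P setT (fun w => (\sum_i a i * X i w) ^+ k))%:C%C.
  rewrite -cexpectation_real /E; congr cexpectation; apply/funext => w.
  by rewrite exprfctE rmorphXn.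
by rewrite !EX h !rmorphM /= rmorph_nat.
Qed.

Let ME x : fin_moments x -> cintegrable P setT x.
Proof. exact: fin_moments_integrable. Qed.

Let ED x y : fin_moments x -> fin_moments y -> E (x + y) = E x + E y.
Proof. by move=> mx my; apply: cintegralD => //; exact: ME. Qed.

Let EZ c x : fin_moments x -> E (const_fun Omega c * x) = c * E x.
Proof. by move=> mx; apply: cintegralZ => //; exact: ME. Qed.

Let E1 : E 1 = 1.
Proof.
rewrite /E (_ : 1 = (fun w => ((cst 1 : Omega -> R) w)%:C%C))//.
by rewrite cexpectation_real Rintegral_cst//= probability_setT mulr1.
Qed.

(** With c = a + i b, the combinations with coefficients a + n b are real, hence Gaussian for every
    natural n; the polynomial identity in n is then evaluated at i. *)
Let gspan_rec c : rec (gspan c).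
Proof.
pose a i := Re (c i); pose b i := Im (c i).
have cE (n : R[i]) : gspan (fun i => (a i)%:C%C) + const_fun Omega n * gspan (fun i => (b i)%:C%C) =
   gspan (fun i => (a i)%:C%C + n * (b i)%:C%C).
  apply/funext => w.
  transitivity (gspan (fun i => (a i)%:C%C) w + n * gspan (fun i => (b i)%:C%C) w) => //.
  rewrite /gspan mulr_sumr -big_split.
  by apply: eq_bigr => i _ /=; rewrite mulrDl mulrA.
have -> : gspan c = gspan (fun i => (a i)%:C%C + 'i%C * (b i)%:C%C).
  by congr gspan; apply/funext => i; rewrite -complexE.
rewrite -cE; apply: (gauss_rec_pencil fin_moments_const fin_momentsD fin_momentsM ED EZ).
- exact: fin_moments_gspan.
- exact: fin_moments_gspan.
- move=> n; rewrite cE.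
  rewrite (_ : (fun i => _) = (fun i => (a i + n%:R * b i)%:C%C)); first exact: real_rec.
  by apply/funext => i; rewrite rmorphD rmorphM rmorph_nat.
Qed.

Let Gs (x : Omega -> R[i]) := exists c, x = gspan c.

Let GM x : Gs x -> fin_moments x.
Proof. by move=> [c ->]; exact: fin_moments_gspan. Qed.

Let GD x y (n : nat) : Gs x -> Gs y -> Gs (x + const_fun Omega n%:R * y).
Proof.
move=> [c ->] [c' ->]; exists (fun i => c i + n%:R * c' i).
apply/funext => w; transitivity (gspan c w + n%:R * gspan c' w) => //.
rewrite /gspan mulr_sumr -big_split.
by apply: eq_bigr => i _ /=; rewrite mulrDl mulrA.
Qed.

Let G0 x : Gs x -> E x = 0.
Proof. by move=> [c ->]; exact: cexpectation_gspan. Qed.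

Let Grec x : Gs x -> rec x.
Proof. by move=> [c ->]; exact: gspan_rec. Qed.

Lemma gaussian_wick_cross n (U V : 'I_n -> I -> R[i]) :
  (forall i i', cexpectation P (fun w => gspan (U i) w * gspan (U i') w) = 0) ->
  (forall i i', cexpectation P (fun w => gspan (V i) w * gspan (V i') w) = 0) ->
  cexpectation P (fun w => \prod_i gspan (U i) w * \prod_i gspan (V i) w) =
  \sum_(s : 'S_n) \prod_i
    cexpectation P (fun w => gspan (U i) w * gspan (V (s i)) w).
Proof.
move=> UU VV.
have := wick_cross fin_moments_const fin_momentsD fin_momentsM ED EZ E1
  GM GD G0 Grec (fun i => ex_intro _ (U i) erefl) (fun i => ex_intro _ (V i) erefl)
  UU VV.
move=> <-; rewrite /E; congr cexpectation; apply/funext => w.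
by rewrite mulrfctE !fct_prodE.
Qed.

Lemma gaussian_wick_cross_neq n n' (U : 'I_n -> I -> R[i]) (V : 'I_n' -> I -> R[i]) :
  n != n' ->
  (forall i i', cexpectation P (fun w => gspan (U i) w * gspan (U i') w) = 0) ->
  (forall i i', cexpectation P (fun w => gspan (V i) w * gspan (V i') w) = 0) ->
  cexpectation P (fun w => \prod_i gspan (U i) w * \prod_i gspan (V i) w) = 0.
Proof.
move=> nn' UU VV.
have := wick_cross_neq fin_moments_const fin_momentsD fin_momentsM ED EZ E1
  GM GD G0 Grec nn' (fun i => ex_intro _ (U i) erefl) (fun i => ex_intro _ (V i) erefl)
  UU VV.
move=> <-; rewrite /E; congr cexpectation; apply/funext => w.
by rewrite mulrfctE !fct_prodE.
Qed.

End gaussian_family.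
End moments.

(** * Powers of a measure *)

Section tuple_boxes.
Context {d} {T : measurableType d}.

Definition tbox n (A : 'I_n -> set T) : set (n.-tuple T) :=
  [set t | forall i, A i (tnth t i)].

Lemma measurable_tbox n (A : 'I_n -> set T) :
  (forall i, measurable (A i)) -> measurable (tbox A).
Proof.
move=> mA; rewrite (_ : tbox A = \bigcap_(i in [set: 'I_n]) ((@tnth n T)^~ i @^-1` A i)).
  apply: fin_bigcap_measurable => // i _.
  by rewrite -[X in measurable X]setTI; exact: measurable_tnth.
by apply/seteqP; split=> t At; [move=> i _; exact: At|move=> i; exact: At].
Qed.

Definition measurable_boxes n : set (set (n.-tuple T)) :=
  [set B | exists2 A : 'I_n -> set T, forall i, measurable (A i) & B = tbox A].

Lemma measurable_boxes_setI n : setI_closed (@measurable_boxes n).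
Proof.
move=> _ _ [A mA ->] [B mB ->]; exists (fun i => A i `&` B i).
  by move=> i; exact: measurableI.
apply/seteqP; split=> t; first by move=> [h1 h2] i; split.
by move=> h; split=> i; have [] := h i.
Qed.

(** The sigma-algebra of tuples is generated by the coordinate maps, and a preimage under a
    coordinate is a box with all other sides full. *)
Lemma measurable_tuple_boxes n (A : set (n.-tuple T)) :
  measurable A -> <<s @measurable_boxes n >> A.
Proof.
apply: smallest_sub; first exact: smallest_sigma_algebra.
move=> B; rewrite -bigcup_seq => -[i _ [C mC <-]]; apply: sub_sigma_algebra.
exists (fun j => if j == i then C else setT); first by move=> j; case: ifP.
apply/seteqP; split=> t /=.
  by move=> [_ Ct] j; case: eqVneq => // ->.
by move=> /(_ i); rewrite eqxx.
Qed.

End tuple_boxes.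

Section product_integral.
Context {R : realType} {d1 d2} {T1 : measurableType d1} {T2 : measurableType d2}.
Variables (m1 : {sigma_finite_measure set T1 -> \bar R})
          (m2 : {sigma_finite_measure set T2 -> \bar R}).

Lemma product_Rintegral (u : T1 -> R) (v : T2 -> R) :
  m1.-integrable setT (EFin \o u) -> m2.-integrable setT (EFin \o v) ->
  (m1 \x m2)%E.-integrable setT (fun p => (u p.1 * v p.2)%:E) /\
  Rintegral (m1 \x m2)%E setT (fun p => u p.1 * v p.2) =
  Rintegral m1 setT u * Rintegral m2 setT v.
Proof.
move=> iu iv; have [mu_ uoo] := integrableP _ _ _ iu; have [mv voo] := integrableP _ _ _ iv.
have mu' : measurable_fun setT u by exact/measurable_EFinP.
have mv' : measurable_fun setT v by exact/measurable_EFinP.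
have m : measurable_fun setT (fun p : T1 * T2 => (u p.1 * v p.2)%:E).
  by apply/measurable_EFinP/measurable_funM; apply: measurableT_comp.
have ip : (m1 \x m2)%E.-integrable setT (fun p => (u p.1 * v p.2)%:E).
  apply/integrable12ltyP => //.
  rewrite (eq_integral (fun x => `|u x|%:E * \int[m2]_y `|v y|%:E)%E); last first.
    move=> x _; rewrite -ge0_integralZl//; last exact/measurable_EFinP/measurableT_comp.
    by apply: eq_integral => y _; rewrite -EFinM -normrM.
  rewrite ge0_integralZr//; last 2 first.
  - exact/measurable_EFinP/measurableT_comp.
  - exact: integral_ge0.
  by rewrite lte_mul_pinfty ?integral_ge0// ge0_fin_numE ?integral_ge0.
split=> //; rewrite {1}/Rintegral -integral12_prod_meas1//.
have fv : (\int[m2]_y (v y)%:E)%E = (Rintegral m2 setT v)%:E.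
  by rewrite /Rintegral fineK//; exact: integrable_fin_num.
have fu : (\int[m1]_y (u y)%:E)%E = (Rintegral m1 setT u)%:E.
  by rewrite /Rintegral fineK//; exact: integrable_fin_num.
rewrite /fubini_F (eq_integral (fun x => (u x)%:E * (Rintegral m2 setT v)%:E)%E).
  by rewrite integralZr// fu.
by move=> x _; rewrite -fv -integralZl//; apply: eq_integral.
Qed.

Lemma product_cintegral (f : T1 -> R[i]) (g : T2 -> R[i]) :
  cintegrable m1 setT f -> cintegrable m2 setT g ->
  cintegrable (m1 \x m2)%E setT (fun p => f p.1 * g p.2) /\
  cintegral (m1 \x m2)%E setT (fun p => f p.1 * g p.2) =
  cintegral m1 setT f * cintegral m2 setT g.
Proof.
move=> [fr fi] [gr gi].
have [irr Err] := product_Rintegral fr gr.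
have [iii Eii] := product_Rintegral fi gi.
have [iri Eri] := product_Rintegral fr gi.
have [iir Eir] := product_Rintegral fi gr.
split; first split.
- by under eq_fun do rewrite ReM EFinB; exact: integrableB.
- by under eq_fun do rewrite ImM EFinD; exact: integrableD.
apply: complexP; rewrite ?ReM ?ImM /=.
  by rewrite -Err -Eii -RintegralB//; apply: eq_Rintegral => p _; rewrite ReM.
by rewrite -Eri -Eir -RintegralD//; apply: eq_Rintegral => p _; rewrite ImM.
Qed.

End product_integral.

Section power_measure_theory.
Context {R : realType} {d} {T : measurableType d}.
Variable mu : {sigma_finite_measure set T -> \bar R}.
Local Notation "'mu^' n" := (power_measure mu n) (at level 2, format "'mu^' n").

Lemma integrable_power_step n (f : n.+1.-tuple T -> R) : measurable_fun setT f ->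
  (mu \x mu^n)%E.-integrable setT (fun p => (f (cons_pair p))%:E) ->
  mu^(n.+1).-integrable setT (EFin \o f) /\
  Rintegral mu^(n.+1) setT f =
    Rintegral (mu \x mu^n)%E setT (fun p => f (cons_pair p)).
Proof.
move=> mf fi; have mc := @measurable_cons_pair _ T n.
have mEf : measurable_fun setT (EFin \o f) by exact/measurable_EFinP.
have E (h : n.+1.-tuple T -> \bar R) : (\int[mu^(n.+1)]_x h x =
    \int[pushforward (mu \x mu^n) (@cons_pair _ T n)]_x h x)%E.
  exact: eq_measure_integral.
split; last by rewrite /Rintegral E integral_pushforward.
apply/integrableP; split => //; rewrite E ge0_integral_pushforward//.
  by have /integrableP[] := fi.
exact: measurableT_comp.
Qed.

(** Fubini, one coordinate at a time; the power of order 0 has mass 1 on the single empty tuple. *)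
Lemma power_cintegral_setT n (g : 'I_n -> T -> R[i]) :
  (forall i, cintegrable mu setT (g i)) ->
  cintegrable mu^n setT (fun t => \prod_i g i (tnth t i)) /\
  cintegral mu^n setT (fun t => \prod_i g i (tnth t i)) =
  \prod_i cintegral mu setT (g i).
Proof.
elim: n g => [|n IHn] g ig.
  have E : (fun t : 0.-tuple T => \prod_i g i (tnth t i)) = fun=> 1.
    by apply/funext => t; rewrite big_ord0.
  have m1 : mu^0 setT = 1%E.
    have := power_measure_box mu (A := fun _ : 'I_0 => setT) (fun _ => measurableT).
    by rewrite big_ord0 => <-; congr (mu^0 _); apply/seteqP; split => // t _ [].
  rewrite E big_ord0; split; first split.
  - apply/integrableP; split; first exact: measurable_cst.
    by rewrite integral_cst// [X in (_ * X)%E](_ : _ = 1%E) ?mule1 ?ltry//; exact: m1.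
  - exact: integrable0.
  apply: complexP => /=; rewrite Rintegral_cst// ?mul0r//.
  by rewrite [X in fine X](_ : _ = 1%E) ?mulr1//; exact: m1.
have [iS ES] := IHn _ (fun i => ig (lift ord0 i)).
have [ip Ep] := product_cintegral (ig ord0) iS.
have E p : \prod_i g i (tnth (cons_pair p) i) =
    g ord0 p.1 * \prod_i g (lift ord0 i) (tnth p.2 i).
  rewrite big_ord_recl; congr (_ * _).
  by apply: eq_bigr => i _; rewrite tnthS; congr (g _ (tnth _ _)); exact/val_inj.
have mg : cmeasurable setT (fun t : n.+1.-tuple T => \prod_i g i (tnth t i)).
  apply: cmeasurable_prod => i _.
  apply: (@cmeasurable_comp _ _ _ _ _ setT setT (@tnth _ T ^~ i)) => //.
    exact: measurable_tnth.
  exact: cintegrable_measurable.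
have [ir ii] := ip.
have [i1 E1] := @integrable_power_step n (fun t => Re (\prod_i g i (tnth t i))) mg.1
  (eq_ind _ (fun h => integrable _ _ h) ir _ (funext (fun p => congr1 (fun z => (Re z)%:E) (esym (E p))))).
have [i2 E2] := @integrable_power_step n (fun t => Im (\prod_i g i (tnth t i))) mg.2
  (eq_ind _ (fun h => integrable _ _ h) ii _ (funext (fun p => congr1 (fun z => (Im z)%:E) (esym (E p))))).
split; first by split.
rewrite big_ord_recl -ES -Ep; apply: complexP => /=; rewrite ?E1 ?E2.
  by apply: eq_Rintegral => p _; rewrite E.
by apply: eq_Rintegral => p _; rewrite E.
Qed.

Lemma power_cintegral n (A : 'I_n -> set T) (g : 'I_n -> T -> R[i]) :
  (forall i, measurable (A i)) -> (forall i, cintegrable mu (A i) (g i)) ->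
  cintegrable mu^n (tbox A) (fun t => \prod_i g i (tnth t i)) /\
  cintegral mu^n (tbox A) (fun t => \prod_i g i (tnth t i)) =
  \prod_i cintegral mu (A i) (g i).
Proof.
move=> mA ig.
have E : crestrict (tbox A) (fun t : n.-tuple T => \prod_i g i (tnth t i)) =
    (fun t => \prod_i crestrict (A i) (g i) (tnth t i)).
  apply/funext => t; rewrite {1}/crestrict; case: ifPn => [/set_mem h|/negP hn].
    by apply: eq_bigr => i _; rewrite /crestrict mem_set//; exact: h.
  have h : ~ tbox A t by move=> ?; apply: hn; exact/mem_set.
  have [i hi] : exists i, ~ A i (tnth t i) by exact/existsNP.
  by rewrite (bigD1 i)//= /crestrict memNset// mul0r.
have [] := @power_cintegral_setT n (fun i => crestrict (A i) (g i)).
  by move=> i; exact: (cintegrable_mkcond mu (g i) (mA i)).1 (ig i).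
rewrite -E => i1 i2; split.
  exact: (cintegrable_mkcond _ _ (measurable_tbox mA)).2.
by rewrite cintegral_mkcond i2; apply: eq_bigr => i _; rewrite -cintegral_mkcond.
Qed.

Lemma power_measure_tbox n (A : 'I_n -> set T) : (forall i, measurable (A i)) ->
  mu^n (tbox A) = (\prod_(i < n) mu (A i))%E.
Proof. exact: power_measure_box. Qed.

Definition tperm_tuple n (s : 'S_n) (x : n.-tuple T) : n.-tuple T :=
  [tuple tnth x (s i) | i < n].

Lemma measurable_tperm_tuple n (s : 'S_n) : measurable_fun setT (tperm_tuple s).
Proof.
apply/measurable_fun_tnthP => i.
rewrite (_ : _ \o _ = (fun x => tnth x (s i))); first exact: measurable_tnth.
by apply/funext => x /=; rewrite tnth_mktuple.
Qed.

(** Both measures agree on boxes, which are stable under intersection and generate the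
    sigma-algebra; increasing boxes with all sides [F m] have finite measure and exhaust the space,
    so the measures coincide. *)
Lemma power_measure_perm n (s : 'S_n) (A : set (n.-tuple T)) : measurable A ->
  mu^n (tperm_tuple s @^-1` A) = mu^n A.
Proof.
move=> mA.
pose nuf : {measure set (n.-tuple T) -> \bar R} := pushforward mu^n (tperm_tuple s).
pose nu := nuf (measurable_tperm_tuple s).
have /sigma_finiteP[F [FT ndF Foo]] := sigma_finiteT mu.
apply/esym; apply: (g_sigma_algebra_measure_unique (@measurable_boxes _ T n) _
    (fun m => tbox (fun _ : 'I_n => F m)) _ _ mu^n nu) => //.
- by move=> _ [B mB ->]; exact: measurable_tbox.
- by move=> m; exists (fun=> F m) => // i; have [] := Foo m.
- apply/seteqP; split => // t _.
  have h i : exists m, F m (tnth t i).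
    by have [m _ Fm] : (\bigcup_m F m) (tnth t i) by [rewrite -FT]; exists m.
  pose m i := projT1 (cid (h i)); exists (\max_i m i) => // i.
  have : F (m i) (tnth t i) by exact: (projT2 (cid (h i))).
  by apply/subsetPset/ndF/leq_bigmax.
- exact: measurable_boxes_setI.
- move=> _ [B mB ->]; apply: (etrans (power_measure_tbox mB)).
  rewrite /nu /nuf /= /pushforward.
  rewrite (_ : _ @^-1` _ = tbox (fun i => B (s^-1%g i))); last first.
    apply/seteqP; split=> t /= h i.
      by have := h (s^-1%g i); rewrite tnth_mktuple permKV.
    by rewrite tnth_mktuple; have := h (s i); rewrite permK.
  apply/esym; apply: (etrans (power_measure_tbox (fun i => mB (s^-1%g i)))).
  by rewrite [RHS](reindex_inj (@perm_inj _ s^-1%g)).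
- move=> m; have [mF h] := Foo m.
  rewrite [ltLHS](power_measure_tbox (fun=> mF)).
  rewrite (eq_bigr (fun=> mu (F m)))//.
  rewrite -ge0_fin_numE//; last exact: prode_ge0.
  by apply: prode_fin_num => i _; rewrite ge0_fin_numE.
- exact: measurable_tuple_boxes.
Qed.

Lemma ge0_integral_perm n (s : 'S_n) (f : n.-tuple T -> \bar R) :
  measurable_fun setT f -> (forall x, 0 <= f x)%E ->
  (\int[mu^n]_x f (tperm_tuple s x) = \int[mu^n]_x f x)%E.
Proof.
move=> mf f0.
transitivity (\int[pushforward mu^n (tperm_tuple s)]_x f x)%E.
  by rewrite ge0_integral_pushforward//; exact: measurable_tperm_tuple.
apply: eq_measure_integral => [|m A mA _]; first exact: measurable_tperm_tuple.
exact: power_measure_perm.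
Qed.

Lemma power_measure_null n (i : 'I_n) (N : set T) : measurable N -> mu N = 0%E ->
  mu^n [set x | N (tnth x i)] = 0%E.
Proof.
move=> mN N0.
rewrite (_ : [set x | _] = tbox (fun j => if j == i then N else setT)).
  rewrite power_measure_tbox; last by move=> j; case: ifP.
  by rewrite (bigD1 i)//= eqxx N0 mul0e.
apply/seteqP; split=> t /=; first by move=> Nt j; case: eqVneq => // ->.
by move=> /(_ i); rewrite eqxx.
Qed.

Lemma power_measure_ae n (Q : T -> Prop) : {ae mu, forall x, Q x} ->
  {ae mu^n, forall x, forall i, Q (tnth x i)}.
Proof.
move=> [N [mN N0 QN]]; apply: filter_forall => i.
exists [set x | N (tnth x i)]; split.
- by rewrite -[X in measurable X]setTI; exact: measurable_tnth.
- exact: power_measure_null.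
- by move=> x /= hx; exact: QN.
Qed.

End power_measure_theory.

(** * Reflection and diagonals *)

Section space_measurability.
Context {R : realType} (k : space_kind) (nu : nat).
Local Notation point := (nu.-tuple R).

Lemma measurable_space : measurable (space R k nu).
Proof.
rewrite /space; case: k => //.
rewrite (_ : [set x | _] = tbox (fun=> `[- pi, pi[%classic)).
  by apply: measurable_tbox => i; exact: measurable_itv.
by apply/seteqP; split=> x /= h i; have := h i; rewrite /= in_itv /=.
Qed.

Lemma measurable_space_pow n : measurable (space_pow R k nu n).
Proof. exact: (measurable_tbox (fun _ : 'I_n => measurable_space)). Qed.

Lemma measurable_cube (t : R) : measurable (@cube R nu t).
Proof.
rewrite (_ : cube t = tbox (fun=> `[- t, t]%classic)).
  by apply: measurable_tbox => i; exact: measurable_itv.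
by apply/seteqP; split=> x /= h i; have := h i; rewrite /= in_itv/= -ler_norml.
Qed.

Lemma measurable_neg : measurable_fun setT (@neg R k nu).
Proof.
apply/measurable_fun_tnthP => i.
rewrite (_ : _ \o _ = (fun x : point => neg1 k (tnth x i))); last first.
  by apply/funext => x /=; rewrite tnth_mktuple.
have mi : measurable_fun setT (fun x : point => tnth x i) by exact: measurable_tnth.
rewrite /neg1; case: k; first exact: measurable_funN.
apply: measurable_fun_ifT => //; last exact: measurable_funN.
exact: measurable_fun_eqr.
Qed.

Lemma measurable_neg_tuple n : measurable_fun setT (@neg_tuple R k nu n).
Proof.
apply/measurable_fun_tnthP => i.
rewrite (_ : _ \o _ = @neg R k nu \o (fun x => tnth x i)); last first.
  by apply/funext => x /=; rewrite tnth_mktuple.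
apply: measurableT_comp; [exact: measurable_neg|exact: measurable_tnth].
Qed.

Lemma neg1K (t : R) : match k with Euclidean => True | Torus => - pi <= t < pi end ->
  neg1 k (neg1 k t) = t.
Proof.
rewrite /neg1; case: k => [_|/andP[t1 t2]]; first by rewrite opprK.
have [->|h] := eqVneq t (- pi); first by rewrite eqxx.
by rewrite eqr_opp lt_eqF// opprK.
Qed.

Lemma negK (x : point) : space R k nu x -> neg k (neg k x) = x.
Proof.
move=> Ex; apply: eq_from_tnth => i; rewrite !tnth_mktuple neg1K//.
by move: Ex; rewrite /space; case: k => // /(_ i).
Qed.

Lemma space_neg (x : point) : space R k nu x -> space R k nu (neg k x).
Proof.
rewrite /space /neg; case: k => // h i; rewrite tnth_mktuple /neg1.
have /andP[h1 h2] := h i; case: ifPn => [_|hn].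
  by rewrite lexx /= -subr_gt0 opprK addr_gt0// pi_gt0.
by rewrite lerN2 (ltW h2)/= ltrNl lt_neqAle eq_sym hn.
Qed.

Lemma norm_neg1 (t : R) : `|neg1 k t| = `|t|.
Proof.
by rewrite /neg1; case: k; [|case: eqP => [->|_]]; rewrite normrN.
Qed.

Lemma cube_neg (t : R) (x : point) : cube t x -> cube t (neg k x).
Proof. by move=> h i; rewrite tnth_mktuple norm_neg1. Qed.

Lemma neg_tupleK n (x : n.-tuple point) : space_pow R k nu n x ->
  neg_tuple k (neg_tuple k x) = x.
Proof.
by move=> Ex; apply: eq_from_tnth => i; rewrite !tnth_mktuple negK//; exact: Ex.
Qed.

Lemma space_pow_neg n (x : n.-tuple point) : space_pow R k nu n x ->
  space_pow R k nu n (neg_tuple k x).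
Proof. by move=> Ex i; rewrite tnth_mktuple; apply: space_neg; exact: Ex. Qed.

(** [neg] is an involution on E only, so an image is a preimage cut down to E. This is how images
    are seen to be measurable. *)
Lemma neg_image (A : set point) : A `<=` space R k nu ->
  neg k @` A = space R k nu `&` (neg k @^-1` A).
Proof.
move=> AE; apply/seteqP; split=> [_ [x Ax <-]|x [Ex Ax]].
  by split; [exact/space_neg/AE|rewrite /= negK//; exact: AE].
by exists (neg k x) => //; rewrite negK.
Qed.

Lemma neg_imageK (A : set point) : A `<=` space R k nu ->
  neg k @` (neg k @` A) = A.
Proof.
move=> AE; apply/seteqP; split=> [_ [_ [x Ax <-] <-]|x Ax].
  by rewrite negK//; exact: AE.
by exists (neg k x); [exists x|rewrite negK//; exact: AE].
Qed.

Lemma bounded_borel_neg (A : set point) : bounded_borel k A ->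
  bounded_borel k (neg k @` A).
Proof.
move=> [mA AE [t At]]; split.
- rewrite neg_image//; apply: measurableI; first exact: measurable_space.
  by rewrite -[X in measurable X]setTI; apply: measurable_neg.
- by move=> _ [x Ax <-]; apply/space_neg/AE.
- by exists t => _ [x Ax <-]; apply/cube_neg/At.
Qed.

Lemma bounded_borelI (A B : set point) : bounded_borel k A -> measurable B ->
  bounded_borel k (A `&` B).
Proof.
move=> [mA AE [t At]] mB; split; first exact: measurableI.
  by move=> x [/AE].
by exists t => x [/At].
Qed.

Lemma bounded_borel_set0 : bounded_borel k (@set0 point).
Proof. by split=> //; exists 0. Qed.

End space_measurability.

Section diagonals.
Context {R : realType} (nu : nat).
Local Notation point := (nu.-tuple R).
Variable mu : {sigma_finite_measure set point -> \bar R}.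
Variables (E : set point) (phi : point -> point).
Hypothesis mE : measurable E.
Hypothesis mphi : measurable_fun setT phi.
Hypothesis phiE : forall x, E x -> E (phi x).
Hypothesis phiK : forall x, E x -> phi (phi x) = x.
Hypothesis muE : forall x, E x -> mu [set x] = 0%E.
Local Notation "'mu^' n" := (power_measure mu n) (at level 2, format "'mu^' n").

(** Taken with [phi] the identity for the diagonals x_l = x_l' and with [phi] the reflection for x_l
    = - x_l'. *)
Definition graph_set n (l l' : 'I_n) : set (n.-tuple point) :=
  [set x | [/\ E (tnth x l), E (tnth x l') & tnth x l = phi (tnth x l')]].

Lemma measurable_graph d (T : measurableType d) (f g : T -> point) :
  measurable_fun setT f -> measurable_fun setT g ->
  measurable [set x | f x = g x].
Proof.
move=> mf mg.
rewrite (_ : [set x | _] = \bigcap_(i in [set: 'I_nu]) [set x | tnth (f x) i == tnth (g x) i]).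
  apply: fin_bigcap_measurable => // i _.
  have h : measurable_fun setT (fun x => tnth (f x) i == tnth (g x) i).
    apply: measurable_fun_eqr.
      by have /measurable_fun_tnthP /(_ i) := mf.
    by have /measurable_fun_tnthP /(_ i) := mg.
  have := h measurableT [set true]; rewrite setTI; apply.
  by [].
apply/seteqP; split=> x /=; first by move=> fg i _ /=; rewrite fg.
by move=> h; apply: eq_from_tnth => i; apply/eqP; exact: h.
Qed.

Lemma measurable_point (a : point) : measurable [set a].
Proof.
rewrite (_ : [set a] = [set x | id x = cst a x]); last by apply/seteqP; split.
by apply: measurable_graph.
Qed.

Lemma measurable_graph_set n (l l' : 'I_n) : measurable (graph_set l l').
Proof.
have mt (i : 'I_n) : measurable_fun setT (fun x : n.-tuple point => tnth x i).
  exact: measurable_tnth.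
rewrite (_ : graph_set l l' = (fun x => tnth x l) @^-1` E `&`
  (fun x => tnth x l') @^-1` E `&` [set x | tnth x l = phi (tnth x l')]); last first.
  by apply/seteqP; split=> x /=; [case|case=> -[]].
apply: measurableI; first apply: measurableI.
- by rewrite -[X in measurable X]setTI; exact: mt.
- by rewrite -[X in measurable X]setTI; exact: mt.
- by apply: measurable_graph => //; apply: measurableT_comp.
Qed.

Lemma graph_set_sym n (l l' : 'I_n) : graph_set l l' = graph_set l' l.
Proof.
apply/seteqP; split=> x [El El' h]; split => //.
  by rewrite h phiK.
by rewrite h phiK.
Qed.

(** If one of the indices is 0, Fubini reduces the claim to single points, which are null; otherwise
    the first coordinate is free and the claim is the one for n - 1 coordinates. *)
Lemma power_measure_graph_set n (l l' : 'I_n) : l != l' ->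
  mu^n (graph_set l l') = 0%E.
Proof.
elim: n l l' => [|n IHn] l l'; first by case: l.
have mpre (m m' : 'I_n.+1) : measurable (@cons_pair _ point n @^-1` graph_set m m').
  rewrite -[X in measurable X]setTI; apply: measurable_cons_pair => //.
  exact: measurable_graph_set.
have tE (x : point) (y : n.-tuple point) (i : 'I_n) :
    tnth (cons_pair (x, y)) (lift ord0 i) = tnth y i.
  by rewrite tnthS; congr tnth; exact/val_inj.
have h0 (m : 'I_n) : mu^(n.+1) (graph_set ord0 (lift ord0 m)) = 0%E.
  rewrite /= /power_step /pushforward.
  (* The order of integration is exchanged: for a fixed tail [y] the section in the first coordinate
     lies in the single point [phi (tnth y m)]. *)
  transitivity ((mu \x^ mu^n) (@cons_pair _ point n @^-1` graph_set ord0 (lift ord0 m)))%E.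
    by apply: product_measure_unique => // A B mA mB; exact: product_measure2E.
  rewrite /product_measure2 integral0_eq// => y _ /=.
  have [Ey|nEy] := pselect (E (tnth y m)).
    apply/eqP; rewrite eq_le measure_ge0 andbT -(muE (phiE Ey)).
    apply: le_measure; rewrite ?inE//; [exact: measurable_ysection|exact: measurable_point|].
    move=> x /set_mem /= [_ _].
    by rewrite tE => <-.
  rewrite (_ : ysection _ _ = set0) ?measure0//.
  rewrite -subset0 => x; rewrite /ysection /= inE /= => -[_ +  _].
  by rewrite tE.
case: (unliftP ord0 l) => [m ->|->]; case: (unliftP ord0 l') => [m' ->|->] //.
- rewrite (inj_eq lift_inj) => mm'.
  rewrite /= /power_step /pushforward.
  rewrite (_ : _ @^-1` _ = setT `*` graph_set m m').
    rewrite product_measure1E//; last exact: measurable_graph_set.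
    by rewrite IHn// mule0.
  apply/seteqP; split=> -[x y] /=; rewrite /graph_set /= !tE.
    by move=> h; split.
  by case.
- by move=> _; rewrite graph_set_sym h0.
Qed.

End diagonals.

(** * Regular systems *)

Lemma measurable_bool_set d (T : measurableType d) (f : T -> bool) :
  measurable_fun setT f -> measurable [set x | f x].
Proof.
by move=> mf; rewrite -[X in measurable X]setTI; exact: (mf measurableT [set true]).
Qed.

Section half_space.
Context {R : realType} (k : space_kind) (nu : nat).
Local Notation point := (nu.-tuple R).

Definition lexlt (x y : point) := exists i : 'I_nu,
  (forall j : 'I_nu, (j < i)%N -> tnth x j = tnth y j) /\ tnth x i < tnth y i.

Lemma lexlt_asym x y : lexlt x y -> lexlt y x -> False.
Proof.
move=> [i [hi xi]] [j [hj xj]]; case: (ltngtP i j) => ij.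
- by move: xi; rewrite (hj _ ij) ltxx.
- by move: xj; rewrite (hi _ ij) ltxx.
- by move/val_inj : ij xj xi => -> /lt_trans h /h; rewrite ltxx.
Qed.

Lemma lexlt_total x y : x != y -> lexlt x y \/ lexlt y x.
Proof.
move=> xy; have [i hi] : exists i, tnth x i != tnth y i.
  apply: contrapT => /forallNP h; move: xy; rewrite (_ : x = y) ?eqxx//.
  by apply: eq_from_tnth => i; apply/eqP/negPn/negP; exact: h.
case: (@arg_minnP _ i (fun i => tnth x i != tnth y i) (fun i => i : nat) hi) => j hj jmin.
have eqj (m : 'I_nu) : (m < j)%N -> tnth x m = tnth y m.
  by move=> mj; apply/eqP/negPn/negP => /jmin; rewrite leqNgt mj.
move: hj; rewrite neq_lt => /orP[h|h]; [left|right]; exists j; split => // m mj.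
by rewrite eqj.
Qed.

(** A measurable choice, by lexicographic order, of one point from each pair {x, -x} with x
    different from -x. *)
Definition half_space : set point := [set x | lexlt (neg k x) x].

Lemma measurable_half_space : measurable half_space.
Proof.
have mt (i : 'I_nu) : measurable_fun setT (fun x : point => tnth x i).
  exact: measurable_tnth.
have mn (i : 'I_nu) : measurable_fun setT (fun x : point => tnth (neg k x) i).
  by have /measurable_fun_tnthP /(_ i) := @measurable_neg R k nu.
rewrite (_ : half_space = \bigcup_(i in [set: 'I_nu])
   ((\bigcap_(j in [set: 'I_nu]) [set x | (j < i)%N ==> (tnth (neg k x) j == tnth x j)]) `&`
    [set x | tnth (neg k x) i < tnth x i])).
  apply: fin_bigcup_measurable => // i _; apply: measurableI.
    apply: fin_bigcap_measurable => // j _; case: (j < i)%N => /=; last by apply: measurable_bool_set; exact: measurable_cst.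
    exact/measurable_bool_set/measurable_fun_eqr.
  exact: (measurable_bool_set (measurable_fun_ltr (mn i) (mt i))).
apply/seteqP; split=> [x [i [h1 h2]]|x [i _ [h1 h2]]]; exists i => //; split=> //.
  by move=> j _ /=; apply/implyP => /h1 ->.
by move=> j ji; have := h1 j Logic.I; rewrite /= ji => /eqP.
Qed.

Lemma half_space_neg x : space R k nu x -> half_space x -> half_space (neg k x) -> False.
Proof. by move=> Ex; rewrite /half_space /= negK// => h1 h2; exact: lexlt_asym h1 h2. Qed.

Lemma half_space_total x : space R k nu x -> neg k x != x ->
  half_space x \/ half_space (neg k x).
Proof. by move=> Ex /lexlt_total; rewrite /half_space /= negK. Qed.

End half_space.
Arguments half_space {R} k {nu} _.

Section regular_refinement.
Context {R : realType} (k : space_kind) (nu : nat).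
Local Notation point := (nu.-tuple R).

Lemma bounded_borel_bigcup (I : finType) (B : I -> set point) :
  (forall i, bounded_borel k (B i)) -> bounded_borel k (\bigcup_i B i).
Proof.
move=> bB; split.
- by apply: fin_bigcup_measurable => // i _; have [] := bB i.
- by move=> x [i _]; have [_ h _] := bB i; exact: h.
- have h i : exists t, B i `<=` cube t by have [] := bB i.
  pose t i := projT1 (cid (h i)).
  exists (\sum_i `|t i|) => x [i _ Bx] m.
  have : cube (t i) x by apply: (projT2 (cid (h i))).
  move=> /(_ m) /le_trans; apply.
  rewrite (bigD1 i)//= (le_trans (ler_norm _))// lerDl.
  by apply: sumr_ge0.
Qed.

Section family.
Variables (I : finType) (B : I -> set point).
Hypothesis bB : forall i, bounded_borel k (B i).

Let BE i : B i `<=` space R k nu. Proof. by have [] := bB i. Qed.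
Let mB i : measurable (B i). Proof. by have [] := bB i. Qed.

Let U : set point := \bigcup_i (B i) `|` neg k @` (\bigcup_i (B i)).

Let bU : bounded_borel k U.
Proof.
have b := bounded_borel_bigcup bB; have b' := bounded_borel_neg b.
have := @bounded_borel_bigcup bool (fun c => if c then \bigcup_i (B i) else neg k @` (\bigcup_i (B i))).
rewrite (_ : \bigcup_(i : bool) _ = U); first by apply; case.
apply/seteqP; split=> [x [[] _ h]|x [h|h]]; [by left|by right|by exists true|by exists false].
Qed.

(* The cells are the atoms of the algebra generated by the sets B i and - B i,
   cut along a half space, which makes a cell disjoint from its opposite. *)
Let sig x : {ffun I -> bool * bool} := [ffun i => (`[< B i x >], `[< B i (neg k x) >])].

Let cell (S : {ffun I -> bool * bool}) : set point :=
  [set x | [/\ U x, half_space k x & sig x = S]].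

Let mcell S : measurable (cell S).
Proof.
rewrite (_ : cell S = (U `&` half_space k) `&`
  \bigcap_(i in [set: I]) ((if (S i).1 then B i else ~` B i) `&`
     (if (S i).2 then neg k @^-1` B i else ~` (neg k @^-1` B i)))).
  apply: measurableI.
    by apply: measurableI; [have [] := bU|exact: measurable_half_space].
  apply: fin_bigcap_measurable => // i _; apply: measurableI.
    by case: ifP => _; [|apply: measurableC]; exact: mB.
  have : measurable (neg k @^-1` B i).
    by rewrite -[X in measurable X]setTI; apply: measurable_neg.
  by case: ifP => _ //; exact: measurableC.
apply/seteqP; split=> [x [Ux Hx Sx]|x [[Ux Hx] Sx]].
  split=> // i _; rewrite -Sx ffunE /=.
  by split; [case: (asboolP (B i x))|case: (asboolP (B i (neg k x)))].
split=> //; apply/ffunP => i; rewrite ffunE; have [] := Sx i Logic.I.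
case: (S i) => [[] []] /= h1 h2; congr pair; first [exact/asboolT|exact/asboolF].
Qed.

Let bcell S : bounded_borel k (cell S).
Proof.
have [mU UE [t Ut]] := bU; split; first exact: mcell.
  by move=> x [/UE].
by exists t => x [/Ut].
Qed.

Let cellE S : cell S `<=` space R k nu. Proof. by have [] := bcell S. Qed.

(** Each membership pattern gives a pair of opposite cells. The sets of a regular system contain no
    fixed point of the reflection, so the covering clause is restricted to points with
    [neg k x != x]. *)
Lemma regular_refinement : exists N (D : sindex N -> set point),
  [/\ regular_system (k := k) D,
      forall i a, D a `<=` B i \/ D a `&` B i = set0 &
      forall i x, B i x -> neg k x != x -> exists a, D a x].
Proof.
pose N := #|{: {ffun I -> bool * bool}}|.
pose D (a : sindex N) := if a.2 then neg k @` cell (enum_val a.1) else cell (enum_val a.1).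
have DE a : D a `<=` space R k nu.
  rewrite /D; case: a.2; last exact: cellE.
  by have [_ ] := bounded_borel_neg (bcell (enum_val a.1)).
exists N, D; split; first split.
- by move=> a; rewrite /D; case: a.2; [apply: bounded_borel_neg|]; exact: bcell.
- move=> [i b]; rewrite /D /=; case: b => //=.
  by rewrite neg_imageK//; exact: cellE.
- move=> [i b] [i' b'] ab; rewrite -subset0 => x []; rewrite /D /=.
  case: b ab => ab; case: b' ab => ab /=.
  + move=> [y Sy <-] [y' Sy' e]; have := congr1 (neg k) e.
    rewrite !negK; [|exact: (cellE Sy)|exact: (cellE Sy')] => yy'; move: ab.
    case: Sy => _ _ s; case: Sy' => _ _; rewrite yy' s => /enum_val_inj ->.
    by rewrite eqxx.
  + move=> [y Sy <-] [_ h _]; have [_ h' _] := Sy.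
    exact: half_space_neg (cellE Sy) h' h.
  + move=> [_ h _] [y Sy e]; move: h; rewrite -e; have [_ h' _] := Sy => h.
    exact: half_space_neg (cellE Sy) h' h.
  + move=> [_ _ s] [_ _]; rewrite s => /enum_val_inj e; move: ab.
    by rewrite e eqxx.
- move=> i [j b]; rewrite /D /=; case: b => /=.
    case h : (enum_val j i).2; [left|right].
      move=> _ [y [_ _ s] <-]; move: h; rewrite -s ffunE /= => /asboolP//.
    rewrite -subset0 => _ [[y [_ _ s] <-]]; move: h; rewrite -s ffunE /= => /asboolP//.
  case h : (enum_val j i).1; [left|right].
    move=> x [_ _ s]; move: h; rewrite -s ffunE /= => /asboolP//.
  rewrite -subset0 => x [[_ _ s]]; move: h; rewrite -s ffunE /= => /asboolP//.
- move=> i x Bx nx; have Ex := BE Bx.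
  case: (half_space_total Ex nx) => h.
    exists (enum_rank (sig x), false); rewrite /D /= enum_rankK; split => //.
    by left; exists i.
  exists (enum_rank (sig (neg k x)), true); rewrite /D /= enum_rankK.
  exists (neg k x); last exact: negK.
  by split=> //; right; exists x => //; exists i.
Qed.

End family.
End regular_refinement.

(** * The space K *)

Section psd.
Context {R : realType} {d : nat}.
Variable M : 'I_d -> 'I_d -> R[i].
Hypothesis psdM : hermitian_psd M.

Lemma psd_two (j j' : 'I_d) (a b : R[i]) : j != j' ->
  0 <= (a * M j j * conjc a + a * M j j' * conjc b) +
       (b * M j' j * conjc a + b * M j' j' * conjc b).
Proof.
move=> jj'; have [_ h] := psdM.
have := h (fun l => if l == j then a else if l == j' then b else 0).
have j'j : (j' == j) = false by apply/negbTE; rewrite eq_sym.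
have S (c : R[i]) l : \sum_(j'0 < d) c * M l j'0 *
   conjc (if j'0 == j then a else if j'0 == j' then b else 0) =
   c * M l j * conjc a + c * M l j' * conjc b.
  rewrite (bigD1 j)//= eqxx (bigD1 j')//= ?eqxx ?j'j// big1 ?addr0//.
  by move=> i /andP[/negbTE -> /negbTE ->]; rewrite conjc0 mulr0.
under eq_bigr do rewrite S.
rewrite (bigD1 j)//= eqxx (bigD1 j')//= ?eqxx ?j'j// big1 ?addr0//.
by move=> i /andP[/negbTE -> /negbTE ->]; rewrite !mul0r addr0.
Qed.

Lemma psd_diag_ge0 (j : 'I_d) : 0 <= M j j.
Proof.
have [_ h] := psdM; have := h (fun l => (l == j)%:R).
rewrite (bigD1 j)//= (bigD1 j)//= !eqxx mul1r conjc1 mulr1 big1 ?addr0; last first.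
  by move=> i /negbTE ->; rewrite conjc0 mulr0.
rewrite big1 ?addr0// => i /negbTE ->.
by rewrite big1// => l _; rewrite !mul0r.
Qed.

(** The form is evaluated at the vector with entries - t conj(M_jj') and s, for real t and s, which
    gives a real quadratic form with discriminant of the required sign. *)
Lemma psd_cauchy_schwarz (j j' : 'I_d) :
  csq (M j j') <= Re (M j j) * Re (M j' j').
Proof.
have /ger0_Im i0 := psd_diag_ge0 j; have /ger0_Im i0' := psd_diag_ge0 j'.
have := psd_diag_ge0 j; rewrite lecE => /andP[_ /= p0].
have := psd_diag_ge0 j'; rewrite lecE => /andP[_ /= q0].
have [<-|jj'] := eqVneq j j'; first by rewrite /csq i0 expr0n addr0 expr2.
have [hM _] := psdM.
set p := Re (M j j) in p0 *; set q := Re (M j' j') in q0 *.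
set m := csq (M j j').
have m0 : 0 <= m by exact: csq_ge0.
have key (t s : R) : 0 <= p * m * t ^+ 2 - 2 * m * t * s + q * s ^+ 2.
  have := @psd_two j j' ((- t)%:C%C * conjc (M j j')) (s%:C%C) jj'.
  rewrite lecE => /andP[_]; rewrite (hM j j').
  move: i0 i0'; rewrite /p /q /m /csq.
  case: (M j j) => p1 p2; case: (M j' j') => q1 q2; case: (M j j') => u v /= -> ->.
  by congr (0 <= _); ring.
have [->|mn0] := eqVneq m 0; first exact: mulr_ge0.
have mpos : 0 < m by rewrite lt_def mn0.
have [qz|qn0] := eqVneq q 0.
  (* For q = 0 the form is affine in s, and s = p + 1 makes it equal to - m (p + 2) < 0, a
     contradiction. *)
  have := key 1 (p + 1); rewrite qz; nra.
have qpos : 0 < q by rewrite lt_def qn0.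
(* The minimizing ratio s / t = m / q, without the division. *)
have := key q m.
have -> : p * m * q ^+ 2 - 2 * m * q * m + q * m ^+ 2 = q * m * (p * q - m) by ring.
by rewrite pmulr_rge0 ?mulr_gt0// subr_ge0.
Qed.

End psd.

Section K_space.
Context {R : realType} {k : space_kind} {nu d : nat}.
Variable G : spectral_measure R k nu d.
Local Notation point := (nu.-tuple R).
Local Notation E := (space R k nu).
Local Notation En := (space_pow R k nu).
Local Notation "'mu^' n" := (power_measure (sm_mu G) n) (at level 2, format "'mu^' n").

Lemma cmeasurable_prod_density n (j j' : 'I_n -> 'I_d) :
  cmeasurable (En n) (prod_density G j j').
Proof.
apply: cmeasurable_prod => i _.
apply: (@cmeasurable_comp _ _ _ _ _ E (En n) (@tnth _ point ^~ i)).
- exact: measurable_space.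
- by move=> _ [x Ex <-]; exact: Ex.
- by apply: measurable_funTS; exact: measurable_tnth.
- exact: sm_g_measurable.
Qed.

Lemma ae_density_psd n : {ae mu^n, forall x, En n x ->
  forall i, hermitian_psd (fun l l' => sm_g G l l' (tnth x i))}.
Proof.
have := power_measure_ae n (sm_psd G); apply: filterS => x h Ex i.
by apply: h; exact: Ex.
Qed.

(* The truncation at 0 is effective on a null set only. *)
Definition weight n (j : 'I_n -> 'I_d) (x : n.-tuple point) : R :=
  Num.max 0 (Re (prod_density G j j x)).

Lemma weight_ge0 n (j : 'I_n -> 'I_d) x : 0 <= weight j x.
Proof. by rewrite le_max lexx. Qed.

Lemma measurable_weight n (j : 'I_n -> 'I_d) : measurable_fun (En n) (weight j).
Proof.
apply: measurable_maxr; first exact: measurable_cst.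
by have [] := cmeasurable_prod_density j j.
Qed.

Lemma psd_weight n (j : 'I_n -> 'I_d) (x : n.-tuple point) :
  (forall i, hermitian_psd (fun l l' => sm_g G l l' (tnth x i))) ->
  weight j x = \prod_i Re (sm_g G (j i) (j i) (tnth x i)) /\
  prod_density G j j x = (weight j x)%:C%C.
Proof.
move=> h.
have h0 i : 0 <= sm_g G (j i) (j i) (tnth x i).
  exact: (psd_diag_ge0 (h i)).
have hr i : sm_g G (j i) (j i) (tnth x i) =
    (Re (sm_g G (j i) (j i) (tnth x i)))%:C%C.
  by apply: complexP => //=; apply: ger0_Im.
have E : prod_density G j j x =
   (\prod_i Re (sm_g G (j i) (j i) (tnth x i)))%:C%C.
  by rewrite rmorph_prod; apply: eq_bigr => i _; exact: hr.
have p0 : 0 <= \prod_i Re (sm_g G (j i) (j i) (tnth x i)).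
  by apply: prodr_ge0 => i _; have := h0 i; rewrite lecE => /andP[].
by rewrite /weight E /= max_r.
Qed.

Lemma psd_prod_density n (j j' : 'I_n -> 'I_d) (x : n.-tuple point) :
  (forall i, hermitian_psd (fun l l' => sm_g G l l' (tnth x i))) ->
  csq (prod_density G j j' x) <= weight j x * weight j' x.
Proof.
move=> h; have [-> _] := psd_weight j h; have [-> _] := psd_weight j' h.
rewrite -big_split /= (big_morph (@csq R) (@csqM R) (_ : csq 1 = 1)); last first.
  by rewrite /csq /= expr1n expr0n addr0.
apply: ler_prod => i _; rewrite csq_ge0 /=.
exact: (psd_cauchy_schwarz (h i)).
Qed.

Lemma sqnormE n (j : 'I_n -> 'I_d) (f : n.-tuple point -> R[i]) :
  cmeasurable (En n) f ->
  sqnorm G j f = (\int[mu^n]_(x in En n) (csq (f x) * weight j x)%:E)%E.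
Proof.
move=> mf; rewrite /sqnorm.
under eq_integral do rewrite cmod_sq.
apply: ae_eq_integral.
- exact: measurable_space_pow.
- apply/measurable_EFinP; apply: measurable_funM; first exact: measurable_csq.
  by have [] := cmeasurable_prod_density j j.
- apply/measurable_EFinP; apply: measurable_funM; first exact: measurable_csq.
  exact: measurable_weight.
- have := ae_density_psd n; apply: filterS => x h Ex.
  by congr (_ * _)%:E; have [_ e] := psd_weight j (h Ex); rewrite e.
Qed.

Lemma measurable_csq_weight n (j : 'I_n -> 'I_d) (f : n.-tuple point -> R[i]) :
  cmeasurable (En n) f ->
  measurable_fun (En n) (fun x => (csq (f x) * weight j x)%:E).
Proof.
move=> mf; apply/measurable_EFinP; apply: measurable_funM; first exact: measurable_csq.
exact: measurable_weight.
Qed.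

(** Squared norms replace norms throughout, so the triangle inequality is used in the form |x + y|^2
    <= 2 |x|^2 + 2 |y|^2 and enters as such a pointwise comparison. *)
Lemma sqnorm_le n (j : 'I_n -> 'I_d) (f g h : n.-tuple point -> R[i]) (a b : R) :
  0 <= a -> 0 <= b ->
  cmeasurable (En n) f -> cmeasurable (En n) g -> cmeasurable (En n) h ->
  (forall x, En n x -> csq (f x) <= a * csq (g x) + b * csq (h x)) ->
  (sqnorm G j f <= a%:E * sqnorm G j g + b%:E * sqnorm G j h)%E.
Proof.
move=> a0 b0 mf mg mh le; rewrite !sqnormE//.
have mE := @measurable_space_pow R k nu n.
have pos (f0 : n.-tuple point -> R[i]) x : (0 <= (csq (f0 x) * weight j x)%:E)%E.
  by rewrite lee_fin mulr_ge0 ?csq_ge0 ?weight_ge0.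
rewrite -!ge0_integralZl//; try exact: measurable_csq_weight.
rewrite -ge0_integralD//.
- apply: ge0_le_integral => //.
  + exact: measurable_csq_weight.
  + by apply: emeasurable_funD; apply: measurable_funeM; exact: measurable_csq_weight.
  + move=> x Ex; rewrite -!EFinM -EFinD lee_fin !mulrA -mulrDl.
    by rewrite ler_wpM2r ?weight_ge0// le.
- by move=> x _; apply: mule_ge0.
- by apply: measurable_funeM; exact: measurable_csq_weight.
- by move=> x _; apply: mule_ge0.
- by apply: measurable_funeM; exact: measurable_csq_weight.
Qed.

Lemma sqnorm_ge0 n (j : 'I_n -> 'I_d) (f : n.-tuple point -> R[i]) :
  cmeasurable (En n) f -> (0 <= sqnorm G j f)%E.
Proof.
move=> mf; rewrite sqnormE//; apply: integral_ge0 => x _.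
by rewrite lee_fin mulr_ge0 ?csq_ge0 ?weight_ge0.
Qed.

Lemma cmeasurable_lin n (f h : n.-tuple point -> R[i]) (a b : R) :
  cmeasurable (En n) f -> cmeasurable (En n) h ->
  cmeasurable (En n) (fun x => a%:C%C * f x + b%:C%C * h x).
Proof.
by move=> mf mh; apply: cmeasurableD; apply: cmeasurableM => //;
  exact: cmeasurable_cst.
Qed.

Lemma sqnorm_lin n (j : 'I_n -> 'I_d) (f h : n.-tuple point -> R[i]) (a b : R) :
  cmeasurable (En n) f -> cmeasurable (En n) h ->
  (sqnorm G j (fun x => a%:C%C * f x + b%:C%C * h x)%R
   <= (2 * a ^+ 2)%:E * sqnorm G j f + (2 * b ^+ 2)%:E * sqnorm G j h)%E.
Proof.
move=> mf mh; apply: sqnorm_le => //.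
- by rewrite mulr_ge0 ?sqr_ge0.
- by rewrite mulr_ge0 ?sqr_ge0.
- exact: cmeasurable_lin.
- move=> x _; apply: (le_trans (csqD_le _ _)).
  by rewrite !csqM !csq_real !mulrA.
Qed.

Lemma in_K_lin n (j : 'I_n -> 'I_d) (f h : n.-tuple point -> R[i]) (a b : R) :
  in_K G j f -> in_K G j h -> in_K G j (fun x => a%:C%C * f x + b%:C%C * h x).
Proof.
move=> [mf ef nf] [mh eh nh]; split; first exact: cmeasurable_lin.
  by move=> x Ex; rewrite ef// eh//; apply: complexP;
    rewrite ?(ReJ, ImJ, ReD, ImD, ReM, ImM) /=; ring.
apply: (le_lt_trans (sqnorm_lin j a b mf mh)).
have fin (g : n.-tuple point -> R[i]) (c : R) : 0 <= c -> cmeasurable (En n) g ->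
    (sqnorm G j g < +oo)%E -> (c%:E * sqnorm G j g < +oo)%E.
  by move=> c0 mg ng; rewrite lte_mul_pinfty.
by apply: lte_add_pinfty; apply: fin => //; rewrite mulr_ge0 ?sqr_ge0.
Qed.

Lemma soppK N : involutive (@sopp N).
Proof. by case=> i b; rewrite /sopp /= negbK. Qed.

Lemma sopp_neq N (a : sindex N) : a != sopp a.
Proof. by case: a => i b; rewrite /sopp xpair_eqE eqxx /=; case: b. Qed.

(** A fixed point of the reflection in D_a would also lie in D_(-a), which is disjoint from D_a. *)
Lemma regular_neq N (D : sindex N -> set point) a x :
  regular_system (k := k) D -> D a x -> neg k x != x.
Proof.
move=> [bD nD dD] Dx; apply/eqP => e.
have [_ DE _] := bD a; have := Dx; rewrite nD => -[y Dy yx].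
have [_ DE' _] := bD (sopp a).
have : D (sopp a) x by rewrite -e -yx negK//; exact: DE'.
by move=> Dx'; have := dD _ _ (sopp_neq a); rewrite -subset0 => /(_ x); apply.
Qed.

Lemma regular_inj N (D : sindex N -> set point) a b x :
  regular_system (k := k) D -> D a x -> D b x -> a = b.
Proof.
move=> [bD nD dD] Da Db; apply/eqP/negPn/negP => /dD.
by rewrite -subset0 => /(_ x); apply.
Qed.

Lemma regular_opp N (D : sindex N -> set point) a x :
  regular_system (k := k) D -> D a x -> D (sopp a) (neg k x).
Proof.
move=> rD Dx; rewrite (rs_neg rD) soppK; exists x => //.
Qed.

(* As D' is finer than D, a coincidence a l = +- a l' between cells of D' forces
   the same coincidence between the cells of D that contain them. *)
Lemma adapted_refine N N' (D : sindex N -> set point) (D' : sindex N' -> set point)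
    n (f : n.-tuple point -> R[i]) :
  regular_system (k := k) D -> regular_system (k := k) D' ->
  (forall a b, D' b `<=` D a \/ D' b `&` D a = set0) ->
  (forall a x, D a x -> exists b, D' b x) ->
  adapted (k := k) D f -> adapted (k := k) D' f.
Proof.
move=> rD rD' ref cov [fc fo fd].
have inE b x : D' b x -> E x by have [_ h _] := rs_bounded rD' b; exact: h.
have sub a b x : D' b x -> D a x -> D' b `<=` D a.
  by move=> D'x Dx; case: (ref a b) => //; rewrite -subset0 => /(_ x); case.
have inD (b : 'I_n -> sindex N') x : box D' b x -> En n x.
  by move=> bx i; apply: inE (bx i).
have zero z c : box D' c z -> (~ exists a : 'I_n -> sindex N, box D a z) -> f z = 0.
  by move=> cz nz; apply: fo; [exact: (inD _ _ cz)|move=> a az; apply: nz; exists a].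
split.
- move=> b x y bx yb.
  have [[a ax]|nx] := pselect (exists a : 'I_n -> sindex N, box D a x).
    by apply: (fc a) => // i; apply: (sub _ _ _ (bx i) (ax i)); exact: yb.
  rewrite (zero x b)// (zero y b)// => -[a ay]; apply: nx; exists a => i.
  by apply: (sub _ _ _ (yb i) (ay i)); exact: bx.
- move=> x Ex nx; apply: fo => // a ax.
  have h i : exists b, D' b (tnth x i) by apply: cov (ax i).
  by apply: (nx (fun i => projT1 (cid (h i)))) => i; exact: (projT2 (cid (h i))).
- move=> b x bx [l [l' [ll' e]]].
  have [[a ax]|nx] := pselect (exists a : 'I_n -> sindex N, box D a x); last first.
    exact: zero bx nx.
  apply: (fd a) => //; exists l, l'; split=> //.
  have s := sub _ _ _ (bx l) (ax l).
  case: e => e.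
    left; apply: (regular_inj rD (x := tnth x l')) => //.
    by apply: s; rewrite e; exact: bx.
  right; apply: (regular_inj rD (ax l)).
  have := regular_opp rD' (bx l'); rewrite -e => /s Dal.
  have := regular_opp rD Dal; rewrite negK; last by apply: (inD _ _ bx).
  by move=> /(regular_inj rD (ax l')) ->; rewrite soppK; exact: ax.
Qed.

Lemma adapted_lin N (D : sindex N -> set point) n (f h : n.-tuple point -> R[i]) (a b : R) :
  adapted (k := k) D f -> adapted (k := k) D h ->
  adapted (k := k) D (fun x => a%:C%C * f x + b%:C%C * h x).
Proof.
move=> [fc fo fd] [hc ho hd]; split.
- by move=> c x y cx cy; rewrite (fc c x y)// (hc c x y).
- by move=> x Ex nx; rewrite fo// ho// !mulr0 addr0.
- by move=> c x cx e; rewrite (fd c)// (hd c)// !mulr0 addr0.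
Qed.

Theorem in_Khat_lin n (j : 'I_n -> 'I_d) f h (a b : R) :
  in_Khat G j f -> in_Khat G j h ->
  in_Khat G j (fun x => a%:C%C * f x + b%:C%C * h x).
Proof.
move=> [Kf [N [D [rD aD]]]] [Kh [N' [D' [rD' aD']]]].
split; first exact: in_K_lin.
pose B (c : sindex N + sindex N') := match c with inl u => D u | inr v => D' v end.
have bB c : bounded_borel k (B c).
  by case: c => c /=; [exact: (rs_bounded rD)|exact: (rs_bounded rD')].
have [N'' [D'' [rD'' ref cov]]] := regular_refinement bB.
exists N'', D''; split=> //; apply: adapted_lin.
  apply: (adapted_refine rD rD'' _ _ aD).
    by move=> u b0; exact: (ref (inl u) b0).
  by move=> u x Dx; apply: (cov (inl u)) => //; exact: regular_neq rD Dx.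
apply: (adapted_refine rD' rD'' _ _ aD').
  by move=> u b0; exact: (ref (inr u) b0).
by move=> u x Dx; apply: (cov (inr u)) => //; exact: regular_neq rD' Dx.
Qed.

End K_space.

(** * Density of simple functions *)

Section box_approximation.
Context {R : realType} {k : space_kind} {nu d : nat}.
Variable G : spectral_measure R k nu d.
Variables (n : nat) (j : 'I_n -> 'I_d).
Local Notation point := (nu.-tuple R).
Local Notation E := (space R k nu).
Local Notation En := (space_pow R k nu n).
Local Notation mun := (power_measure (sm_mu G) n).
Local Notation w := (weight G j).
Local Notation neg_n := (@neg_tuple R k nu n).

Let mEn : measurable En := @measurable_space_pow R k nu n.

Lemma measurable_comp_neg (h : n.-tuple point -> R) : measurable_fun En h ->
  measurable_fun En (fun x => h (neg_n x)).
Proof.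
move=> mh; apply: (@measurable_comp _ _ _ _ _ _ En h En neg_n) => //.
  by move=> _ [x Ex <-]; exact: space_pow_neg.
by apply: measurable_funTS; exact: measurable_neg_tuple.
Qed.

Lemma cmeasurable_comp_neg (f : n.-tuple point -> R[i]) : cmeasurable En f ->
  cmeasurable En (fun x => f (neg_n x)).
Proof. by move=> [fr fi]; split; [exact: measurable_comp_neg fr|exact: measurable_comp_neg fi]. Qed.

Lemma weighted_dominated (v_ : nat -> n.-tuple point -> R) (g : n.-tuple point -> R) :
  (forall m, measurable_fun En (v_ m)) -> measurable_fun En g ->
  (forall m x, En x -> 0 <= v_ m x <= g x) ->
  {ae mun, forall x, En x -> v_ m x @[m --> \oo] --> (0 : R)} ->
  (\int[mun]_(x in En) (g x * w x)%:E < +oo)%E ->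
  (\int[mun]_(x in En) (v_ m x * w x)%:E)%E @[m --> \oo] --> 0%E.
Proof.
move=> mv mg vg v0 goo.
have mw := measurable_weight G j.
have mgw : measurable_fun En (fun x => (g x * w x)%:E).
  by apply/measurable_EFinP; exact: measurable_funM.
have g0 x : En x -> 0 <= g x by move=> /(vg 0) /andP[]; exact: le_trans.
have := @dominated_convergence _ _ _ mun En mEn (fun m x => (v_ m x * w x)%:E)
  (fun=> 0%E) (fun x => (g x * w x)%:E).
case.
- by move=> m; apply/measurable_EFinP; exact: measurable_funM.
- exact: measurable_cst.
- apply: filterS v0 => x h Ex; apply/cvg_EFin; first by near=> m.
  by rewrite -[X in _ --> X](mul0r (w x)); apply: cvgMl; exact: h.
- apply/integrableP; split => //; apply: le_lt_trans goo.
  apply: ge0_le_integral => //.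
  + exact: measurableT_comp.
  + by move=> x Ex; rewrite lee_fin ger0_norm// mulr_ge0 ?weight_ge0 ?g0.
- apply: nearW => x m Ex; have /andP[h1 h2] := vg m x Ex.
  by rewrite lee_fin ger0_norm ?mulr_ge0 ?weight_ge0// ler_wpM2r ?weight_ge0.
by move=> _ _; rewrite integral0.
Unshelve. all: by end_near. Qed.

(* Instead of the invariance of the weighted measure under x |-> - x, its sum with
   its own reflection is used: approximation in this sense is stable under
   symmetrization. *)
Definition sym_int (h : n.-tuple point -> R) : \bar R :=
  (\int[mun]_(x in En) ((h x + h (neg_n x)) * w x)%:E)%E.

Let msym (h : n.-tuple point -> R) : measurable_fun En h ->
  measurable_fun En (fun x => ((h x + h (neg_n x)) * w x)%:E).
Proof.
move=> mh; apply/measurable_EFinP; apply: measurable_funM.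
  by apply: measurable_funD => //; exact: measurable_comp_neg.
exact: measurable_weight.
Qed.

Lemma sym_int_le (h h1 h2 : n.-tuple point -> R) (a b : R) : 0 <= a -> 0 <= b ->
  measurable_fun En h -> measurable_fun En h1 -> measurable_fun En h2 ->
  (forall x, En x -> 0 <= h x) -> (forall x, En x -> 0 <= h1 x) ->
  (forall x, En x -> 0 <= h2 x) ->
  (forall x, En x -> h x <= a * h1 x + b * h2 x) ->
  (sym_int h <= a%:E * sym_int h1 + b%:E * sym_int h2)%E.
Proof.
move=> a0 b0 mh mh1 mh2 h0 h10 h20 le.
have pos (u : n.-tuple point -> R) x : (forall x, En x -> 0 <= u x) -> En x ->
    (0 <= ((u x + u (neg_n x)) * w x)%:E)%E.
  move=> u0 Ex; rewrite lee_fin mulr_ge0 ?weight_ge0 ?addr_ge0 ?u0//.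
  exact: space_pow_neg.
rewrite /sym_int -!ge0_integralZl//; try exact: msym; try (by move=> x; exact: pos).
rewrite -ge0_integralD//.
- apply: ge0_le_integral => //.
  + by move=> x; exact: pos.
  + exact: msym.
  + by apply: emeasurable_funD; apply: measurable_funeM; exact: msym.
  + move=> x Ex; rewrite -!EFinM -EFinD lee_fin !mulrA -mulrDl.
    rewrite ler_wpM2r ?weight_ge0//.
    have := le _ Ex; have := le _ (space_pow_neg Ex); lra.
- by move=> x Ex; apply: mule_ge0 => //; exact: pos.
- by apply: measurable_funeM; exact: msym.
- by move=> x Ex; apply: mule_ge0 => //; exact: pos.
- by apply: measurable_funeM; exact: msym.
Qed.

Lemma sym_int_dominated (h_ : nat -> n.-tuple point -> R) (g : n.-tuple point -> R) :
  (forall m, measurable_fun En (h_ m)) -> measurable_fun En g ->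
  (forall m x, En x -> 0 <= h_ m x <= g x) ->
  (forall x, En x -> h_ m x @[m --> \oo] --> (0 : R)) ->
  (sym_int g < +oo)%E ->
  sym_int (h_ m) @[m --> \oo] --> 0%E.
Proof.
move=> mh mg hg h0 goo.
apply: (weighted_dominated (v_ := fun m x => h_ m x + h_ m (neg_n x))
  (g := fun x => g x + g (neg_n x))) => //.
- by move=> m; apply: measurable_funD => //; exact: measurable_comp_neg.
- by apply: measurable_funD => //; exact: measurable_comp_neg.
- move=> m x Ex; have := hg m _ Ex; have := hg m _ (space_pow_neg Ex); lra.
- apply: nearW => x Ex; rewrite -[X in _ --> X](addr0 0); apply: cvgD.
    exact: h0.
  by apply: h0; exact: space_pow_neg.
Qed.

(** The boxes may overlap, need not be symmetric and may meet the diagonals; these defects are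
    repaired afterwards by refinement, symmetrization and truncation. *)
Inductive box_step : (n.-tuple point -> R[i]) -> Prop :=
| Box_step_one c B : (forall i : 'I_n, bounded_borel k (B i)) ->
    box_step (fun x => c * (x \in tbox B)%:R)
| Box_step_add f g : box_step f -> box_step g -> box_step (fun x => f x + g x).

Lemma cmeasurable_indic (A D : set (n.-tuple point)) (c : R[i]) : measurable A ->
  cmeasurable D (fun x => c * (x \in A)%:R).
Proof.
move=> mA; apply: cmeasurableM; first exact: cmeasurable_cst.
have e (b : bool) : (b%:R : R[i]) = (b%:R : R)%:C%C by case: b.
split; under eq_fun do rewrite e /=; last exact: measurable_cst.
apply: measurable_funTS; exact: (@measurable_indic _ _ R setT _ mA).
Qed.

Lemma cmeasurable_box_step f D : box_step f -> cmeasurable D f.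
Proof.
elim=> [c B bB|u v _ mu_ _ mv]; last exact: cmeasurableD.
by apply: cmeasurable_indic; apply: measurable_tbox => i; have [] := bB i.
Qed.

(** The distance is [sym_int], so that [phi] approximates [f] at x and at -x simultaneously. *)
Definition approximable (f : n.-tuple point -> R[i]) := cmeasurable En f /\
  forall e : R, 0 < e -> exists2 phi, box_step phi &
    (sym_int (fun x => csq (f x - phi x))%R < e%:E)%E.

Let mdist (f g : n.-tuple point -> R[i]) : cmeasurable En f -> cmeasurable En g ->
  measurable_fun En (fun x => csq (f x - g x)).
Proof. by move=> mf mg; apply: measurable_csq; exact: cmeasurableB. Qed.

Lemma box_step_approximable f : box_step f -> approximable f.
Proof.
move=> sf; split; first exact: cmeasurable_box_step.
move=> e e0; exists f => //.
rewrite /sym_int (eq_integral (fun=> 0%E)) ?integral0// => x _.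
by rewrite !subrr csq0 addr0 mul0r.
Qed.

Lemma box_stepZ c f : box_step f -> box_step (fun x => c * f x).
Proof.
elim=> [c' B bB|u v _ su _ sv].
  by rewrite (_ : (fun _ => _) = (fun x => (c * c') * (x \in tbox B)%:R));
    [exact: Box_step_one|apply/funext => x; rewrite mulrA].
rewrite (_ : (fun _ => _) = (fun x => c * u x + c * v x)); first exact: Box_step_add.
by apply/funext => x; rewrite mulrDr.
Qed.

Lemma approximableD f g : approximable f -> approximable g ->
  approximable (fun x => f x + g x).
Proof.
move=> [mf af] [mg ag]; split; first exact: cmeasurableD.
(* Each of the two errors e / 4 is doubled by the inequality for squares of sums. *)
move=> e e0; have e40 : 0 < e / 4 by rewrite divr_gt0.
have [phi sp hp] := af _ e40; have [psi ss hs] := ag _ e40.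
have mp := cmeasurable_box_step En sp; have ms := cmeasurable_box_step En ss.
exists (fun x => phi x + psi x); first exact: Box_step_add.
apply: (@le_lt_trans _ _ (2%:E * sym_int (fun x => csq (f x - phi x))%R +
    2%:E * sym_int (fun x => csq (g x - psi x))%R)%E).
  apply: sym_int_le => //; try (by move=> x _; exact: csq_ge0); try exact: mdist.
    by apply: mdist; exact: cmeasurableD.
  move=> x _; rewrite opprD addrACA; exact: csqD_le.
have -> : e%:E = (2%:E * (e / 4)%:E + 2%:E * (e / 4)%:E)%E.
  by rewrite -EFinM -EFinD; congr (_%:E); lra.
by apply: lteD; rewrite lte_pmul2l.
Qed.

Lemma approximableZ c f : approximable f -> approximable (fun x => c * f x).
Proof.
move=> [mf af]; split; first by apply: cmeasurableM => //; exact: cmeasurable_cst.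
(* The summand 1 avoids a division by 0 when c = 0. *)
move=> e e0; have c0 : 0 < 1 + csq c by rewrite ltr_pwDl// csq_ge0.
have ec0 : 0 < e / (1 + csq c) by rewrite divr_gt0.
have [phi sp hp] := af _ ec0; have mp := cmeasurable_box_step En sp.
exists (fun x => c * phi x); first exact: box_stepZ.
apply: (@le_lt_trans _ _ ((1 + csq c)%:E * sym_int (fun x => csq (f x - phi x))%R +
    0%:E * sym_int (fun x => csq (f x - phi x))%R)%E).
  apply: sym_int_le => //; try (by move=> x _; exact: csq_ge0); try exact: mdist.
  - exact: ltW.
  - by apply: mdist; apply: cmeasurableM => //; exact: cmeasurable_cst.
  - move=> x _; rewrite -mulrBr csqM mul0r addr0 ler_wpM2r ?csq_ge0//.
    by rewrite lerDr.
rewrite mul0e adde0.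
have -> : e%:E = ((1 + csq c)%:E * (e / (1 + csq c))%:E)%E.
  by rewrite -EFinM; congr (_%:E); rewrite mulrC divfK// gt_eqF.
by rewrite lte_pmul2l.
Qed.

Lemma approximable_lim (f_ : nat -> n.-tuple point -> R[i]) f : cmeasurable En f ->
  (forall m, approximable (f_ m)) ->
  sym_int (fun x => csq (f_ m x - f x))%R @[m --> \oo] --> 0%E -> approximable f.
Proof.
move=> mf af cf; split => // e e0; have e40 : 0 < e / 4 by rewrite divr_gt0.
have e4E : (0 < (e / 4)%:E)%E by rewrite lte_fin.
have [m _ hm] : \forall m \near \oo, (sym_int (fun x => csq (f_ m x - f x))%R < (e / 4)%:E)%E.
  exact: (cf _ (open_ereal_lt' e4E)).
have := hm m (leqnn m) => /= {}hm.
have [mfm /(_ _ e40) [phi sp hp]] := af m.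
have mp := cmeasurable_box_step En sp.
exists phi => //.
apply: (@le_lt_trans _ _ (2%:E * sym_int (fun x => csq (f_ m x - f x))%R +
    2%:E * sym_int (fun x => csq (f_ m x - phi x))%R)%E).
  apply: sym_int_le => //; try (by move=> x _; exact: csq_ge0); try exact: mdist.
  move=> x _; rewrite (_ : f x - phi x = - (f_ m x - f x) + (f_ m x - phi x)).
    by rewrite -[csq (f_ m x - f x)]csqN; exact: csqD_le.
  by rewrite opprB addrA subrK.
have -> : e%:E = (2%:E * (e / 4)%:E + 2%:E * (e / 4)%:E)%E.
  by rewrite -EFinM -EFinD; congr (_%:E); lra.
by apply: lteD; rewrite lte_pmul2l.
Qed.

Definition cube_pow (t : R) : set (n.-tuple point) := tbox (fun=> cube t `&` E).

Lemma bounded_borel_cube (t : R) : bounded_borel k (cube t `&` E).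
Proof.
split; last by exists t => x [].
  by apply: measurableI; [exact: measurable_cube|exact: measurable_space].
by move=> x [].
Qed.

Lemma measurable_cube_pow t : measurable (cube_pow t).
Proof. by apply: measurable_tbox => i; have [] := bounded_borel_cube t. Qed.

Lemma cube_powE t : cube_pow t `<=` En.
Proof. by move=> x h i; have [] := h i. Qed.

Lemma cube_pow_neg t x : En x -> cube_pow t (neg_n x) <-> cube_pow t x.
Proof.
move=> Ex; split=> h i.
  split; last exact: Ex.
  have := h i; rewrite tnth_mktuple => -[h1 h2].
  by have := cube_neg k h1; rewrite negK//; exact: Ex.
rewrite tnth_mktuple; have [h1 h2] := h i.
by split; [exact: cube_neg|exact: space_neg].
Qed.

(** The densities are integrable over bounded Borel sets and the integral over a box factors; the
    weight is at most the modulus of the real part of the product density. *)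
Lemma weight_box_lty (B : 'I_n -> set point) : (forall i, bounded_borel k (B i)) ->
  (\int[mun]_(x in tbox B) (w x)%:E < +oo)%E.
Proof.
move=> bB; have mB i : measurable (B i) by have [] := bB i.
have [[ir _] _] := power_cintegral mB (fun i => (sm_density G (j i) (j i) (bB i)).1).
have mb := measurable_tbox mB.
have sb : tbox B `<=` En by move=> x h i; have [_ h' _] := bB i; exact: h' (h i).
have /integrableP[mr] := ir; apply: le_lt_trans; apply: ge0_le_integral => //.
- by move=> x _; rewrite lee_fin weight_ge0.
- by apply/measurable_EFinP; apply: measurable_funS (measurable_weight G j).
- exact: measurableT_comp.
- move=> x _ /=; rewrite lee_fin /weight ge_max normr_ge0 /=.
  exact: ler_norm.
Qed.

Lemma sym_int_cube_lty t : (sym_int (fun x => (x \in cube_pow t)%:R) < +oo)%E.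
Proof.
have E1 x : En x -> (((x \in cube_pow t)%:R + (neg_n x \in cube_pow t)%:R) * w x)%:E =
    (2%:E * (((fun x => (w x)%:E) \_ (cube_pow t)) x))%E.
  move=> Ex; rewrite patchE.
  have -> : (neg_n x \in cube_pow t) = (x \in cube_pow t).
    by apply/idP/idP => /set_mem /(cube_pow_neg t Ex) h; exact/mem_set.
  by case: ifP => _; rewrite /= ?addr0 ?mul0r ?mule0// EFinM.
rewrite /sym_int (eq_integral (fun x => 2%:E * (((fun x => (w x)%:E) \_ (cube_pow t)) x))%E); last first.
  by move=> x /set_mem; exact: E1.
have mw : measurable_fun En ((fun x => (w x)%:E) \_ (cube_pow t)).
  apply: (measurable_restrict (fun x => (w x)%:E) (measurable_cube_pow t) mEn).1.
  rewrite setIidr//; last exact: cube_powE.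
  apply: measurable_funS (mEn) (@cube_powE t) _.
  by apply/measurable_EFinP; exact: measurable_weight.
rewrite ge0_integralZl//; last first.
  by move=> x _; rewrite patchE; case: ifP => // _; rewrite lee_fin weight_ge0.
rewrite lte_mul_pinfty//.
rewrite -integral_mkcondr setIidr; last exact: cube_powE.
exact: (weight_box_lty (fun=> bounded_borel_cube t)).
Qed.

Let indE (b : bool) : csq (b%:R : R[i]) = b%:R :> R.
Proof. by case: b; rewrite /csq /= ?expr1n ?expr0n ?addr0. Qed.

Let mind (A : set (n.-tuple point)) : measurable A ->
  cmeasurable En (fun x => ((x \in A)%:R : R[i])).
Proof.
move=> mA; have := cmeasurable_indic En 1 mA.
by under eq_fun do rewrite mul1r.
Qed.

(** Dynkin's theorem: the admissible sets [A] contain the boxes and are stable under proper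
    differences and increasing unions. The intersection with a cube provides the integrable
    dominating function for the limit. *)
Lemma approximable_indic (A : set (n.-tuple point)) t : measurable A ->
  approximable (fun x => (x \in A `&` cube_pow t)%:R).
Proof.
move=> mA; have mQ := measurable_cube_pow t.
pose Lam : set (set (n.-tuple point)) := [set A | measurable A /\
  approximable (fun x => (x \in A `&` cube_pow t)%:R)].
have LB : @measurable_boxes _ point n `<=` Lam.
  move=> _ [B mB ->]; split; first exact: measurable_tbox.
  rewrite (_ : tbox B `&` _ = tbox (fun i => (cube t `&` E) `&` B i)); last first.
    apply/seteqP; split=> x.
      by move=> [h1 h2] i; split; [exact: h2|exact: h1].
    by move=> h; split=> i; have [] := h i.
  have bs : box_step (fun x => 1 * (x \in tbox (fun i : 'I_n => (cube t `&` E) `&` B i))%:R).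
    by apply: Box_step_one => i; apply: bounded_borelI => //; exact: bounded_borel_cube.
  have := box_step_approximable bs.
  by under eq_fun do rewrite mul1r.
suff : lambda_system setT Lam.
  move=> lam; have [] // : Lam A.
  apply: (lambda_system_subset (@measurable_boxes_setI _ point n) lam LB) => //.
  exact: measurable_tuple_boxes.
split => //.
- by apply: LB; exists (fun=> setT) => //; apply/seteqP; split.
- move=> A1 B1 BA [mA1 aA1] [mB1 aB1]; split; first exact: measurableD.
  rewrite (_ : (fun _ => _) = (fun x => (x \in A1 `&` cube_pow t)%:R +
     (-1) * (x \in B1 `&` cube_pow t)%:R)).
    by apply: approximableD => //; exact: approximableZ.
  apply/funext => x; rewrite !in_setI.
  have -> : (x \in ~` B1) = (x \notin B1).
    apply/idP/negP => [/set_mem h /set_mem|h]; first exact: h.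
    by apply/mem_set => h'; apply: h; exact/mem_set.
  rewrite mulN1r.
  case: (boolP (x \in B1)) => [/set_mem/BA/mem_set ->|_]; case: (x \in cube_pow t);
    case: (x \in A1); rewrite /= ?subrr ?subr0//.
- move=> F ndF LF; split; first by apply: bigcupT_measurable => i; have [] := LF i.
  have mF i : measurable (F i) by have [] := LF i.
  have mU : measurable (\bigcup_i F i) by exact: bigcupT_measurable.
  apply: (approximable_lim (f_ := fun i x => (x \in F i `&` cube_pow t)%:R)).
  - by apply: mind; exact: measurableI.
  - by move=> i; have [] := LF i.
  have cB (b c : bool) : csq ((b%:R : R[i]) - c%:R) = (b (+) c)%:R :> R.
    by case: b; case: c; rewrite /= ?subrr ?subr0 ?sub0r ?csqN ?csq0//; exact: (indE true).
  apply: (sym_int_dominated (g := fun x => (x \in cube_pow t)%:R)).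
  - by move=> m; apply/measurable_csq/cmeasurableB; apply: mind; exact: measurableI.
  - by apply: measurable_funTS; exact: (@measurable_indic _ _ R setT _ mQ).
  - move=> m x _; rewrite cB ler0n ler_nat !in_setI.
    by case: (x \in cube_pow t); rewrite ?andbF ?andbT//; case: addb.
  - move=> x _; apply: cvg_near_cst.
    have [[i _ Fi]|nF] := pselect ((\bigcup_i F i) x).
      exists i => // m /= im; rewrite cB !in_setI.
      have -> : x \in \bigcup_i F i by apply/mem_set; exists i.
      have -> : x \in F m by apply/mem_set; move: Fi; apply/subsetPset/ndF.
      by rewrite addbb.
    apply: nearW => m; rewrite cB !in_setI.
    have -> : (x \in \bigcup_i F i) = false by apply/memNset.
    have -> : (x \in F m) = false by apply/memNset => Fm; apply: nF; exists m.
    by rewrite addbb.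
  - exact: sym_int_cube_lty.
Qed.

Lemma approximable_sum I (s : seq I) (f : I -> n.-tuple point -> R[i]) :
  (forall i, approximable (f i)) -> approximable (fun x => \sum_(i <- s) f i x).
Proof.
move=> af; elim: s => [|i s IHs].
  under eq_fun do rewrite big_nil.
  have := approximableZ 0 (approximable_indic 0 measurableT).
  by under eq_fun do rewrite mul0r.
by under eq_fun do rewrite big_cons; exact: approximableD.
Qed.

Import HBNNSimple.

(** Increasing simple approximations, cut off to growing cubes, tend to [f] pointwise and stay
    between 0 and [f], so the squared errors are dominated by f^2. *)
Lemma approximable_ge0 (f : n.-tuple point -> R) : measurable_fun En f ->
  (forall x, En x -> 0 <= f x) -> (sym_int (fun x => f x ^+ 2)%R < +oo)%E ->
  approximable (fun x => (f x)%:C%C).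
Proof.
move=> mf f0 foo.
pose F x : \bar R := ((f \_ En) x)%:E.
have F0 x : (0 <= F x)%E.
  by rewrite /F patchE lee_fin; case: ifP => // /set_mem; exact: f0.
have mF : measurable_fun setT F.
  by apply/measurable_EFinP; apply: (measurable_restrictT f mEn).1.
pose g := nnsfun_approx measurableT mF.
have gcv x : (g m x)%:E @[m --> \oo] --> F x.
  by apply: cvg_nnsfun_approx.
have gle m x : En x -> 0 <= g m x <= f x.
  move=> Ex; apply/andP; split; first by [].
  rewrite -lee_fin; have -> : (f x)%:E = F x by rewrite /F patchE mem_set.
  rewrite -(cvg_lim _ (gcv x))//; apply: lime_ge.
    by apply/cvg_ex; exists (F x); exact: gcv.
  exists m => // m' /= mm'; rewrite lee_fin.
  exact/lefP/nd_nnsfun_approx.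
pose g' m x := g m x * (x \in cube_pow m%:R)%:R.
have g'le m x : En x -> 0 <= g' m x <= f x.
  move=> Ex; have /andP[h1 h2] := gle m x Ex; rewrite /g'.
  by case: (x \in _); rewrite ?mulr1 ?h1// mulr0 lexx f0.
have mg' m : measurable_fun En (g' m).
  apply: measurable_funTS; apply: measurable_funM => //.
  exact: (@measurable_indic _ _ R setT _ (measurable_cube_pow _)).
have g'cv x : En x -> g' m x @[m --> \oo] --> f x.
  move=> Ex.
  have : g m x @[m --> \oo] --> f x.
    have := gcv x; rewrite /F patchE mem_set//.
    by move=> /fine_cvgP[].
  apply: cvg_trans; apply: near_eq_cvg.
  (* This index exceeds the sum of the moduli of all coordinates of x, so every later cube contains
     x. *)
  exists (Num.truncn (\sum_(i < n) \sum_(l < nu) `|tnth (tnth x i) l|)).+1 => // m /= hm.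
  rewrite /g' mem_set ?mulr1// => i; split; last exact: Ex.
  move=> l; apply: (@le_trans _ _ (\sum_(i < n) \sum_(l < nu) `|tnth (tnth x i) l|)).
    rewrite (bigD1 i)//= (bigD1 l)//= -addrA lerDl addr_ge0//.
      by apply: sumr_ge0.
    by apply: sumr_ge0 => ? _; exact: sumr_ge0.
  by rewrite (le_trans (ltW (truncnS_gt _)))// ler_nat.
apply: (approximable_lim (f_ := fun m x => (g' m x)%:C%C)).
- by split => //=; exact: measurable_cst.
- move=> m.
  rewrite (_ : (fun _ => _) = (fun x => \sum_(y <- finmap.enum_fset (fset_set (range (g m))))
     y%:C%C * (x \in (g m @^-1` [set y]) `&` cube_pow m%:R)%:R)).
    apply: approximable_sum => y; apply: approximableZ; apply: approximable_indic.
    exact: measurable_sfunP.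
  apply/funext => x; rewrite /g' fimfunE fsbig_finite// mulr_suml rmorph_sum.
  apply: eq_bigr => y _; rewrite !rmorphM /= -mulrA; congr (_ * _).
  by rewrite in_setI indicE; case: (x \in _); case: (x \in _);
    rewrite /= ?rmorph0 ?rmorph1 ?mul1r ?mul0r.
have cE m x : csq ((g' m x)%:C%C - (f x)%:C%C) = (g' m x - f x) ^+ 2.
  by rewrite -rmorphB csq_real.
under eq_fun do under eq_fun do rewrite cE.
apply: (sym_int_dominated (g := fun x => f x ^+ 2)) => //.
- by move=> m; apply: measurable_funX; exact: measurable_funB.
- exact: measurable_funX.
- move=> m x Ex; rewrite sqr_ge0 /=.
  by have /andP[h1 h2] := g'le m x Ex; have := f0 x Ex; nra.
- move=> x Ex; rewrite (_ : 0 = (f x - f x) ^+ 2 :> R); last by rewrite subrr expr0n.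
  rewrite expr2; under eq_fun do rewrite expr2.
  by apply: cvgM; (apply: cvgB; [exact: g'cv|exact: cvg_cst]).
Qed.

Lemma approximable_sq_lty (f : n.-tuple point -> R[i]) : cmeasurable En f ->
  (sym_int (fun x => csq (f x)) < +oo)%E -> approximable f.
Proof.
move=> [mr mi] foo.
have sub (u : n.-tuple point -> R) : measurable_fun En u ->
    (forall x, u x ^+ 2 <= csq (f x)) -> approximable (fun x => (u x)%:C%C).
  move=> mu_ ule.
  have pn (v : n.-tuple point -> R) : measurable_fun En v ->
      (forall x, En x -> 0 <= v x) -> (forall x, v x ^+ 2 <= csq (f x)) -> approximable (fun x => (v x)%:C%C).
    move=> mv v0 vle; apply: approximable_ge0 => //; apply: le_lt_trans foo.
    have mc : measurable_fun En (fun x => csq (f x)) by exact: measurable_csq.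
    apply: (@le_trans _ _ (1%:E * sym_int (fun x => csq (f x)) + 0%:E * sym_int (fun x => csq (f x)))%E); last first.
      by rewrite mul1e mul0e adde0.
    apply: sym_int_le => //; try (by move=> x _; exact: csq_ge0).
    - exact: measurable_funX.
    - by move=> x _; exact: sqr_ge0.
    - by move=> x _; rewrite mul1r mul0r addr0.
  have ap : approximable (fun x => (Num.max (u x) 0)%:C%C).
    apply: pn.
    - by apply: measurable_maxr => //; exact: measurable_cst.
    - by move=> x _; rewrite le_max lexx orbT.
    - move=> x; apply: le_trans (ule x); rewrite /Num.max; case: ifP => // _.
      by rewrite expr0n sqr_ge0.
  have an : approximable (fun x => (Num.max (- u x) 0)%:C%C).
    apply: pn.
    - by apply: measurable_maxr => //; exact: measurable_funN.
    - by move=> x _; rewrite le_max lexx orbT.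
    - move=> x; apply: le_trans (ule x); rewrite /Num.max; case: ifP => // _; last by rewrite sqrrN.
      by rewrite expr0n sqr_ge0.
  have := approximableD ap (approximableZ (-1) an).
  rewrite (_ : (fun _ => _) = (fun x => (u x)%:C%C)) //; apply/funext => x.
  rewrite mulN1r -rmorphB; congr (_%:C%C).
  rewrite /Num.max oppr_lt0; case: ltgtP => [h|h|h]; lra.
have := approximableD (sub _ mr (fun x => Re_sq_le (f x)))
  (approximableZ 'i%C (sub _ mi (fun x => Im_sq_le (f x)))).
rewrite (_ : (fun _ => _) = f) //; apply/funext => x.
by rewrite -complexE.
Qed.

End box_approximation.
Arguments box_step {R} k {nu n} _.

(** The sides of all the boxes. The value at x depends only on which of them contain each
    coordinate, so the function is constant on the cells of every regular system that refines
    them. *)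
Lemma box_step_family {R : realType} (k : space_kind) (nu n : nat)
    (phi : n.-tuple (nu.-tuple R) -> R[i]) : box_step k phi ->
  exists (I : finType) (B : I -> set (nu.-tuple R)),
  [/\ forall c, bounded_borel k (B c),
      forall x y, (forall i c, B c (tnth x i) <-> B c (tnth y i)) -> phi x = phi y &
      forall x, phi x != 0 -> forall i, exists c, B c (tnth x i)].
Proof.
elim=> [c B bB|f g _ [I [B [bB cB zB]]] _ [I' [B' [bB' cB' zB']]]].
  exists 'I_n, B; split => //.
    move=> x y h; congr (_ * _%:R); congr nat_of_bool; apply/idP/idP => /set_mem t;
      by apply/mem_set => i; apply/h; exact: t.
  move=> x; case: (boolP (x \in tbox B)) => [/set_mem h _ i|]; first by exists i.
  by rewrite mulr0 eqxx.
exists (I + I')%type, (fun c => match c with inl u => B u | inr v => B' v end); split.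
- by case.
- move=> x y h; rewrite (cB x y) ?(cB' x y)// => i c; first exact: (h i (inr c)).
  exact: (h i (inl c)).
- move=> x h i; have [fx|fx] := eqVneq (f x) 0.
    have [|c hc] := zB' x _ i; last by exists (inr c).
    by move: h; rewrite fx add0r.
  by have [c hc] := zB x fx i; exists (inl c).
Qed.

(** * Null sets: fixed points of the reflection and diagonals *)

Section negligible_sets.
Context {R : realType} {k : space_kind} {nu d : nat}.
Variable G : spectral_measure R k nu d.
Hypothesis hG : nonatomic G.
Local Notation point := (nu.-tuple R).
Local Notation E := (space R k nu).

(** A fixed point of the reflection has all coordinates equal to 0 or, on the torus, to 0 or - pi:
    these are finitely many points, each a null set. *)
Lemma ae_neg_neq : {ae sm_mu G, forall x, E x -> neg k x != x}.
Proof.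
pose pt (b : {ffun 'I_nu -> bool}) : point := [tuple if b i then 0 else - pi | i < nu].
have h b : {ae sm_mu G, forall x, E x -> x != pt b}.
  have [Eb|nEb] := pselect (E (pt b)); last first.
    by apply: nearW => x Ex; apply/eqP => e; apply: nEb; rewrite -e.
  exists [set pt b]; split; [exact: (measurable_point (pt b))|exact: hG|].
  move=> x /= /not_implyP[_ /negP/negPn/eqP ->//].
have : {ae sm_mu G, forall x, forall b, E x -> x != pt b} by exact: filter_forall.
apply: filterS => x {}h Ex; apply/eqP => e.
have /eqP := h [ffun i => tnth x i == 0] Ex; apply.
apply: eq_from_tnth => i; rewrite tnth_mktuple ffunE.
have := congr1 (fun y => tnth y i) e; rewrite tnth_mktuple /neg1.
have two (t : R) : - t = t -> t = 0.
  by move=> e1; apply/eqP; rewrite -[t == 0]/((2 == 0)%N || (t == 0)) -mulrn_eq0 mulr2n -{1}e1 addNr.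
have [->//|t0] := eqVneq (tnth x i) 0.
case: k => [/two e1|]; first by rewrite e1 eqxx in t0.
by case: eqP => // _ /two e1; rewrite e1 eqxx in t0.
Qed.

Lemma ae_off_diagonal n : {ae power_measure (sm_mu G) n, forall x,
  space_pow R k nu n x -> (forall i, neg k (tnth x i) != tnth x i) /\
  forall l l', l != l' -> tnth x l != tnth x l' /\ tnth x l != neg k (tnth x l')}.
Proof.
have h1 := power_measure_ae n ae_neg_neq.
have h2 (phi : point -> point) : measurable_fun setT phi ->
    (forall x, E x -> E (phi x)) -> (forall x, E x -> phi (phi x) = x) ->
    {ae power_measure (sm_mu G) n, forall x, forall p : 'I_n * 'I_n,
       p.1 != p.2 -> space_pow R k nu n x -> tnth x p.1 != phi (tnth x p.2)}.
  move=> mphi phiE phiK; apply: filter_forall => -[l l'] /=.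
  have [->|ll'] := eqVneq l l'; first exact: nearW.
  exists (graph_set E phi l l'); split.
  - by apply: measurable_graph_set => //; exact: measurable_space.
  - by apply: power_measure_graph_set => //; exact: measurable_space.
  - move=> x /= /not_implyP[_ /not_implyP[Ex /negP/negPn/eqP h]]; split => //; exact: Ex.
have := h2 id (@measurable_id _ _ _) (fun _ h => h) (fun _ _ => erefl).
have := h2 (neg k) (@measurable_neg R k nu) (@space_neg R k nu) (@negK R k nu).
move: h1; apply: filterS3 => x a1 a2 a3 Ex; split.
  by move=> i; apply: a1; exact: Ex.
by move=> l l' ll'; split; [exact: (a3 (l, l'))|exact: (a2 (l, l'))].
Qed.

End negligible_sets.

(** * Symmetrization and truncation of step functions *)

Section simple_density.
Context {R : realType} {k : space_kind} {nu d : nat}.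
Variable G : spectral_measure R k nu d.
Hypothesis hG : nonatomic G.
Variables (n : nat) (j : 'I_n -> 'I_d).
Local Notation point := (nu.-tuple R).
Local Notation E := (space R k nu).
Local Notation En := (space_pow R k nu n).
Local Notation mun := (power_measure (sm_mu G) n).
Local Notation neg_n := (@neg_tuple R k nu n).

Section truncation.
Variables (phi : n.-tuple point -> R[i]).
Hypothesis bphi : box_step k phi.

Definition symmetrization (x : n.-tuple point) : R[i] :=
  (2^-1)%:C%C * (phi x + conjc (phi (neg_n x))).
Local Notation psi := symmetrization.

Lemma cmeasurable_symmetrization : cmeasurable En psi.
Proof.
apply: cmeasurableM; first exact: cmeasurable_cst.
have mp := cmeasurable_box_step En bphi.
apply: cmeasurableD => //; apply: cmeasurableJ.
exact: cmeasurable_comp_neg.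
Qed.

Lemma symmetrization_even x : En x -> psi (neg_n x) = conjc (psi x).
Proof.
move=> Ex; rewrite /psi neg_tupleK//; apply: complexP;
  rewrite ?(ReJ, ImJ, ReM, ImM, ReD, ImD) /=; ring.
Qed.

Section refined.
Variables (N : nat) (D : sindex N -> set point).
Hypothesis rD : regular_system (k := k) D.
Hypothesis cD : forall a x y, box D a x -> box D a y -> phi x = phi y.

Definition off_diag (a : 'I_n -> sindex N) :=
  forall l l', l != l' -> a l != a l' /\ a l != sopp (a l').

(* The points of cells on which a simple function need not vanish. *)
Definition good x := exists2 a : 'I_n -> sindex N, box D a x & off_diag a.

Definition truncation (x : n.-tuple point) : R[i] := psi x * (x \in [set y | good y])%:R.

Lemma measurable_good : measurable [set y | good y].
Proof.
rewrite (_ : [set y | good y] = \bigcup_(a in [set: {ffun 'I_n -> sindex N}])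
   (if `[< off_diag a >] then tbox (fun i => D (a i)) else set0)).
  apply: fin_bigcup_measurable => // a _; case: ifP => // _.
  by apply: measurable_tbox => i; have [] := rs_bounded rD (a i).
apply/seteqP; split=> [x [a ax oa]|x [a _]].
  exists [ffun i => a i] => //; case: asboolP => [_ i|h]; first by rewrite ffunE; exact: ax.
  by exfalso; apply: h => l l' /oa; rewrite !ffunE.
by case: asboolP => // oa h; exists a.
Qed.

Let box_neg (a : 'I_n -> sindex N) x : box D a x -> box D (fun i => sopp (a i)) (neg_n x).
Proof. by move=> bx i; rewrite tnth_mktuple; apply: (regular_opp rD); exact: bx. Qed.

Let good_neg x : En x -> good (neg_n x) <-> good x.
Proof.
have h y : good y -> good (neg_n y).
  move=> [a ay oa]; exists (fun i => sopp (a i)); first exact: box_neg.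
  move=> l l' /oa; rewrite (inj_eq (can_inj (@soppK N))) => -[-> h]; split=> //.
  by apply: contra h => /eqP e; rewrite -[a l]soppK e soppK.
by move=> Ex; split=> [/h|/h//]; rewrite neg_tupleK.
Qed.

(** [phi] is constant on each cell and on the opposite cell, hence so is its symmetrization; the
    good points are stable under reflection, so evenness survives the truncation. *)
Lemma truncation_simple : (sqnorm G j psi < +oo)%E -> in_Khat G j truncation.
Proof.
move=> npsi; have mtr : cmeasurable En truncation.
  apply: cmeasurableM; first exact: cmeasurable_symmetrization.
  have := cmeasurable_indic En (1 : R[i]) measurable_good.
  by under eq_fun do rewrite mul1r.
split; first split => //.
- move=> x Ex; rewrite /truncation symmetrization_even//.
  have -> : (neg_n x \in [set y | good y]) = (x \in [set y | good y]).
    by apply/idP/idP => /set_mem/= /(good_neg Ex) h; apply/mem_set.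
  by case: (x \in _); rewrite ?mulr1 ?mulr0 ?conjc0.
- apply: le_lt_trans npsi.
  apply: (@le_trans _ _ (1%:E * sqnorm G j psi + 0%:E * sqnorm G j psi)%E); last first.
    by rewrite mul1e mul0e adde0.
  apply: sqnorm_le => //; try exact: cmeasurable_symmetrization.
  move=> x _; rewrite mul1r mul0r addr0 /truncation csqM.
  by case: (x \in _); rewrite /csq /= ?expr1n ?expr0n /= ?addr0 ?mulr1// mulr0 addr_ge0 ?sqr_ge0.
exists N, D; split => //; split.
- move=> a x y ax ay; rewrite /truncation; congr (_ * _%:R).
    rewrite /psi (cD ax ay); congr (_ * (_ + conjc _)).
    exact: cD (box_neg ax) (box_neg ay).
  congr nat_of_bool; have key u v : box D a u -> box D a v -> good u -> good v.
    move=> au av [b bu ob]; exists b => // i.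
    by rewrite (regular_inj rD (bu i) (au i)); exact: av.
  by apply/idP/idP => /set_mem h; apply/mem_set; [exact: key ax ay h|exact: key ay ax h].
- move=> x Ex nx; rewrite /truncation memNset ?mulr0// => -[a ax _]; exact: nx ax.
- move=> a x ax [l [l' [ll' e]]]; rewrite /truncation memNset ?mulr0// => -[b bx ob].
  have eq i : b i = a i by exact: regular_inj rD (bx i) (ax i).
  by have := ob _ _ ll'; rewrite !eq; case: e => ->; rewrite eqxx => -[].
Qed.

End refined.

(** Almost every x with [psi x != 0] becomes good as the systems are refined, from where on the
    truncation equals [psi] at x. Dominated convergence, with the square of [psi] as bound,
    concludes. *)
Lemma truncation_cvg : (sqnorm G j psi < +oo)%E -> forall e : R, 0 < e ->
  exists2 h, in_Khat G j h & (sqnorm G j (fun x => h x - psi x)%R < e%:E)%E.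
Proof.
move=> npsi e e0.
have [I [B [bB cB zB]]] := box_step_family bphi.
have [_ _ [T0 BT0]] := bounded_borel_bigcup bB.
pose Q : set point := cube T0 `&` E.
have bQ : bounded_borel k Q by exact: bounded_borel_cube.
(* The half spaces C p separate the points of Q, so that the coordinates of a point
   off the diagonals eventually lie in different, not opposite, cells. *)
pose C (p : nat) : set point := match unpickle p with
  | Some (i, q) => Q `&` [set x | tnth x (i : 'I_nu) < ratr (q : rat)]
  | None => set0 end.
have bC p : bounded_borel k (C p).
  rewrite /C; case: unpickle => [[i q]|]; last exact: bounded_borel_set0.
  apply: bounded_borelI => //; apply: measurable_bool_set.
  by apply: measurable_fun_ltr; [exact: measurable_tnth|exact: measurable_cst].
(* All sides of the boxes are kept at every stage, so that [phi] remains constant on cells, and the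
   first m separating sets are added. *)
pose Fam m (c : I + 'I_m) : set point := match c with inl u => B u | inr p => C p end.
have bFam m c : bounded_borel k (Fam m c) by case: c => c /=; [exact: bB|exact: bC].
pose W m := cid (regular_refinement (bFam m)).
pose Nm m := projT1 (W m).
pose W' m := cid (projT2 (W m)).
pose D m : sindex (Nm m) -> set point := projT1 (W' m).
have HD m : [/\ regular_system (k := k) (D m),
    forall c a, D m a `<=` Fam m c \/ D m a `&` Fam m c = set0 &
    forall c x, Fam m c x -> neg k x != x -> exists a, D m a x].
  exact: (projT2 (W' m)).
have same m c a u v : D m a u -> D m a v -> Fam m c u -> Fam m c v.
  move=> au av Fu; have [_ ref _] := HD m; case: (ref c a) => [h|]; first exact: h.
  by rewrite -subset0 => /(_ u); case.
have cD m (a : 'I_n -> sindex (Nm m)) x y : box (D m) a x -> box (D m) a y -> phi x = phi y.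
  move=> ax ay; apply: cB => i c; split.
    by move=> h; apply: (same m (inl c) (a i) _ _ (ax i) (ay i) h).
  by move=> h; apply: (same m (inl c) (a i) _ _ (ay i) (ax i) h).
have sep u v : Q u -> Q v -> u != v -> \forall m \near \oo, forall a, D m a u -> D m a v -> False.
  have key u' v' : Q u' -> Q v' -> lexlt u' v' ->
      exists p, C p u' /\ ~ C p v'.
    move=> Qu Qv [i [_ uv]].
    have [q] := rat_in_itvoo uv; rewrite in_itv /= => /andP[uq qv].
    exists (pickle (i, q)); rewrite /C pickleK; split => // -[_ /=].
    by move=> /(lt_trans qv); rewrite ltxx.
  move=> Qu Qv uv.
  have [p hp] : exists p, (C p u /\ ~ C p v) \/ (C p v /\ ~ C p u).
    by case: (lexlt_total uv) => /key[//|//|p hp]; exists p; [left|right].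
  exists p.+1 => // m /= pm a au av.
  case: hp => -[h1 h2]; apply: h2.
    exact: (same m (inr (Ordinal pm)) a _ _ au av h1).
  exact: (same m (inr (Ordinal pm)) a _ _ av au h1).
pose h m := truncation (D m).
have Kh m : in_Khat G j (h m).
  by have [rD _ _] := HD m; apply: truncation_simple => //; exact: cD.
have mpsi := cmeasurable_symmetrization.
have mh m : cmeasurable En (h m) by have [[]] := Kh m.
have mdiff m : cmeasurable En (fun x => h m x - psi x) by exact: cmeasurableB.
have cv : sqnorm G j (fun x => h m x - psi x)%R @[m --> \oo] --> 0%E.
  under eq_fun do rewrite sqnormE//.
  apply: (weighted_dominated (v_ := fun m x => csq (h m x - psi x)) (g := fun x => csq (psi x))).
  - by move=> m; exact: measurable_csq.
  - exact: measurable_csq.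
  - move=> m x _; rewrite csq_ge0 /= /h /truncation.
    by case: (x \in _); rewrite ?mulr1 ?mulr0 ?subrr ?sub0r ?csqN ?csq0 ?csq_ge0.
  - have := ae_off_diagonal hG n; apply: filterS => x nd Ex.
    have [nx nll] := nd Ex; apply: cvg_near_cst.
    have [z|nz] := eqVneq (psi x) 0.
      by apply: nearW => m; rewrite /h /truncation z mul0r subrr csq0.
    (* As [psi x] is not 0, [phi] is nonzero at x or at -x. *)
    have Bx i : exists c, B c (tnth x i) \/ B c (neg k (tnth x i)).
      have [p0|p0] := eqVneq (phi x) 0; last by have [c hc] := zB _ p0 i; exists c; left.
      have p0' : phi (neg_n x) != 0.
        by apply: contraNneq nz => p0'; rewrite /psi p0 p0' conjc0 addr0 mulr0.
      by have [c hc] := zB _ p0' i; exists c; right; rewrite tnth_mktuple in hc.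
    have Ux i : Q (tnth x i).
      split; last exact: Ex.
      have [c [hc|hc]] := Bx i; first by apply: BT0; exists c.
      have : cube T0 (neg k (tnth x i)) by apply: BT0; exists c.
      by move=> /(cube_neg k); rewrite negK//; exact: Ex.
    have inD m i : exists a, D m a (tnth x i).
      have [rD _ cov] := HD m; have [c [hc|hc]] := Bx i.
        exact: (cov (inl c)).
      (* When only the reflected coordinate is known to lie in some B_c, the cell opposite to the
         one containing it contains the coordinate itself. *)
      have [|a ha] := cov (inl c) (neg k (tnth x i)) hc.
        by rewrite negK 1?eq_sym//; exact: Ex.
      exists (sopp a); have := regular_opp rD ha; rewrite negK//; exact: Ex.
    have near1 : \forall m \near \oo, forall p : 'I_n * 'I_n, p.1 != p.2 ->
       (forall a, D m a (tnth x p.1) -> D m a (tnth x p.2) -> False) /\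
       (forall a, D m a (tnth x p.1) -> D m a (neg k (tnth x p.2)) -> False).
      apply: filter_forall => -[l l'] /=.
      have [->|ll'] := eqVneq l l'; first exact: nearW.
      have [s1 s2] := nll _ _ ll'.
      have Qn : Q (neg k (tnth x l')).
        by have [q1 q2] := Ux l'; split; [exact: cube_neg|exact: space_neg].
      have := sep _ _ (Ux l) (Ux l') s1; have := sep _ _ (Ux l) Qn s2.
      by apply: filterS2 => m a1 a2 _; split.
    apply: filterS near1 => m sm; rewrite /h /truncation mem_set ?mulr1 ?subrr ?csq0//=.
    have [rD _ _] := HD m.
    exists (fun i => projT1 (cid (inD m i))); first by move=> i; exact: (projT2 (cid (inD m i))).
    move=> l l' ll'; have [s1 s2] := sm (l, l') ll'; rewrite /= in s1 s2.
    have dl := projT2 (cid (inD m l)); have dl' := projT2 (cid (inD m l')).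
    split; apply/eqP => eq; first by apply: (s1 _ dl); rewrite eq.
    by apply: (s2 _ dl); rewrite eq; exact: (regular_opp rD dl').
  - by rewrite -sqnormE.
have eE : (0 < e%:E)%E by rewrite lte_fin.
have [m _ hm] := cv _ (open_ereal_lt' eE).
by exists (h m) => //; exact: (hm m (leqnn m)).
Qed.

End truncation.

Theorem in_Khat_dense f : in_K G j f -> forall e : R, 0 < e ->
  exists2 h, in_Khat G j h & (sqnorm G j (fun x => h x - f x)%R < e%:E)%E.
Proof.
move=> [mf ef nf] e e0; have e40 : 0 < e / 4 by rewrite divr_gt0.
have mw := @measurable_space_pow R k nu n.
have fsym : (sym_int G j (fun x => csq (f x)) < +oo)%E.
  (* For an even function the squared modulus is invariant under reflection, so the symmetrized
     integral is twice the squared norm. *)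
  rewrite /sym_int (eq_integral (fun x => 2%:E * (csq (f x) * weight G j x)%:E)%E); last first.
    by move=> x /set_mem Ex; rewrite ef// csqJ -EFinM; congr (_%:E); ring.
  rewrite ge0_integralZl//; last 2 first.
  - exact: measurable_csq_weight.
  - by move=> x _; rewrite lee_fin mulr_ge0 ?csq_ge0 ?weight_ge0.
  by rewrite lte_mul_pinfty// -sqnormE.
have [_ /(_ _ e40) [phi bphi hphi]] := approximable_sq_lty mf fsym.
have mphi := cmeasurable_box_step (space_pow R k nu n) bphi.
have mpsi := cmeasurable_symmetrization bphi.
have d1 : (sqnorm G j (fun x => symmetrization phi x - f x)%R < (e / 4)%:E)%E.
  apply: le_lt_trans hphi; rewrite sqnormE; last exact: cmeasurableB.
  apply: ge0_le_integral => //.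
  - by move=> x _; rewrite lee_fin mulr_ge0 ?csq_ge0 ?weight_ge0.
  - by apply: measurable_csq_weight; exact: cmeasurableB.
  - apply/measurable_EFinP; apply: measurable_funM; last exact: measurable_weight.
    have md : measurable_fun En (fun x => csq (f x - phi x)) by apply/measurable_csq/cmeasurableB.
    by apply: measurable_funD => //; exact: (measurable_comp_neg md).
  - move=> x Ex; rewrite lee_fin ler_wpM2r ?weight_ge0// ef//.
    (* As [f] is even, it equals its own symmetrization: the error is the mean of the error at x and
       the conjugated error at -x, which [sym_int] controls. *)
    have -> : symmetrization phi x - f x = (2^-1)%:C%C *
        ((phi x - f x) + conjc (phi (neg_n x) - conjc (f x))).
      by rewrite /symmetrization; apply: complexP;
        rewrite ?(ReJ, ImJ, ReM, ImM, ReD, ImD, ReN, ImN) /=; field.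
    rewrite csqM csq_real -[csq (f x - phi x)]csqN opprB.
    rewrite -[csq (conjc _ - _)]csqN opprB -[csq (_ - conjc (f x))]csqJ.
    have := csqD_le (phi x - f x) (conjc (phi (neg_n x) - conjc (f x))).
    by have := csq_ge0 (phi x - f x); have := csq_ge0 (conjc (phi (neg_n x) - conjc (f x))); lra.
have npsi : (sqnorm G j (symmetrization phi) < +oo)%E.
  apply: (@le_lt_trans _ _ (2%:E * sqnorm G j (fun x => symmetrization phi x - f x)%R + 2%:E * sqnorm G j f)%E).
    apply: sqnorm_le => //; first exact: cmeasurableB.
    by move=> x _; rewrite -{1}[symmetrization phi x](subrK (f x)); exact: csqD_le.
  apply: lte_add_pinfty; rewrite lte_mul_pinfty//.
  by apply: lt_trans d1 _; rewrite ltry.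
have [h Kh d2] := truncation_cvg bphi npsi e40.
exists h => //; have [[mh _ _] _] := Kh.
apply: (@le_lt_trans _ _ (2%:E * sqnorm G j (fun x => h x - symmetrization phi x)%R +
    2%:E * sqnorm G j (fun x => symmetrization phi x - f x)%R)%E).
  apply: sqnorm_le => //; try exact: cmeasurableB.
  move=> x _; have -> : h x - f x = (h x - symmetrization phi x) + (symmetrization phi x - f x).
    by rewrite addrA subrK.
  exact: csqD_le.
have -> : e%:E = (2%:E * (e / 4)%:E + 2%:E * (e / 4)%:E)%E.
  by rewrite -EFinM -EFinD; congr (_%:E); lra.
by apply: lteD; rewrite lte_pmul2l.
Qed.

End simple_density.

(** * The bilinear form on K *)

(** Arithmetic and geometric means of r a and b / r; minimizing over r would give back the square
    root of a b. *)
Lemma sq_le_mul_norm_le (R : realFieldType) (x a b r : R) : 0 <= a -> 0 <= b -> 0 < r ->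
  x ^+ 2 <= a * b -> `|x| <= (r * a + b / r) / 2.
Proof.
move=> a0 b0 r0 h; have ra : 0 <= r * a by rewrite mulr_ge0// ltW.
have br : 0 <= b / r by rewrite divr_ge0// ltW.
have c0 : 0 <= (r * a + b / r) / 2 by rewrite divr_ge0// addr_ge0.
rewrite -ler_sqr ?nnegrE// real_normK ?num_real//; apply: (le_trans h).
have -> : a * b = (r * a) * (b / r) by field; rewrite gt_eqF.
set u := r * a; set v := b / r; rewrite -subr_ge0.
have -> : ((u + v) / 2) ^+ 2 - u * v = ((u - v) / 2) ^+ 2 by field.
exact: sqr_ge0.
Qed.

Section pairing.
Context {R : realType} {k : space_kind} {nu d : nat}.
Variable G : spectral_measure R k nu d.
Local Notation point := (nu.-tuple R).
Local Notation En := (space_pow R k nu).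
Variables (n : nat) (j j' : 'I_n -> 'I_d).
Local Notation mun := (power_measure (sm_mu G) n).

Definition pairing_integrand (f h : n.-tuple point -> R[i]) (s : 'S_n) (x : n.-tuple point) :
    R[i] :=
  f x * conjc (h (tperm_tuple s x)) * prod_density G j (fun i => j' ((s^-1)%g i)) x.

Let mE := @measurable_space_pow R k nu n.

Lemma space_pow_perm (s : 'S_n) (x : n.-tuple point) :
  En n (tperm_tuple s x) <-> En n x.
Proof.
split=> h i; last by rewrite tnth_mktuple; exact: h.
by have := h ((s^-1)%g i); rewrite tnth_mktuple permKV.
Qed.

Lemma weight_perm (s : 'S_n) x :
  weight G (fun i => j' ((s^-1)%g i)) x = weight G j' (tperm_tuple s x).
Proof.
rewrite /weight /prod_density (reindex_inj (@perm_inj _ s)).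
by congr (Num.max _ (Re _)); apply: eq_bigr => i _; rewrite permK tnth_mktuple.
Qed.

(** The weight is permuted together with the function, and the power measure is invariant under
    permutations of the coordinates. *)
Lemma sqnorm_perm (s : 'S_n) (h : n.-tuple point -> R[i]) : cmeasurable (En n) h ->
  (\int[mun]_(x in En n) (csq (h (tperm_tuple s x)) * weight G j' (tperm_tuple s x))%:E =
   sqnorm G j' h)%E.
Proof.
move=> mh; rewrite sqnormE// [LHS]integral_mkcond [RHS]integral_mkcond.
rewrite -[RHS](ge0_integral_perm _ s).
- apply: eq_integral => x _; rewrite !patchE.
  have -> : (tperm_tuple s x \in En n) = (x \in En n).
    by apply/idP/idP => /set_mem /(space_pow_perm s) hx; apply/mem_set.
  by [].
- by apply: (measurable_restrictT _ mE).1; exact: measurable_csq_weight.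
- by move=> x; rewrite patchE; case: ifP => // _; rewrite lee_fin mulr_ge0 ?csq_ge0 ?weight_ge0.
Qed.

Lemma cmeasurable_perm (s : 'S_n) (h : n.-tuple point -> R[i]) : cmeasurable (En n) h ->
  cmeasurable (En n) (fun x => h (tperm_tuple s x)).
Proof.
move=> mh; apply: (@cmeasurable_comp _ _ _ _ _ (En n) (En n) (tperm_tuple s) h) => //.
  by move=> _ [x Ex <-]; exact/space_pow_perm.
by apply: measurable_funTS; exact: measurable_tperm_tuple.
Qed.

Variables (f h : n.-tuple point -> R[i]).
Hypothesis mf : cmeasurable (En n) f.
Hypothesis mh : cmeasurable (En n) h.
Hypothesis nf : (sqnorm G j f < +oo)%E.
Hypothesis nh : (sqnorm G j' h < +oo)%E.
Variable s : 'S_n.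

Lemma cmeasurable_pairing : cmeasurable (En n) (pairing_integrand f h s).
Proof.
apply: cmeasurableM; last exact: cmeasurable_prod_density.
by apply: cmeasurableM => //; apply: cmeasurableJ; exact: cmeasurable_perm.
Qed.

Let a x := csq (f x) * weight G j x.
Let b x := csq (h (tperm_tuple s x)) * weight G j' (tperm_tuple s x).

Let a0 x : 0 <= a x. Proof. by rewrite mulr_ge0 ?csq_ge0 ?weight_ge0. Qed.
Let b0 x : 0 <= b x. Proof. by rewrite mulr_ge0 ?csq_ge0 ?weight_ge0. Qed.

Let ia : mun.-integrable (En n) (EFin \o a).
Proof.
apply/integrableP; split; first exact: measurable_csq_weight.
under eq_integral do rewrite /= ger0_norm//.
by move: nf; rewrite sqnormE.
Qed.

Let ib : mun.-integrable (En n) (EFin \o b).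
Proof.
apply/integrableP; split.
  apply/measurable_EFinP; apply: measurable_funM.
    by apply: measurable_csq; exact: cmeasurable_perm.
  under eq_fun do rewrite -weight_perm; exact: measurable_weight.
under eq_integral do rewrite /= ger0_norm//.
by rewrite sqnorm_perm.
Qed.

Let csq_pairing : {ae mun, forall x, En n x -> csq (pairing_integrand f h s x) <= a x * b x}.
Proof.
have := ae_density_psd G n; apply: filterS => x psd Ex.
rewrite /pairing_integrand !csqM csqJ.
have := psd_prod_density j (fun i => j' ((s^-1)%g i)) (psd Ex).
rewrite weight_perm /a /b mulrACA => hp.
by rewrite ler_wpM2l// mulr_ge0 ?csq_ge0.
Qed.

(** Used for the real and the imaginary part of the integrand: their squares are at most [a x * b x]
    almost everywhere, and the integrals of [a] and [b] are the two squared norms, whatever the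
    permutation. *)
Let part_bound (p : n.-tuple point -> R) (r : R) : 0 < r -> measurable_fun (En n) p ->
  (forall x, p x ^+ 2 <= csq (pairing_integrand f h s x)) ->
  mun.-integrable (En n) (EFin \o p) /\
  `|Rintegral mun (En n) p| <=
    (r * fine (sqnorm G j f) + fine (sqnorm G j' h) / r) / 2.
Proof.
move=> r0 mp hp.
pose g x := r / 2 * a x + r^-1 / 2 * b x.
have ig : mun.-integrable (En n) (EFin \o g).
  rewrite (_ : _ \o _ = (fun x => (r / 2)%:E * (a x)%:E)%E \+ (fun x => (r^-1 / 2)%:E * (b x)%:E)%E)//.
  by apply: integrableD => //; apply: integrableZl.
have g0 x : 0 <= g x by rewrite addr_ge0// mulr_ge0// divr_ge0 ?invr_ge0 ?ltW.
have pg : {ae mun, forall x, En n x -> `|p x| <= g x}.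
  apply: filterS csq_pairing => x hx Ex.
  have -> : g x = (r * a x + b x / r) / 2.
    by rewrite /g; field; rewrite gt_eqF.
  by apply: sq_le_mul_norm_le => //; exact: le_trans (hp x) (hx Ex).
have le : (\int[mun]_(x in En n) `|p x|%:E <= \int[mun]_(x in En n) (g x)%:E)%E.
  apply: ae_ge0_le_integral => //.
  - by apply/measurable_EFinP; exact: measurableT_comp.
  - by move=> x _; rewrite lee_fin.
  - by have /integrableP[] := ig.
have ip : mun.-integrable (En n) (EFin \o p).
  apply/integrableP; split; first exact/measurable_EFinP.
  apply: (le_lt_trans le); have /integrableP[_] := ig.
  by under eq_integral do rewrite /= ger0_norm//.
split => //; apply: (le_trans (le_normr_Rintegral mE ip)).
have -> : (r * fine (sqnorm G j f) + fine (sqnorm G j' h) / r) / 2 = Rintegral mun (En n) g.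
  have iz (c : R) (q : n.-tuple point -> R) : mun.-integrable (En n) (EFin \o q) ->
      mun.-integrable (En n) (EFin \o (fun x => c * q x)).
    by move=> iq; rewrite (_ : _ \o _ = (fun x => c%:E * (q x)%:E)%E)//; exact: integrableZl.
  rewrite /g RintegralD//; try exact: iz.
  rewrite !RintegralZl// /Rintegral sqnorm_perm// -sqnormE//.
  by field; rewrite gt_eqF.
rewrite /Rintegral fine_le//.
- have iN : mun.-integrable (En n) (EFin \o (fun x => `|p x|)) by exact: integrable_norm.
  exact: integrable_fin_num.
- exact: integrable_fin_num.
Qed.

Lemma cintegrable_pairing :
  cintegrable mun (En n) (pairing_integrand f h s).
Proof.
have [mr mi] := cmeasurable_pairing.
split.
  by have [] := part_bound ltr01 mr (fun x => Re_sq_le _).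
by have [] := part_bound ltr01 mi (fun x => Im_sq_le _).
Qed.

Lemma pairing_bound (r : R) : 0 < r ->
  let I := cintegral mun (En n) (pairing_integrand f h s) in
  let b := (r * fine (sqnorm G j f) + fine (sqnorm G j' h) / r) / 2 in
  `|Re I| <= b /\ `|Im I| <= b.
Proof.
move=> r0; have [mr mi] := cmeasurable_pairing.
by have [_ ?] := part_bound r0 mr (fun x => Re_sq_le _);
  have [_ ?] := part_bound r0 mi (fun x => Im_sq_le _).
Qed.

End pairing.

(** * Square integrable random variables *)

Section square_integrable.
Context {R : realType} {dO} {Omega : measurableType dO}.
Variable P : probability Omega R.
Implicit Types X Y W : Omega -> R.

Definition sq_integrable X :=
  measurable_fun setT X /\ P.-integrable setT (fun w => (X w ^+ 2)%:E).

Definition inner X Y := Rintegral P setT (fun w => X w * Y w).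

Lemma sq_integrable_prod X Y : sq_integrable X -> sq_integrable Y ->
  P.-integrable setT (fun w => (X w * Y w)%:E).
Proof.
move=> [mX iX] [mY iY].
apply: (@le_integrable _ _ _ P setT measurableT _
    (fun w => (X w ^+ 2)%:E + (Y w ^+ 2)%:E)%E).
- by apply/measurable_EFinP; exact: measurable_funM.
- move=> w _; rewrite -EFinD /= lee_fin [leRHS]ger0_norm ?addr_ge0 ?sqr_ge0//.
  rewrite ler_norml; have := sqr_ge0 (X w - Y w); have := sqr_ge0 (X w + Y w); nra.
- exact: integrableD.
Qed.

Lemma sq_integrable_lin X Y (a b : R) : sq_integrable X -> sq_integrable Y ->
  sq_integrable (fun w => a * X w + b * Y w).
Proof.
move=> sX sY; have [mX iX] := sX; have [mY iY] := sY; split.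
  by apply: measurable_funD; apply: measurable_funM.
apply: (@le_integrable _ _ _ P setT measurableT _
    (fun w => (2 * a ^+ 2)%:E * (X w ^+ 2)%:E + (2 * b ^+ 2)%:E * (Y w ^+ 2)%:E)%E).
- apply/measurable_EFinP/measurable_funX.
  by apply: measurable_funD; apply: measurable_funM.
- move=> w _; rewrite -!EFinM -EFinD /= lee_fin ger0_norm ?sqr_ge0//.
  apply: le_trans (ler_norm _).
  have := sqr_ge0 (a * X w - b * Y w); nra.
- by apply: integrableD => //; exact: integrableZl.
Qed.

Lemma sq_integrableB X Y : sq_integrable X -> sq_integrable Y ->
  sq_integrable (fun w => X w - Y w).
Proof.
move=> sX sY; have := sq_integrable_lin 1 (-1) sX sY.
by under eq_fun do rewrite mul1r mulN1r.
Qed.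

Lemma sq_integrable_cst (c : R) : sq_integrable (fun=> c).
Proof.
split; first exact: measurable_cst.
exact: (@finite_measure_integrable_cst _ _ _ P setT (c ^+ 2)).
Qed.

Lemma innerC X Y : inner X Y = inner Y X.
Proof. by apply: eq_Rintegral => w _; rewrite mulrC. Qed.

Lemma inner_lin X Y W (a b : R) : sq_integrable X -> sq_integrable Y -> sq_integrable W ->
  inner (fun w => a * X w + b * Y w) W = a * inner X W + b * inner Y W.
Proof.
move=> sX sY sW; rewrite /inner.
have iz (c : R) V : sq_integrable V -> P.-integrable setT (EFin \o (fun w => c * (V w * W w))).
  move=> sV; rewrite (_ : _ \o _ = (fun w => c%:E * (V w * W w)%:E)%E)//.
  by apply: integrableZl => //; exact: sq_integrable_prod.
rewrite -!RintegralZl//; try exact: sq_integrable_prod.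
rewrite -RintegralD//; try exact: iz.
by apply: eq_Rintegral => w _; ring.
Qed.

Lemma innerB X Y W : sq_integrable X -> sq_integrable Y -> sq_integrable W ->
  inner (fun w => X w - Y w) W = inner X W - inner Y W.
Proof.
move=> sX sY sW; have := inner_lin 1 (-1) sX sY sW.
by under eq_fun do rewrite mul1r mulN1r; rewrite mul1r mulN1r.
Qed.

Lemma innerB_r X Y W : sq_integrable X -> sq_integrable Y -> sq_integrable W ->
  inner W (fun w => X w - Y w) = inner W X - inner W Y.
Proof. by move=> sX sY sW; rewrite innerC innerB// !(innerC _ W). Qed.

Lemma inner_ge0 X : 0 <= inner X X.
Proof.
by apply: Rintegral_ge0 => // w _; rewrite -expr2 sqr_ge0.
Qed.

Lemma inner_sq_lin X Y (a b : R) : sq_integrable X -> sq_integrable Y ->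
  inner (fun w => a * X w + b * Y w) (fun w => a * X w + b * Y w) =
  a ^+ 2 * inner X X + 2 * a * b * inner X Y + b ^+ 2 * inner Y Y.
Proof.
move=> sX sY; have sW := sq_integrable_lin a b sX sY.
rewrite inner_lin// (innerC X) (innerC Y) !inner_lin// (innerC Y X); ring.
Qed.

(** The second moments of r X + Y and r X - Y are nonnegative; expanding them and dividing by 2 r
    bounds the mixed moment on both sides. *)
Lemma inner_bound X Y (r : R) : sq_integrable X -> sq_integrable Y -> 0 < r ->
  `|inner X Y| <= (r * inner X X + inner Y Y / r) / 2.
Proof.
move=> sX sY r0.
have h (b : R) : b ^+ 2 = 1 -> 0 <= (r * inner X X + inner Y Y / r) / 2 + b * inner X Y.
  move=> b1; have := inner_ge0 (fun w => r * X w + b * Y w).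
  rewrite inner_sq_lin// b1 => h.
  have -> : (r * inner X X + inner Y Y / r) / 2 + b * inner X Y =
    (r ^+ 2 * inner X X + 2 * r * b * inner X Y + 1 * inner Y Y) / (2 * r).
    by field; rewrite gt_eqF.
  by rewrite divr_ge0// mulr_ge0// ltW.
by rewrite ler_norml; have := h 1 (expr1n _ _); have := h (-1) (sqrr_sign _ 1); lra.
Qed.

Lemma integral_sq X : sq_integrable X ->
  (\int[P]_w (X w ^+ 2)%:E)%E = (inner X X)%:E.
Proof.
move=> [mX iX]; rewrite /inner /Rintegral fineK//.
exact: integrable_fin_num.
Qed.

Lemma inner_eq0_ae X : sq_integrable X -> inner X X = 0 -> {ae P, forall w, X w = 0}.
Proof.
move=> sX X0; have [mX iX] := sX.
have : (\int[P]_w `|(X w ^+ 2)%:E|)%E = 0%E.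
  rewrite -[RHS]/(0%:E) -X0 -integral_sq//; apply: eq_integral => w _.
  by rewrite gee0_abs// lee_fin sqr_ge0.
move/(ae_eq_integral_abs P measurableT _).1 => h.
have := h (measurable_int P iX); apply: filterS => w /(_ I) [] /eqP.
by rewrite sqrf_eq0 => /eqP.
Qed.

(** The argument of Riesz and Fischer: squared increments of order 4^-m have summable first moments,
    so the sequence converges almost surely, and Fatou's lemma carries the rate over to the
    limit. *)
Lemma sq_integrable_complete (T : nat -> Omega -> R) (K : R) :
  (forall m, sq_integrable (T m)) ->
  (forall m l, (m <= l)%N ->
     inner (fun w => T l w - T m w) (fun w => T l w - T m w) <= K / 4 ^+ m) ->
  exists2 X, sq_integrable X &
    forall m, inner (fun w => X w - T m w) (fun w => X w - T m w) <= K / 4 ^+ m.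
Proof.
move=> sT cT.
have mT m : measurable_fun setT (T m) by have [] := sT m.
pose diff m w := T m.+1 w - T m w.
have sd m : sq_integrable (diff m) by exact: sq_integrableB.
have sd1 m : sq_integrable (fun w => `|diff m w|).
  have [md id] := sd m; split; first exact: measurableT_comp.
  by under eq_fun do rewrite real_normK ?num_real//.
have md m : measurable_fun setT (fun w => `|diff m w|%:E).
  by apply/measurable_EFinP; have [] := sd1 m.
have norm_diff m : (\int[P]_w `|diff m w|%:E <= ((K + 1) / (2 ^ (m + 1))%:R)%:E)%E.
  have s1 := sq_integrable_cst 1.
  have e2 : 0 < 2 ^+ m :> R by rewrite exprn_gt0.
  (* With r = 2^m both terms of the bound are of order 2^-m, the squared increments being at most K
     / 4^m. *)
  have := inner_bound (sd1 m) s1 e2.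
  have -> : inner (fun=> 1) (fun=> 1) = 1.
    rewrite /inner /Rintegral; under eq_integral do rewrite mul1r.
    rewrite integral_cst// mul1e.
    by transitivity (fine (1%E : \bar R)); [congr fine; exact: probability_setT|].
  have -> : inner (fun w => `|diff m w|) (fun w => `|diff m w|) = inner (diff m) (diff m).
    by apply: eq_Rintegral => w _; rewrite -!expr2 real_normK ?num_real.
  move=> h; have i1 := sq_integrable_prod (sd1 m) s1.
  have -> : (\int[P]_w `|diff m w|%:E)%E = (inner (fun w => `|diff m w|) (fun=> 1))%:E.
    rewrite /inner /Rintegral fineK; last exact: integrable_fin_num.
    by apply: eq_integral => w _; rewrite mulr1.
  rewrite lee_fin; apply: (le_trans (ler_norm _)); apply: (le_trans h).
  have -> : (K + 1) / (2 ^ (m + 1))%:R = (2 ^+ m * (K / 4 ^+ m) + 1 / 2 ^+ m) / 2.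
    rewrite addn1 natrX exprS (_ : 4 = 2 * 2 :> R) ?exprMn; last by ring.
    by field; rewrite gt_eqF.
  by rewrite ler_pM2r// lerD2r ler_pM2l//; exact: cT.
have iS : P.-integrable setT (fun w => \sum_(0 <= m <oo) `|diff m w|%:E)%E.
  apply/integrableP; split.
    by apply: ge0_emeasurable_sum.
  rewrite (eq_integral (fun w => \sum_(0 <= m <oo) `|diff m w|%:E)%E); last first.
    by move=> w _; rewrite gee0_abs//; apply: nneseries_ge0 => m _ _; rewrite lee_fin.
  rewrite integral_nneseries//.
  apply: (@le_lt_trans _ _ (\sum_(0 <= m <oo) ((K + 1) / (2 ^ (m + 1))%:R)%:E)%E).
    apply: lee_nneseries => [m _ _|m _]; last exact: norm_diff.
    by apply: integral_ge0.
  have /cvg_lim := @cvg_geometric_eseries_half R (K + 1) 0.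
  by move=> -> //; rewrite ltry.
(* The upper limit is measurable and defined everywhere; it is the limit wherever the sequence
   converges. *)
pose X w := fine (limn_esup (fun m => (T m w)%:E)).
have TX : {ae P, forall w, T m w @[m --> \oo] --> X w}.
  have := integrable_ae measurableT iS; apply: filterS => w /(_ I) fS.
  have cT' : cvgn (T ^~ w).
    have -> : T ^~ w = (fun m => T 0%N w + series (telescope (T ^~ w)) m).
      by apply/funext => m; rewrite -eq_sum_telescope.
    apply: is_cvgD; first exact: is_cvg_cst.
    apply: normed_cvg; apply: nondecreasing_is_cvgn.
      by move=> a b ab; apply: (@nondecreasing_series R (fun m => `|telescope (T ^~ w) m|) xpredT 0%N).
    exists (fine (\sum_(0 <= m <oo) `|diff m w|%:E)%E) => _ [m _ <-].
    rewrite -lee_fin fineK// /series /= -sumEFin.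
    exact: nneseries_lim_ge.
  have cE : (T m w)%:E @[m --> \oo] --> (limn (T ^~ w))%:E by apply: cvg_EFin; [exact: nearW|exact: cT'].
  have -> : X w = limn (T ^~ w).
    by rewrite /X is_cvg_limn_esupE; [rewrite (cvg_lim _ cE)|apply/cvg_ex; eexists; exact: cE].
  exact: cT'.
have mX : measurable_fun setT X.
  apply: (measurableT_comp (fine_measurable measurableT)).
  by apply: measurable_fun_limn_esup => m; exact/measurable_EFinP.
have Fatou m : (\int[P]_w ((X w - T m w) ^+ 2)%:E <= (K / 4 ^+ m)%:E)%E.
  have mf l : measurable_fun setT (fun w => ((T (l + m)%N w - T m w) ^+ 2)%:E).
    by apply/measurable_EFinP/measurable_funX; exact: measurable_funB.
  have f0 l w : setT w -> (0 <= ((T (l + m)%N w - T m w) ^+ 2)%:E)%E.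
    by move=> _; rewrite lee_fin sqr_ge0.
  have := @fatou _ _ _ P setT measurableT _ mf f0.
  pose u l := (\int[P]_w ((T (l + m)%N w - T m w) ^+ 2)%:E)%E.
  rewrite -[X in (_ <= limn_einf X)%E -> _]/u => h.
  apply: (@le_trans _ _ (limn_einf u)); last first.
    rewrite limn_einf_lim; apply: lime_le; first exact: is_cvg_einfs.
    apply: nearW => l; apply: (@le_trans _ _ (u l)).
      by apply: ereal_inf_lbound; exists l => /=.
    rewrite /u integral_sq ?lee_fin; last exact: sq_integrableB.
    by apply: cT; rewrite leq_addl.
  apply: le_trans h; apply: ae_ge0_le_integral => //.
  - by move=> w _; rewrite lee_fin sqr_ge0.
  - by apply/measurable_EFinP/measurable_funX; exact: measurable_funB.
  - move=> w _; rewrite limn_einf_lim; apply: lime_ge; first exact: is_cvg_einfs.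
    by apply: nearW => l; apply: le_ereal_inf_tmp => _ [i _ <-]; exact: f0.
  - rewrite /limn_einf; apply: measurableT_comp => //.
    by apply: measurable_fun_limn_esup => l; exact: measurableT_comp.
  apply: filterS TX => w cw _.
  have cE : ((T (l + m)%N w - T m w) ^+ 2)%:E @[l --> \oo] --> ((X w - T m w) ^+ 2)%:E.
    apply: cvg_EFin; first exact: nearW.
    rewrite (_ : _ \o _ = (fun l => (T (l + m)%N w - T m w) * (T (l + m)%N w - T m w))) //.
    rewrite expr2; have c1 : T (l + m)%N w - T m w @[l --> \oo] --> X w - T m w.
      by apply: cvgB; [rewrite (cvg_shiftn m (T ^~ w))|exact: cvg_cst].
    exact: cvgM.
  rewrite is_cvg_limn_einfE; last by apply/cvg_ex; eexists; exact: cE.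
  by rewrite (cvg_lim _ cE).
have sX m : sq_integrable (fun w => X w - T m w).
  split; first exact: measurable_funB.
  apply/integrableP; split.
    by apply/measurable_EFinP/measurable_funX; exact: measurable_funB.
  under eq_integral do rewrite gee0_abs ?lee_fin ?sqr_ge0//.
  by apply: le_lt_trans (Fatou m) _; rewrite ltry.
exists X; last by move=> m; rewrite -lee_fin -integral_sq.
have := sq_integrable_lin 1 1 (sX 0%N) (sT 0%N).
by under eq_fun do rewrite !mul1r subrK.
Qed.

End square_integrable.

(** The two differences are bounded with the parameters r and 1/r, so that the small quantity [e] is
    multiplied by r and the bounded second moments by 1/r. A large r followed by a much smaller [e]
    makes the bound small. *)
Lemma inner_close {R : realType} {dO} {Omega : measurableType dO} (P : probability Omega R)
    (X X' Y Y' : Omega -> R) (e r : R) : 0 < r ->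
  sq_integrable P X -> sq_integrable P X' -> sq_integrable P Y -> sq_integrable P Y' ->
  inner P (fun w => X w - X' w) (fun w => X w - X' w) <= e ->
  inner P (fun w => Y w - Y' w) (fun w => Y w - Y' w) <= e ->
  `|inner P X Y - inner P X' Y'| <= r * e + (inner P X X + inner P Y Y + e) / r.
Proof.
move=> r0 sX sX' sY sY' Xe Ye.
have sdX := sq_integrableB sX sX'; have sdY := sq_integrableB sY sY'.
have -> : inner P X Y - inner P X' Y' =
    inner P (fun w => X w - X' w) Y' + inner P X (fun w => Y w - Y' w).
  rewrite innerB// innerB_r//; ring.
have r0' : 0 < r^-1 by rewrite invr_gt0.
apply: (le_trans (ler_normD _ _)).
apply: (le_trans (lerD (inner_bound sdX sY' r0) (inner_bound sX sdY r0'))).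
(* The bound may involve only [X] and [Y], which stay fixed, so the approximant [Y'] is eliminated
   by the parallelogram law. *)
have hY : inner P Y' Y' <= 2 * inner P Y Y + 2 * inner P (fun w => Y w - Y' w) (fun w => Y w - Y' w).
  have := inner_sq_lin 1 1 sY sdY; have := inner_sq_lin 1 (-1) sY sdY.
  have -> : (fun w => 1 * Y w + -1 * (Y w - Y' w)) = Y' by apply/funext => w; ring.
  by have := inner_ge0 P (fun w => 1 * Y w + 1 * (Y w - Y' w)); lra.
have X0 := inner_ge0 P X.
rewrite invrK; set a := inner P _ _ in Xe *; set b := inner P _ _ in Ye hY *.
have ra : r * a <= r * e by rewrite ler_pM2l.
have rb : b * r <= r * e by rewrite mulrC ler_pM2l.
have rh : inner P Y' Y' / r <= (2 * inner P Y Y + 2 * e) / r.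
  by rewrite ler_pM2r//; lra.
have fr : 0 <= inner P X X / r by rewrite divr_ge0// ltW.
by rewrite mulrDl mulrDl in rh *; nra.
Qed.

(** * The sum over permutations as a form on K *)

Section form.
Context {R : realType} {k : space_kind} {nu d : nat}.
Variable G : spectral_measure R k nu d.
Local Notation point := (nu.-tuple R).
Local Notation En := (space_pow R k nu).
Variable n : nat.
Local Notation mun := (power_measure (sm_mu G) n).
Implicit Types (j : 'I_n -> 'I_d) (f g h : n.-tuple point -> R[i]).

Let mE := @measurable_space_pow R k nu n.

Definition form j j' f h : R[i] :=
  \sum_(s : 'S_n) cintegral mun (En n) (pairing_integrand G j j' f h s).

Lemma in_KB j f g : in_K G j f -> in_K G j g -> in_K G j (fun x => f x - g x).
Proof.
move=> Kf Kg; have := in_K_lin 1 (-1) Kf Kg.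
by under eq_fun do rewrite raddfN mul1r mulN1r.
Qed.

Lemma in_K_pairing j j' f h s : in_K G j f -> in_K G j' h ->
  cintegrable mun (En n) (pairing_integrand G j j' f h s).
Proof. by case=> mf _ nf [mh _ nh]; exact: cintegrable_pairing. Qed.

Lemma form_lin_l j j' f g h (a b : R) :
  in_K G j f -> in_K G j g -> in_K G j' h ->
  form j j' (fun x => a%:C%C * f x + b%:C%C * g x) h =
  a%:C%C * form j j' f h + b%:C%C * form j j' g h.
Proof.
move=> Kf Kg Kh; rewrite /form !mulr_sumr -big_split; apply: eq_bigr => s _ /=.
have if_ := in_K_pairing s Kf Kh; have ig := in_K_pairing s Kg Kh.
rewrite -!cintegralZ// -cintegralD//; try exact: cintegrableZ.
apply: (@eq_cintegral _ _ _ _ _ _ (fun x => a%:C%C * pairing_integrand G j j' f h s x +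
  b%:C%C * pairing_integrand G j j' g h s x)) => x _.
by rewrite /pairing_integrand; ring.
Qed.

Lemma form_lin_r j j' f g h (a b : R) :
  in_K G j f -> in_K G j' g -> in_K G j' h ->
  form j j' f (fun x => a%:C%C * g x + b%:C%C * h x) =
  a%:C%C * form j j' f g + b%:C%C * form j j' f h.
Proof.
move=> Kf Kg Kh; rewrite /form !mulr_sumr -big_split; apply: eq_bigr => s _ /=.
have ig := in_K_pairing s Kf Kg; have ih := in_K_pairing s Kf Kh.
rewrite -!cintegralZ// -cintegralD//; try exact: cintegrableZ.
apply: (@eq_cintegral _ _ _ _ _ _ (fun x => a%:C%C * pairing_integrand G j j' f g s x +
  b%:C%C * pairing_integrand G j j' f h s x)) => x _.
rewrite /pairing_integrand; set u := g _; set v := h _.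
have -> : conjc (a%:C%C * u + b%:C%C * v) = a%:C%C * conjc u + b%:C%C * conjc v.
  by apply: complexP; rewrite ?(ReJ, ImJ, ReD, ImD, ReM, ImM) /=; ring.
ring.
Qed.

Lemma formB_l j j' f g h : in_K G j f -> in_K G j g -> in_K G j' h ->
  form j j' (fun x => f x - g x) h = form j j' f h - form j j' g h.
Proof.
move=> Kf Kg Kh; have := form_lin_l 1 (-1) Kf Kg Kh.
rewrite raddfN mul1r mulN1r => <-; congr (form _ _ _ _); apply/funext => x.
by rewrite mul1r mulN1r.
Qed.

Lemma formB_r j j' f g h : in_K G j f -> in_K G j' g -> in_K G j' h ->
  form j j' f (fun x => g x - h x) = form j j' f g - form j j' f h.
Proof.
move=> Kf Kg Kh; have := form_lin_r 1 (-1) Kf Kg Kh.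
rewrite raddfN mul1r mulN1r => <-; congr (form _ _ _ _); apply/funext => x.
by rewrite mul1r mulN1r.
Qed.

Definition fsqnorm j f : R := fine (sqnorm G j f).

Lemma sqnorm_fin j f : in_K G j f -> sqnorm G j f = (fsqnorm j f)%:E.
Proof.
by case=> mf _ nf; rewrite fineK// ge0_fin_numE// sqnorm_ge0.
Qed.

Lemma fsqnorm_ge0 j f : in_K G j f -> 0 <= fsqnorm j f.
Proof. by case=> mf _ _; rewrite fine_ge0// sqnorm_ge0. Qed.

Lemma fsqnormB_le j f g : in_K G j f -> in_K G j g ->
  fsqnorm j (fun x => f x - g x) <= 2 * fsqnorm j f + 2 * fsqnorm j g.
Proof.
move=> Kf Kg; have := sqnorm_lin G j 1 (-1) (K_measurable Kf) (K_measurable Kg).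
have -> : (fun x => (1%:C%C * f x + (-1)%:C%C * g x)%R) = (fun x => f x - g x).
  by apply/funext => x; rewrite raddfN mul1r mulN1r.
rewrite !sqnorm_fin//; last exact: in_KB.
by rewrite -!EFinM -EFinD lee_fin sqrrN expr1n mulr1.
Qed.

Lemma form_bound j j' f h (r : R) : in_K G j f -> in_K G j' h -> 0 < r ->
  let b := n`!%:R * ((r * fsqnorm j f + fsqnorm j' h / r) / 2) in
  `|Re (form j j' f h)| <= b /\ `|Im (form j j' f h)| <= b.
Proof.
move=> [mf _ nf] [mh _ nh] r0; rewrite /form Re_sum Im_sum.
have -> : n`!%:R * ((r * fsqnorm j f + fsqnorm j' h / r) / 2) =
    \sum_(s : 'S_n) (r * fsqnorm j f + fsqnorm j' h / r) / 2.
  by rewrite sumr_const card_Sn mulr_natl.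
by split; (apply: (le_trans (ler_norm_sum _ _ _)); apply: ler_sum => s _;
  have [] := pairing_bound mf mh nf nh s r0).
Qed.

(** The parameter r = 1 balances two equal norms. Each of the n! permutations contributes at most
    the squared norm. *)
Lemma form_diag_le j f : in_K G j f -> Re (form j j f f) <= n`!%:R * fsqnorm j f.
Proof.
move=> Kf; apply: (le_trans (ler_norm _)); apply: (le_trans (form_bound Kf Kf ltr01).1).
by have -> : (1 * fsqnorm j f + fsqnorm j f / 1) / 2 = fsqnorm j f by field.
Qed.

Let sq_near j f g e : in_K G j f -> in_K G j g -> fsqnorm j (fun x => g x - f x) <= e ->
  fsqnorm j g <= 2 * fsqnorm j f + 2 * e.
Proof.
move=> Kf Kg le; have Kgf := in_KB Kg Kf; have KD := in_K_lin 1 1 Kf Kgf.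
have := sqnorm_lin G j 1 1 (K_measurable Kf) (K_measurable Kgf).
have -> : (fun x => (1%:C%C * f x + 1%:C%C * (g x - f x))%R) = g.
  by apply/funext => x; rewrite !mul1r addrC subrK.
rewrite !sqnorm_fin// -!EFinM -EFinD lee_fin expr1n; lra.
Qed.

(** The counterpart on K of the estimate for inner products, with the same dependence on [r] and
    [e], so that both can be passed to the limit together. *)
Lemma form_close j j' f f' h h' (e r : R) : 0 < r ->
  in_K G j f -> in_K G j f' -> in_K G j' h -> in_K G j' h' ->
  fsqnorm j (fun x => f' x - f x) <= e -> fsqnorm j' (fun x => h' x - h x) <= e ->
  `|Re (form j j' f' h' - form j j' f h)| <=
    n`!%:R * (r * e + (fsqnorm j f + fsqnorm j' h + e) / r) /\
  `|Im (form j j' f' h' - form j j' f h)| <=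
    n`!%:R * (r * e + (fsqnorm j f + fsqnorm j' h + e) / r).
Proof.
move=> r0 Kf Kf' Kh Kh' fe he.
have -> : form j j' f' h' - form j j' f h =
    form j j' (fun x => f' x - f x) h' + form j j' f (fun x => h' x - h x).
  rewrite formB_l// formB_r//; ring.
have Kdf := in_KB Kf' Kf; have Kdh := in_KB Kh' Kh.
have r0' : 0 < r^-1 by rewrite invr_gt0.
have hh := sq_near Kh Kh' he; have h0 := fsqnorm_ge0 Kh; have f0 := fsqnorm_ge0 Kf.
have e0 : 0 <= e by apply: le_trans fe; exact: fsqnorm_ge0.
have fac : 0 <= n`!%:R :> R by [].
have le : n`!%:R * ((r * fsqnorm j (fun x => f' x - f x) + fsqnorm j' h' / r) / 2) +
   n`!%:R * ((r^-1 * fsqnorm j f + fsqnorm j' (fun x => h' x - h x) / r^-1) / 2) <=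
   n`!%:R * (r * e + (fsqnorm j f + fsqnorm j' h + e) / r).
  rewrite -mulrDr ler_wpM2l// invrK.
  set a := fsqnorm j _ in fe *; set b := fsqnorm j' _ in he *.
  have ra : r * a <= r * e by rewrite ler_pM2l.
  have rb : b * r <= r * e by rewrite mulrC ler_pM2l.
  have rh : fsqnorm j' h' / r <= (2 * fsqnorm j' h + 2 * e) / r by rewrite ler_pM2r.
  have fr : 0 <= fsqnorm j f / r by rewrite divr_ge0// ltW.
  rewrite mulrDl mulrDl in rh *; nra.
rewrite ReD ImD; split; (apply: (le_trans (ler_normD _ _)); apply: le_trans le; apply: lerD).
- exact: (form_bound Kdf Kh' r0).1.
- exact: (form_bound Kf Kdh r0').1.
- exact: (form_bound Kdf Kh' r0).2.
- exact: (form_bound Kf Kdh r0').2.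
Qed.

End form.

(** With [e] equal to r^-2 the bound is of order 1/r, and r is arbitrary. *)
Lemma eq0_of_close (R : realFieldType) (C Q t : R) : 0 <= C -> 0 <= Q ->
  (forall r e, 0 < r -> 0 < e -> `|t| <= C * (r * e + (Q + e) / r)) -> t = 0.
Proof.
move=> C0 Q0 h; apply/eqP; rewrite -normr_le0; apply/ler_addgt0Pl => e e0.
(* Chosen so that r e = e + C (Q + 3), which exceeds the numerator C (1 + Q + r^-2) because r >=
   1. *)
pose r := 1 + (C * (Q + 3)) / e.
have c0 : 0 <= C * (Q + 3) by apply: mulr_ge0 => //; lra.
have r1 : 1 <= r by rewrite lerDl divr_ge0 ?(ltW e0).
have r0 : 0 < r by lra.
have q0 : 0 < r ^- 2 by rewrite invr_gt0 exprn_gt0.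
rewrite addr0; apply: (le_trans (h r (r ^- 2) r0 q0)).
have -> : C * (r * r ^- 2 + (Q + r ^- 2) / r) = C * (1 + Q + r ^- 2) / r.
  by field; rewrite gt_eqF.
rewrite ler_pdivrMr//.
have er : e * r = e + C * (Q + 3).
  by rewrite /r; field; rewrite gt_eqF.
rewrite er; apply: (@le_trans _ _ (C * (Q + 3))); last by rewrite lerDr ltW.
rewrite ler_wpM2l//.
have : r ^- 2 <= 1 by rewrite invf_le1 ?exprn_gt0// exprn_ege1.
lra.
Qed.

(** * Multiple integrals *)

Section random_measure.
Context {R : realType} {dO} {Omega : measurableType dO}.
Variable P : probability Omega R.
Context {k : space_kind} {nu d : nat}.
Variable G : spectral_measure R k nu d.
Local Notation point := (nu.-tuple R).
Variable Z : 'I_d -> set point -> Omega -> R[i].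
Hypothesis hZ : random_spectral_measure P G Z.
Local Notation En := (space_pow R k nu).

Section finite_family.
Variables (p : nat) (jj : 'I_p -> 'I_d) (A : 'I_p -> set point).
Hypothesis bA : forall i, bounded_borel k (A i).

Definition re_im_family (ib : 'I_p * bool) (w : Omega) : R :=
  if ib.2 then Re (Z (jj ib.1) (A ib.1) w)
  else Im (Z (jj ib.1) (A ib.1) w).

Lemma re_im_family_gaussian : jointly_gaussian P re_im_family.
Proof. exact: (rsm_gaussian hZ jj bA). Qed.

Lemma re_im_family_mean ib : Rintegral P setT (re_im_family ib) = 0.
Proof.
have := rsm_mean hZ (jj ib.1) (bA ib.1); case: ib => i b.
by rewrite /cexpectation /cintegral => -[hr hi]; case: b.
Qed.

Definition re_im_coef (i : 'I_p) (ib : 'I_p * bool) : R[i] :=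
  if ib.1 == i then (if ib.2 then 1 else 'i%C) else 0.

Lemma gspan_re_im i : gspan re_im_family (re_im_coef i) = Z (jj i) (A i).
Proof.
apply/funext => w; rewrite /gspan /re_im_coef /re_im_family.
rewrite (bigD1 (i, true)) //= (bigD1 (i, false)) /=; last by rewrite xpair_eqE andbF.
rewrite big1 ?addr0.
  by rewrite ?eqxx mul1r -complexE.
move=> [l b] /andP[/= h1 h2]; case: eqVneq => [e|_]; last by rewrite mul0r.
by move: h1 h2; rewrite e; case: b; rewrite eqxx.
Qed.

Lemma fin_moments_family i : fin_moments P (Z (jj i) (A i)).
Proof.
rewrite -gspan_re_im; apply: fin_moments_gspan.
  exact: re_im_family_gaussian.
exact: re_im_family_mean.
Qed.

End finite_family.

Lemma fin_moments_Z j A : bounded_borel k A -> fin_moments P (Z j A).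
Proof.
by move=> bA; exact: (@fin_moments_family 1 (fun=> j) (fun=> A) (fun=> bA) ord0).
Qed.

Lemma spectral_set0 j j' : sm_G G j j' set0 = 0.
Proof.
have [_ ->] := sm_density G j j' (@bounded_borel_set0 R k nu).
by apply: complexP; rewrite /= /Rintegral integral_set0.
Qed.

Lemma rsm_even_neg j A : bounded_borel k A ->
  {ae P, forall w, conjc (Z j A w) = Z j (neg k @` A) w}.
Proof.
move=> bA; have := rsm_even hZ j bA; apply: filterS => w ->.
by rewrite conjcK.
Qed.

(** Wick's formula involves products without conjugates; Z(B) = conj Z(-B) turns them into the given
    covariances. *)
Lemma rsm_pair j j' A B : bounded_borel k A -> bounded_borel k B ->
  cexpectation P (fun w => Z j A w * Z j' B w) = sm_G G j j' (A `&` neg k @` B).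
Proof.
move=> bA bB; have bB' := bounded_borel_neg bB.
rewrite -(rsm_cov hZ j j' bA bB'); apply: ae_eq_cintegral => //.
- by apply: cmeasurableM; exact: (fin_moments_Z _ _).1.
- by apply: cmeasurableM; [|apply: cmeasurableJ]; exact: (fin_moments_Z _ _).1.
- have := rsm_even hZ j' bB; apply: filterS => w h _.
  by rewrite h.
Qed.

Section products.
Variables (n n' : nat) (j : 'I_n -> 'I_d) (j' : 'I_n' -> 'I_d).
Variables (A : 'I_n -> set point) (B : 'I_n' -> set point).
Hypothesis bA : forall i, bounded_borel k (A i).
Hypothesis bB : forall i, bounded_borel k (B i).
Hypothesis AA : forall i i', A i `&` neg k @` A i' = set0.
Hypothesis BB : forall i i', B i `&` neg k @` B i' = set0.

Let jj (i : 'I_(n + n')) := match fintype.split i with inl a => j a | inr b => j' b end.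
Let C (i : 'I_(n + n')) := match fintype.split i with inl a => A a | inr b => B b end.
Let bC i : bounded_borel k (C i).
Proof. by rewrite /C; case: (fintype.split i) => a; [exact: bA|exact: bB]. Qed.

Let X := re_im_family jj C.
Let U (i : 'I_n) := re_im_coef (lshift n' i).
Let V (i : 'I_n') := re_im_coef (rshift n i).

Let UE i : gspan X (U i) = Z (j i) (A i).
Proof.
rewrite /X gspan_re_im /jj /C.
by rewrite -[lshift n' i]/(unsplit (inl i)) unsplitK.
Qed.

Let VE i : gspan X (V i) = Z (j' i) (B i).
Proof.
rewrite /X gspan_re_im /jj /C.
by rewrite -[rshift n i]/(unsplit (inr i)) unsplitK.
Qed.

Let UU i i' : cexpectation P (fun w => gspan X (U i) w * gspan X (U i') w) = 0.
Proof. by rewrite !UE rsm_pair// AA spectral_set0. Qed.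

Let VV i i' : cexpectation P (fun w => gspan X (V i) w * gspan X (V i') w) = 0.
Proof. by rewrite !VE rsm_pair// BB spectral_set0. Qed.

(** Wick's formula needs one jointly Gaussian family containing the factors of both products, so
    these are concatenated and split into real and imaginary parts. *)
Lemma rsm_gaussian_family : exists (I : finType) (X : I -> Omega -> R) U V,
  [/\ jointly_gaussian P X, forall i, Rintegral P setT (X i) = 0,
      forall i, gspan X (U i) = Z (j i) (A i),
      forall i, gspan X (V i) = Z (j' i) (B i) &
      (forall i i', cexpectation P (fun w => gspan X (U i) w * gspan X (U i') w) = 0) /\
      (forall i i', cexpectation P (fun w => gspan X (V i) w * gspan X (V i') w) = 0)].
Proof.
exists _, X, U, V; split => //; first exact: re_im_family_gaussian.
exact: re_im_family_mean.
Qed.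

End products.

Section wick.
Variables (n n' : nat) (j : 'I_n -> 'I_d) (j' : 'I_n' -> 'I_d).
Variables (A : 'I_n -> set point) (B : 'I_n' -> set point).
Hypothesis bA : forall i, bounded_borel k (A i).
Hypothesis bB : forall i, bounded_borel k (B i).
Hypothesis AA : forall i i', A i `&` neg k @` A i' = set0.
Hypothesis BB : forall i i', B i `&` neg k @` B i' = set0.

Lemma rsm_wick_neq : n != n' ->
  cexpectation P (fun w => \prod_i Z (j i) (A i) w * \prod_i Z (j' i) (B i) w) = 0.
Proof.
have [I [X [U [V [gX X0 UE VE [UU VV]]]]]] := rsm_gaussian_family j j' bA bB AA BB.
move=> nn'; rewrite -(gaussian_wick_cross_neq gX X0 nn' UU VV).
congr cexpectation; apply/funext => w.
by congr (_ * _); apply: eq_bigr => i _; rewrite ?UE ?VE.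
Qed.

End wick.

Lemma rsm_wick n (j j' : 'I_n -> 'I_d) (A B : 'I_n -> set point) :
  (forall i, bounded_borel k (A i)) -> (forall i, bounded_borel k (B i)) ->
  (forall i i', A i `&` neg k @` A i' = set0) ->
  (forall i i', B i `&` neg k @` B i' = set0) ->
  cexpectation P (fun w => \prod_i Z (j i) (A i) w * \prod_i Z (j' i) (B i) w) =
  \sum_(s : 'S_n) \prod_i sm_G G (j i) (j' (s i)) (A i `&` neg k @` B (s i)).
Proof.
move=> bA bB AA BB.
have [I [X [U [V [gX X0 UE VE [UU VV]]]]]] := rsm_gaussian_family j j' bA bB AA BB.
transitivity (cexpectation P (fun w => \prod_i gspan X (U i) w * \prod_i gspan X (V i) w)).
  congr cexpectation; apply/funext => w.
  by congr (_ * _); apply: eq_bigr => i _; rewrite ?UE ?VE.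
rewrite gaussian_wick_cross//; apply: eq_bigr => s _; apply: eq_bigr => i _.
by rewrite UE VE rsm_pair.
Qed.

(** Additivity for the empty family of sets. *)
Lemma rsm_set0 l : {ae P, forall w, Z l set0 w = 0}.
Proof.
have := rsm_additive hZ l (A := fun _ : 'I_0 => set0).
have -> : \bigcup_(i : 'I_0) set0 = set0 :> set point.
  by apply/seteqP; split=> x // -[].
move=> h; have {h} : {ae P, forall w, \sum_(i < 0) Z l set0 w = Z l set0 w}.
  by apply: h => -[].
by apply: filterS => w; rewrite big_ord0.
Qed.

(** * Integrals of simple functions *)

Section simple.
Variables (n : nat) (j : 'I_n -> 'I_d) (f : n.-tuple point -> R[i]).
Variables (N : nat) (D : sindex N -> set point) (u : sindex N -> point).
Hypothesis Kf : in_K G j f.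
Hypothesis rD : regular_system (k := k) D.
Hypothesis aD : adapted (k := k) D f.
Hypothesis uD : forall a, D a !=set0 -> D a (u a).

(* f at the chosen points of a cell of D^n, with the junk value of f at the points
   chosen for empty cells replaced by 0. *)
Definition coef (a : {ffun 'I_n -> sindex N}) : R[i] :=
  if `[< exists x, box D a x >] then f [tuple u (a i) | i < n] else 0.

Definition simple_sum (w : Omega) : R[i] :=
  \sum_a coef a * \prod_i Z (j i) (D (a i)) w.

Let bD a : bounded_borel k (D a) := rs_bounded rD a.

Let u_box (a : {ffun 'I_n -> sindex N}) x : box D a x -> box D a [tuple u (a i) | i < n].
Proof. by move=> bx i; rewrite tnth_mktuple; apply: uD; exists (tnth x i). Qed.

Let coef_box (a : {ffun 'I_n -> sindex N}) x : box D a x -> coef a = f x.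
Proof.
move=> bx; rewrite /coef; case: asboolP => [_|nx]; last by exfalso; apply: nx; exists x.
by apply: (adapted_const aD (a := a)) => //; exact: u_box bx.
Qed.

Lemma coef_expand x : En n x -> f x = \sum_a coef a * (x \in tbox (fun i => D (a i)))%:R.
Proof.
move=> Ex; have [[a ax]|nx] := pselect (exists a : {ffun 'I_n -> sindex N}, box D a x).
  rewrite (bigD1 a)//= mem_set// mulr1 (coef_box ax) big1 ?addr0// => b ba.
  rewrite memNset ?mulr0// => bx; move/eqP: ba; apply; apply/ffunP => i.
  exact: regular_inj rD (bx i) (ax i).
rewrite (adapted_out aD)//; last first.
  by move=> a ax; apply: nx; exists [ffun i => a i] => i; rewrite ffunE; exact: ax.
rewrite big1// => a _; rewrite memNset ?mulr0// => ax; apply: nx; exists a; exact: ax.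
Qed.

Lemma coef_off_diag a : coef a != 0 -> off_diag a.
Proof.
rewrite /coef; case: asboolP => [[x bx] fx|]; last by rewrite eqxx.
move=> l l' ll'; have h e : (a l = a l' \/ a l = sopp (a l')) -> e.
  move=> hh; move: fx; rewrite (adapted_diag aD (u_box bx)) ?eqxx//.
  by exists l, l'.
by split; apply/eqP => e; apply: h; [left|right].
Qed.

Definition sopp_ffun (a : {ffun 'I_n -> sindex N}) := [ffun i => sopp (a i)].

Lemma sopp_ffunK : involutive sopp_ffun.
Proof. by move=> a; apply/ffunP => i; rewrite !ffunE soppK. Qed.

Let box_sopp (a : {ffun 'I_n -> sindex N}) x : box D a x ->
  box D (sopp_ffun a) (neg_tuple k x).
Proof. by move=> bx i; rewrite ffunE tnth_mktuple; apply: (regular_opp rD); exact: bx. Qed.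

(** The opposite cell consists of the reflected points, where [f] takes conjugate values; a cell and
    its opposite are empty together. *)
Lemma coef_sopp a : coef (sopp_ffun a) = conjc (coef a).
Proof.
have [[x bx]|nx] := pselect (exists x, box D a x).
  rewrite (coef_box bx) (coef_box (box_sopp bx)) (K_even Kf)// => i.
  by have [_ h _] := bD (a i); apply: h; exact: bx.
rewrite /coef (asboolF nx) asboolF ?conjc0// => -[x bx]; apply: nx.
by exists (neg_tuple k x); have := box_sopp bx; rewrite sopp_ffunK.
Qed.

Lemma fin_moments_simple_sum : fin_moments P simple_sum.
Proof.
apply: fin_moments_sum => a; apply: fin_momentsZ; apply: fin_moments_prod => i.
exact: fin_moments_Z.
Qed.

End simple.

Section one.
Variables (n : nat) (j : 'I_n -> 'I_d) (f : n.-tuple point -> R[i]).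
Variables (N : nat) (D : sindex N -> set point) (u : sindex N -> point).
Hypothesis Kf : in_K G j f.
Hypothesis rD : regular_system (k := k) D.
Hypothesis aD : adapted (k := k) D f.
Hypothesis uD : forall a, D a !=set0 -> D a (u a).

Let bD a : bounded_borel k (D a) := rs_bounded rD a.

(** The two sums differ only at empty cells; such a cell has an empty side, where Z vanishes almost
    surely. *)
Lemma simple_sumE :
  {ae P, forall w, simple_integral Z D u j f w = simple_sum j f D u w}.
Proof.
have h : {ae P, forall w, forall a : {ffun 'I_n -> sindex N},
   f [tuple u (a i) | i < n] * \prod_(i < n) Z (j i) (D (a i)) w =
   coef f D u a * \prod_(i < n) Z (j i) (D (a i)) w}.
  apply: filter_forall => a; rewrite /coef; case: asboolP => [_|nx]; first exact: nearW.
  have [i hi] : exists i, D (a i) = set0.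
    apply: contrapT => /forallNP hi; apply: nx; exists [tuple u (a i) | i < n] => i.
    by rewrite tnth_mktuple; apply: uD; apply/set0P/eqP; exact: hi.
  have := rsm_set0 (j i); apply: filterS => w Z0.
  by rewrite (bigD1 i)//= hi Z0 mul0r !mulr0.
by apply: filterS h => w h; apply: eq_bigr => a _; exact: h.
Qed.

(** Conjugation exchanges the summand of a cell with that of the opposite cell. *)
Lemma simple_sum_real : {ae P, forall w, conjc (simple_sum j f D u w) = simple_sum j f D u w}.
Proof.
have h : {ae P, forall w, forall p : 'I_d * sindex N,
    conjc (Z p.1 (D p.2) w) = Z p.1 (D (sopp p.2)) w}.
  apply: filter_forall => -[l b] /=; have := rsm_even_neg l (bD b).
  by rewrite -[D (sopp b)]/(D (sopp b)) (rs_neg rD (sopp b)) soppK.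
apply: filterS h => w h; rewrite /simple_sum rmorph_sum.
rewrite [RHS](reindex_inj (can_inj (@sopp_ffunK n N))); apply: eq_bigr => a _.
rewrite (coef_sopp Kf rD aD uD) rmorphM rmorph_prod; congr (_ * _).
by apply: eq_bigr => i _; rewrite ffunE; exact: (h (j i, a i)).
Qed.

Let fm_prod (a : {ffun 'I_n -> sindex N}) :
  fin_moments P (fun w => \prod_i Z (j i) (D (a i)) w).
Proof. by apply: fin_moments_prod => i; apply: fin_moments_Z. Qed.

Lemma off_diag_disjoint (a : {ffun 'I_n -> sindex N}) : off_diag a ->
  forall i i', D (a i) `&` neg k @` D (a i') = set0.
Proof.
move=> oa i i'; rewrite -{1}[a i']soppK -(rs_neg rD); apply: (rs_disjoint rD).
have [->|ii'] := eqVneq i i'; first exact: sopp_neq.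
by have [] := oa _ _ ii'.
Qed.

Lemma simple_sum_mean : (0 < n)%N -> cexpectation P (simple_sum j f D u) = 0.
Proof.
move=> n0; rewrite /cexpectation /simple_sum cintegral_sum//; last first.
  by move=> a _; apply: cintegrableZ => //; exact: fin_moments_integrable.
rewrite big1// => a _; rewrite cintegralZ//; last exact: fin_moments_integrable.
have [->|ca] := eqVneq (coef f D u a) 0; first by rewrite mul0r.
have oa := coef_off_diag aD uD ca.
have n0' : n != 0%N by rewrite -lt0n.
(* The mean is the mixed moment with an empty product; the data of the second family are fillers,
   its index set being empty. *)
have := @rsm_wick_neq n 0 j (fun i => match i with Ordinal _ e => j (Ordinal n0) end)
  (fun i => D (a i)) (fun=> set0) (fun i => bD (a i)) (fun _ => @bounded_borel_set0 R k nu)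
  (off_diag_disjoint oa).
rewrite /cexpectation => h.
rewrite [X in _ * X](_ : _ = 0) ?mulr0// -[RHS]h//.
  by apply: eq_cintegral => w _; rewrite big_ord0 mulr1.
by move=> i; rewrite set0I.
Qed.

End one.

Section two.
Variables (n n' : nat) (j : 'I_n -> 'I_d) (j' : 'I_n' -> 'I_d).
Variables (f : n.-tuple point -> R[i]) (h : n'.-tuple point -> R[i]).
Variables (N : nat) (D : sindex N -> set point) (u : sindex N -> point).
Variables (N' : nat) (D' : sindex N' -> set point) (u' : sindex N' -> point).
Hypothesis rD : regular_system (k := k) D.
Hypothesis aD : adapted (k := k) D f.
Hypothesis uD : forall a, D a !=set0 -> D a (u a).
Hypothesis rD' : regular_system (k := k) D'.
Hypothesis aD' : adapted (k := k) D' h.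
Hypothesis uD' : forall a, D' a !=set0 -> D' a (u' a).

Lemma simple_pair_expand :
  cexpectation P (fun w => simple_sum j f D u w * simple_sum j' h D' u' w) =
  \sum_a \sum_b coef f D u a * coef h D' u' b *
    cexpectation P (fun w => \prod_i Z (j i) (D (a i)) w * \prod_i Z (j' i) (D' (b i)) w).
Proof.
have fm (a : {ffun 'I_n -> sindex N}) (b : {ffun 'I_n' -> sindex N'}) : fin_moments P
    (fun w => \prod_i Z (j i) (D (a i)) w * \prod_i Z (j' i) (D' (b i)) w).
  apply: fin_momentsM; apply: fin_moments_prod => i; apply: fin_moments_Z.
    exact: rs_bounded rD _.
  exact: rs_bounded rD' _.
have fm2 (a : {ffun 'I_n -> sindex N}) (b : {ffun 'I_n' -> sindex N'}) : cintegrable P setT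
    (fun w => coef f D u a * coef h D' u' b *
      (\prod_i Z (j i) (D (a i)) w * \prod_i Z (j' i) (D' (b i)) w)).
  by apply: cintegrableZ => //; exact: fin_moments_integrable.
rewrite /cexpectation (@eq_cintegral _ _ _ _ _ _ (fun w => \sum_a \sum_b coef f D u a * coef h D' u' b *
    (\prod_i Z (j i) (D (a i)) w * \prod_i Z (j' i) (D' (b i)) w))); last first.
  move=> w _; rewrite /simple_sum mulr_suml; apply: eq_bigr => a _.
  by rewrite mulr_sumr; apply: eq_bigr => b _; rewrite mulrACA.
rewrite cintegral_sum//; last by move=> a _; apply: cintegrable_sum => // b _; exact: fm2.
apply: eq_bigr => a _; rewrite cintegral_sum//.
apply: eq_bigr => b _; rewrite cintegralZ//; exact: fin_moments_integrable.
Qed.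

Lemma simple_pair_neq : n != n' ->
  cexpectation P (fun w => simple_sum j f D u w * simple_sum j' h D' u' w) = 0.
Proof.
move=> nn'; rewrite simple_pair_expand big1// => a _; rewrite big1// => b _.
have [->|ca] := eqVneq (coef f D u a) 0; first by rewrite !mul0r.
have [->|cb] := eqVneq (coef h D' u' b) 0; first by rewrite mulr0 mul0r.
rewrite rsm_wick_neq ?mulr0//.
- by move=> i; exact: rs_bounded rD _.
- by move=> i; exact: rs_bounded rD' _.
- by apply: off_diag_disjoint => //; exact: (coef_off_diag aD uD ca).
- by apply: off_diag_disjoint => //; exact: (coef_off_diag aD' uD' cb).
Qed.

End two.

Section isometry.
Variables (n : nat) (j j' : 'I_n -> 'I_d).
Variables (f h : n.-tuple point -> R[i]).
Variables (N : nat) (D : sindex N -> set point) (u : sindex N -> point).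
Variables (N' : nat) (D' : sindex N' -> set point) (u' : sindex N' -> point).
Hypothesis rD : regular_system (k := k) D.
Hypothesis aD : adapted (k := k) D f.
Hypothesis uD : forall a, D a !=set0 -> D a (u a).
Hypothesis Kh : in_K G j' h.
Hypothesis rD' : regular_system (k := k) D'.
Hypothesis aD' : adapted (k := k) D' h.
Hypothesis uD' : forall a, D' a !=set0 -> D' a (u' a).

Local Notation mun := (power_measure (sm_mu G) n).

Let box2 (a : {ffun 'I_n -> sindex N}) (b : {ffun 'I_n -> sindex N'}) (s : 'S_n) i :=
  D (a i) `&` D' (b ((s^-1)%g i)).

Let bbox2 a b s i : bounded_borel k (box2 a b s i).
Proof.
apply: bounded_borelI; first exact: rs_bounded rD _.
by have [] := rs_bounded rD' (b ((s^-1)%g i)).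
Qed.

(** On the box with sides D_(a i) and D'_(b (s^-1 i)) intersected, both functions are constant, and
    the integral of the product density factors over the sides. *)
Lemma pairing_simple (s : 'S_n) :
  cintegral mun (En n) (pairing_integrand G j j' f h s) =
  \sum_a \sum_b coef f D u a * conjc (coef h D' u' b) *
    \prod_i sm_G G (j i) (j' ((s^-1)%g i)) (D (a i) `&` D' (b ((s^-1)%g i))).
Proof.
pose js i := j' ((s^-1)%g i).
have mE := @measurable_space_pow R k nu n.
have mB a b : measurable (tbox (box2 a b s)).
  by apply: measurable_tbox => i; have [] := bbox2 a b s i.
have sB a b : tbox (box2 a b s) `<=` En n.
  by move=> x hx i; have [_ hE _] := bbox2 a b s i; apply: hE; exact: hx.
have [ib Ib] : (forall a b, cintegrable mun (tbox (box2 a b s)) (prod_density G j js)) /\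
   forall a b, cintegral mun (tbox (box2 a b s)) (prod_density G j js) =
     \prod_i sm_G G (j i) (js i) (box2 a b s i).
  have key a b := power_cintegral (fun i => let: And3 m _ _ := bbox2 a b s i in m)
    (fun i => (sm_density G (j i) (js i) (bbox2 a b s i)).1).
  split=> a b; first by have [] := key a b.
  have [_ ->] := key a b; apply: eq_bigr => i _.
  by have [_ ->] := sm_density G (j i) (js i) (bbox2 a b s i).
have cr a b x : En n x -> crestrict (tbox (box2 a b s)) (prod_density G j js) x =
    (x \in tbox (box2 a b s))%:R * prod_density G j js x.
  by move=> _; rewrite /crestrict; case: (x \in _); rewrite ?mul1r ?mul0r.
have icr a b : cintegrable mun (En n) (crestrict (tbox (box2 a b s)) (prod_density G j js)) /\
  cintegral mun (En n) (crestrict (tbox (box2 a b s)) (prod_density G j js)) =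
  \prod_i sm_G G (j i) (js i) (box2 a b s i).
  have e : crestrict (En n) (crestrict (tbox (box2 a b s)) (prod_density G j js)) =
      crestrict (tbox (box2 a b s)) (prod_density G j js).
    apply/funext => x; rewrite /crestrict; case: (boolP (x \in tbox _)) => [/set_mem/sB/mem_set ->//|_].
    by case: ifP.
  split.
    by apply/(cintegrable_mkcond _ _ mE).2; rewrite e; apply/(cintegrable_mkcond _ _ (mB a b)).1.
  by rewrite cintegral_mkcond e -cintegral_mkcond.
rewrite (@eq_cintegral _ _ _ _ _ _ (fun x => \sum_a \sum_b (coef f D u a * conjc (coef h D' u' b)) *
    crestrict (tbox (box2 a b s)) (prod_density G j js) x)); last first.
  move=> x Ex; rewrite /pairing_integrand (coef_expand rD aD uD Ex).
  rewrite (coef_expand rD' aD' uD' (x := tperm_tuple s x)); last first.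
    by move=> i; rewrite tnth_mktuple; exact: Ex.
  rewrite rmorph_sum -mulrA mulr_suml; apply: eq_bigr => a _.
  rewrite mulr_suml mulr_sumr; apply: eq_bigr => b _.
  rewrite rmorphM cr//.
  have -> : x \in tbox (box2 a b s) = (x \in tbox (fun i => D (a i))) &&
      (tperm_tuple s x \in tbox (fun i => D' (b i))).
    apply/idP/andP => [/set_mem hx|[/set_mem h1 /set_mem h2]].
      split; apply/mem_set => i; first by have [] := hx i.
      by rewrite tnth_mktuple; have [_] := hx (s i); rewrite permK.
    apply/mem_set => i; split; first exact: h1.
    by have := h2 ((s^-1)%g i); rewrite tnth_mktuple permKV.
  case: (x \in _); rewrite /= ?(mulr1, mulr0, mul0r)//.
  (* The conjugates of the indicator values 1 and 0, in the form in which simplification leaves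
     them. *)
  have e1 : (1 -i* 0)%C = 1 :> R[i] by rewrite oppr0.
  have e0 : ((- 0)*i)%C = 0 :> R[i] by rewrite oppr0.
  by case: (_ \in _); rewrite /= ?e1 ?e0 ?(mulr1, mulr0, mul0r, mul1r) ?mulrA.
rewrite cintegral_sum//; last first.
  move=> a _; apply: cintegrable_sum => // b _; apply: cintegrableZ => //.
  by have [] := icr a b.
apply: eq_bigr => a _; rewrite cintegral_sum//; last first.
  by move=> b _; apply: cintegrableZ => //; have [] := icr a b.
by apply: eq_bigr => b _; have [i1 i2] := icr a b; rewrite cintegralZ// i2.
Qed.

(* E Z(A) Z(B) = G(A `&` - B): replacing b by - b conjugates the coefficient of h
   and turns - D'_b into D'_b. *)
Lemma simple_isometry :
  cexpectation P (fun w => simple_sum j f D u w * simple_sum j' h D' u' w) =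
  \sum_(s : 'S_n) cintegral mun (En n) (pairing_integrand G j j' f h s).
Proof.
rewrite (simple_pair_expand j j' f h u u' rD rD').
under [RHS]eq_bigr do rewrite pairing_simple.
rewrite [RHS]exchange_big; apply: eq_bigr => a _ /=.
rewrite [RHS]exchange_big (reindex_inj (can_inj (@sopp_ffunK n N'))).
apply: eq_bigr => b _ /=; rewrite -mulr_sumr (coef_sopp Kh rD' aD' uD').
have [->|ca] := eqVneq (coef f D u a) 0; first by rewrite !mul0r.
have [->|cb] := eqVneq (coef h D' u' b) 0; first by rewrite conjc0 mulr0 !mul0r.
congr (_ * _).
have cb' : coef h D' u' (sopp_ffun b) != 0.
  by rewrite (coef_sopp Kh rD' aD' uD') conjc_eq0.
rewrite rsm_wick.
(* Wick's formula attaches to i the factor of index s i, the integral the one of index s^-1 i; the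
   sum over all s is the same. *)
- rewrite (reindex_inj (@invg_inj _)); apply: eq_bigr => s _ /=.
  apply: eq_bigr => i _; congr (sm_G _ _ _ (_ `&` _)).
  by rewrite ffunE -(rs_neg rD').
- by move=> i; exact: rs_bounded rD _.
- by move=> i; exact: rs_bounded rD' _.
- by apply: off_diag_disjoint => //; exact: (coef_off_diag aD uD ca).
- by apply: off_diag_disjoint => //; exact: (coef_off_diag aD' uD' cb').
Qed.

End isometry.

(** The defining sum is real only almost surely; taking its real part gives a variable that is real
    at every outcome and changes it on a null set only. *)
Definition elementary n (j : 'I_n -> 'I_d) h (T : Omega -> R) :=
  in_K G j h /\ exists N (D : sindex N -> set point) (u : sindex N -> point),
    [/\ regular_system (k := k) D, adapted (k := k) D h,
        forall a, D a !=set0 -> D a (u a)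
      & T = fun w => Re (simple_sum j h D u w)].

Lemma elementary_exists n (j : 'I_n -> 'I_d) h :
  in_Khat G j h -> exists T, elementary j h T.
Proof.
move=> [Kh [N [D [rD aD]]]].
have hu a : exists x, D a !=set0 -> D a x.
  have [[x Dx]|nx] := pselect (D a !=set0); first by exists x.
  by exists [tuple of nseq nu 0].
have [u uD] := choice hu.
eexists; split => //; exists N, D, u; split => //.
Qed.

Lemma simple_sum_Re n (j : 'I_n -> 'I_d) h N (D : sindex N -> set point) u :
  in_K G j h -> regular_system (k := k) D -> adapted (k := k) D h ->
  (forall a, D a !=set0 -> D a (u a)) ->
  {ae P, forall w, simple_sum j h D u w = (Re (simple_sum j h D u w))%:C%C}.
Proof.
move=> Kh rD aD uD; apply: filterS (simple_sum_real Kh rD aD uD) => w.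
case: (simple_sum _ _ _ _ _) => a b /= [] hb; congr (_ +i* _)%C; lra.
Qed.

Lemma elementary_sq_integrable n (j : 'I_n -> 'I_d) h T :
  elementary j h T -> sq_integrable P T.
Proof.
move=> [Kh [N [D [u [rD aD uD ->]]]]].
have [[mr mi] iS] := fin_moments_simple_sum j h u rD.
split => //; have := iS 1%N; apply: le_integrable => //.
  by apply/measurable_EFinP/measurable_funX.
by move=> w _; rewrite /= lee_fin expr1 !ger0_norm ?sqr_ge0 ?csq_ge0// Re_sq_le.
Qed.

Let elementary_pair n n' (j : 'I_n -> 'I_d) (j' : 'I_n' -> 'I_d) f h
    N (D : sindex N -> set point) u N' (D' : sindex N' -> set point) u' :
  in_K G j f -> regular_system (k := k) D -> adapted (k := k) D f ->
  (forall a, D a !=set0 -> D a (u a)) ->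
  in_K G j' h -> regular_system (k := k) D' -> adapted (k := k) D' h ->
  (forall a, D' a !=set0 -> D' a (u' a)) ->
  (inner P (fun w => Re (simple_sum j f D u w))
    (fun w => Re (simple_sum j' h D' u' w)))%:C%C =
  cexpectation P (fun w => simple_sum j f D u w * simple_sum j' h D' u' w).
Proof.
move=> Kf rD aD uD Kh rD' aD' uD'; rewrite /inner -cexpectation_real.
have [mS _] := fin_moments_simple_sum j f u rD.
have [mS' _] := fin_moments_simple_sum j' h u' rD'.
apply: ae_eq_cintegral => //.
- split => /=; last exact: measurable_cst.
  by apply: measurable_funM; [exact: mS.1|exact: mS'.1].
- exact: cmeasurableM.
apply: filterS2 (simple_sum_Re Kf rD aD uD) (simple_sum_Re Kh rD' aD' uD') => w e1 e2 _.
by rewrite [in RHS]e1 [in RHS]e2 -rmorphM.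
Qed.

Lemma elementary_form n (j j' : 'I_n -> 'I_d) f h T S :
  elementary j f T -> elementary j' h S -> (inner P T S)%:C%C = form G j j' f h.
Proof.
move=> [Kf [N [D [u [rD aD uD ->]]]]] [Kh [N' [D' [u' [rD' aD' uD' ->]]]]].
by rewrite elementary_pair// simple_isometry.
Qed.

Lemma elementary_neq n n' (j : 'I_n -> 'I_d) (j' : 'I_n' -> 'I_d) f h T S :
  n != n' -> elementary j f T -> elementary j' h S -> inner P T S = 0.
Proof.
move=> nn' [Kf [N [D [u [rD aD uD ->]]]]] [Kh [N' [D' [u' [rD' aD' uD' ->]]]]].
have := elementary_pair Kf rD aD uD Kh rD' aD' uD'.
by rewrite simple_pair_neq// => -[].
Qed.

Lemma elementary_mean n (j : 'I_n -> 'I_d) f T : (0 < n)%N ->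
  elementary j f T -> inner P T (fun=> 1) = 0.
Proof.
move=> n0 [Kf [N [D [u [rD aD uD ->]]]]].
have [] := simple_sum_mean j rD aD uD n0 => h _.
by rewrite -[RHS]h; apply: eq_Rintegral => w _; rewrite mulr1.
Qed.

(** The graph of the extended integral as a relation, without a chosen approximating sequence: one
    elementary pair is close to [f] in K and to [X] in mean square at the same time. *)
Definition approximated n (j : 'I_n -> 'I_d) f (X : Omega -> R) :=
  [/\ in_K G j f, sq_integrable P X & forall e, 0 < e -> exists h T,
    [/\ elementary j h T, fsqnorm G j (fun x => h x - f x) <= e
      & inner P (fun w => X w - T w) (fun w => X w - T w) <= e]].

Lemma elementary_approximated n (j : 'I_n -> 'I_d) f T :
  elementary j f T -> approximated j f T.
Proof.
move=> eT; have [Kf _] := eT; split => //; first exact: elementary_sq_integrable eT.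
move=> e e0; exists f, T; split => //.
  apply: le_trans (ltW e0); rewrite /fsqnorm /sqnorm.
  under eq_integral do rewrite subrr cmod_sq csq0 mul0r.
  by rewrite integral0.
apply: le_trans (ltW e0); rewrite /inner /Rintegral.
by under eq_integral do rewrite subrr mul0r; rewrite integral0.
Qed.

(** For elementary approximants both sides coincide, and each side is close to its value at the
    approximants; the difference is therefore below every bound of the type treated by
    [eq0_of_close]. *)
Lemma approximated_form n (j j' : 'I_n -> 'I_d) f h X Y :
  approximated j f X -> approximated j' h Y -> (inner P X Y)%:C%C = form G j j' f h.
Proof.
move=> [Kf sX aX] [Kh sY aY].
pose Q := inner P X X + inner P Y Y + (fsqnorm G j f + fsqnorm G j' h).
have [X0 Y0 f0 h0] : [/\ 0 <= inner P X X, 0 <= inner P Y Y,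
   0 <= fsqnorm G j f & 0 <= fsqnorm G j' h] by split; rewrite ?inner_ge0 ?fsqnorm_ge0.
have Q0 : 0 <= Q by rewrite /Q; lra.
have C0 : 0 <= 1 + n`!%:R :> R by rewrite addr_ge0.
have main r e : 0 < r -> 0 < e ->
    `|inner P X Y - Re (form G j j' f h)| <= (1 + n`!%:R) * (r * e + (Q + e) / r) /\
    `|Im (form G j j' f h)| <= (1 + n`!%:R) * (r * e + (Q + e) / r).
  move=> r0 e0; have [f' [T [eT ff' XT]]] := aX e e0.
  have [h' [S [eS hh' YS]]] := aY e e0.
  have c1 := inner_close r0 sX (elementary_sq_integrable eT) sY (elementary_sq_integrable eS) XT YS.
  have [c2 c3] := form_close r0 Kf eT.1 Kh eS.1 ff' hh'.
  rewrite -(elementary_form eT eS) ReD ReN ImD ImN /= in c2 c3.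
  have le1 : r * e + (inner P X X + inner P Y Y + e) / r <= r * e + (Q + e) / r.
    by rewrite lerD2l ler_pM2r ?invr_gt0//; rewrite /Q; lra.
  have le2 : n`!%:R * (r * e + (fsqnorm G j f + fsqnorm G j' h + e) / r) <=
             n`!%:R * (r * e + (Q + e) / r).
    by rewrite ler_wpM2l// lerD2l ler_pM2r ?invr_gt0//; rewrite /Q; lra.
  rewrite mulrDl mul1r; split.
    rewrite (_ : _ - _ = (inner P X Y - inner P T S) +
      (inner P T S - Re (form G j j' f h))); last by ring.
    apply: (le_trans (ler_normD _ _)); apply: lerD; first exact: le_trans c1 le1.
    exact: le_trans c2 le2.
  rewrite sub0r normrN in c3; apply: (le_trans c3); apply: (le_trans le2).
  by rewrite lerDr addr_ge0// ?divr_ge0 ?mulr_ge0 ?addr_ge0 // ltW.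
apply: complexP => /=.
  apply/eqP; rewrite -subr_eq0; apply/eqP; apply: (eq0_of_close C0 Q0) => r e r0 e0.
  by have [] := main r e r0 e0.
by apply/esym; apply: (eq0_of_close C0 Q0) => r e r0 e0; have [] := main r e r0 e0.
Qed.

(** Common to two orthogonality relations: between integrals of different orders, and between an
    integral and the constant 1, which is the vanishing of the mean. *)
Let approximated_ortho n (j : 'I_n -> 'I_d) f X Y : approximated j f X -> sq_integrable P Y ->
  (forall h T e, 0 < e -> elementary j h T -> exists S, [/\ sq_integrable P S,
     inner P (fun w => Y w - S w) (fun w => Y w - S w) <= e & inner P T S = 0]) ->
  inner P X Y = 0.
Proof.
move=> [Kf sX aX] sY aY.
have X0 := inner_ge0 P X; have Y0 := inner_ge0 P Y.
apply: (@eq0_of_close _ 1 (inner P X X + inner P Y Y)) => //; first by lra.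
move=> r e r0 e0; have [h [T [eT _ XT]]] := aX e e0.
have [S [sS YS TS]] := aY h T e e0 eT.
have := inner_close r0 sX (elementary_sq_integrable eT) sY sS XT YS.
by rewrite TS subr0 mul1r.
Qed.

Lemma approximated_neq n n' (j : 'I_n -> 'I_d) (j' : 'I_n' -> 'I_d) f h X Y :
  n != n' -> approximated j f X -> approximated j' h Y -> inner P X Y = 0.
Proof.
move=> nn' aX [Kh sY aY]; apply: (approximated_ortho aX sY) => f' T e e0 eT.
have [h' [S [eS _ YS]]] := aY e e0; exists S; split => //.
  exact: elementary_sq_integrable eS.
exact: elementary_neq eT eS.
Qed.

Lemma approximated_mean n (j : 'I_n -> 'I_d) f X : (0 < n)%N ->
  approximated j f X -> Rintegral P setT X = 0.
Proof.
move=> n0 aX; transitivity (inner P X (fun=> 1)).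
  by apply: eq_Rintegral => w _; rewrite mulr1.
have s1 := sq_integrable_cst P 1; apply: (approximated_ortho aX s1) => h T e e0 eT.
exists (fun=> 1); split => //; last exact: elementary_mean eT.
rewrite /inner /Rintegral; under eq_integral do rewrite subrr mul0r.
by rewrite integral0 ltW.
Qed.

(** Expanding the second moment of X - Y gives four values of the form, which recombine to the form
    of f - h with itself. *)
Lemma approximated_dist n (j : 'I_n -> 'I_d) f h X Y :
  approximated j f X -> approximated j h Y ->
  inner P (fun w => X w - Y w) (fun w => X w - Y w) <=
    n`!%:R * fsqnorm G j (fun x => f x - h x).
Proof.
move=> aX aY; have [Kf sX _] := aX; have [Kh sY _] := aY.
have sXY := sq_integrableB sX sY; have Kfh := in_KB Kf Kh.
apply: le_trans (form_diag_le Kfh).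
rewrite formB_l// !formB_r// -(approximated_form aX aX) -(approximated_form aX aY).
rewrite -(approximated_form aY aX) -(approximated_form aY aY).
by rewrite innerB// !innerB_r// !(ReD, ReN).
Qed.

Lemma approximated_unique n (j : 'I_n -> 'I_d) f X Y :
  approximated j f X -> approximated j f Y -> {ae P, forall w, X w = Y w}.
Proof.
move=> aX aY; have [_ sX _] := aX; have [_ sY _] := aY.
have sW := sq_integrableB sX sY.
have W0 : inner P (fun w => X w - Y w) (fun w => X w - Y w) = 0.
  have eq A B : approximated j f A -> approximated j f B -> inner P A B = inner P X X.
    by move=> aA aB; have := approximated_form aA aB; rewrite -(approximated_form aX aX) => -[].
  by rewrite innerB// !innerB_r// (eq _ _ aX aY) (eq _ _ aY aX) (eq _ _ aY aY) !subrr.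
by apply: filterS (inner_eq0_ae sW W0) => w /eqP; rewrite subr_eq0 => /eqP.
Qed.

(** By linearity of the form in its first argument, W - a X - b Y is orthogonal to W, X and Y, hence
    to itself. *)
Lemma approximated_lin n (j : 'I_n -> 'I_d) f h (a b : R) W X Y :
  approximated j (fun x => a%:C%C * f x + b%:C%C * h x) W ->
  approximated j f X -> approximated j h Y ->
  {ae P, forall w, W w = a * X w + b * Y w}.
Proof.
move=> aW aX aY; have [_ sW _] := aW; have [Kf sX _] := aX; have [Kh sY _] := aY.
have sL := sq_integrable_lin a b sX sY; have sD := sq_integrableB sW sL.
set D := (fun w => W w - (a * X w + b * Y w)) in sD.
have DV v V : approximated j v V -> inner P D V = 0.
  move=> aV; have [Kv sV _] := aV.
  have e A B : inner P A B = Re (inner P A B)%:C%C by [].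
  rewrite innerB// inner_lin// (e W) (e X) (e Y).
  rewrite (approximated_form aW aV) (approximated_form aX aV) (approximated_form aY aV).
  by rewrite form_lin_l// ReD !ReM /=; ring.
have D0 : inner P D D = 0.
  have DL : inner P D (fun w => a * X w + b * Y w) = 0.
    rewrite innerC inner_lin// (innerC P X) (innerC P Y) (DV _ _ aX) (DV _ _ aY); ring.
  by rewrite {2}/D innerB_r// DL (DV _ _ aW) subr0.
by apply: filterS (inner_eq0_ae sD D0) => w /eqP; rewrite subr_eq0 => /eqP.
Qed.

(** * Existence of the extension for a non-atomic measure *)

Hypothesis hG : nonatomic G.

Lemma approximated_exists n (j : 'I_n -> 'I_d) f : in_K G j f -> exists X, approximated j f X.
Proof.
move=> Kf.
have hT m : exists hT : (n.-tuple point -> R[i]) * (Omega -> R),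
    elementary j hT.1 hT.2 /\ fsqnorm G j (fun x => hT.1 x - f x) <= 4 ^- m.
  have e0 : 0 < 4 ^- m :> R by rewrite invr_gt0 exprn_gt0.
  have [h Kh hf] := in_Khat_dense hG Kf e0.
  have [T eT] := elementary_exists Kh; exists (h, T); split => //=.
  by have := in_KB eT.1 Kf => K; move: hf; rewrite sqnorm_fin// lte_fin => /ltW.
have [hT_ hTP] := choice hT.
pose h m := (hT_ m).1; pose T m := (hT_ m).2.
have sT m : sq_integrable P (T m) by exact: elementary_sq_integrable (hTP m).1.
(* The squared distance of the approximants of orders l >= m is at most 2 4^-l + 2 4^-m <= 4 4^-m in
   K, and passing to the integrals costs a factor n!. *)
have [|X sX XT] := @sq_integrable_complete _ _ _ P T (4 * n`!%:R) sT.
  move=> m l ml.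
  have aT i := elementary_approximated (hTP i).1.
  apply: (le_trans (approximated_dist (aT l) (aT m))).
  rewrite [leRHS](_ : _ = n`!%:R * (4 * 4 ^- m)); last by ring.
  rewrite ler_wpM2l//.
  have Kl := in_KB (hTP l).1.1 Kf; have Km := in_KB (hTP m).1.1 Kf.
  have := in_KB (hTP l).1.1 Kf; have := in_KB (hTP m).1.1 Kf.
  have := (hTP l).2; have := (hTP m).2.
  set a := (fun x => (hT_ m).1 x - f x); set b := (fun x => (hT_ l).1 x - f x) => am bl Ka Kb.
  have -> : (fun x => (hT_ l).1 x - (hT_ m).1 x) = (fun x => b x - a x).
    by apply/funext => x; rewrite /a /b; ring.
  apply: (le_trans (fsqnormB_le Kb Ka)).
  have lm : 4 ^- l <= 4 ^- m :> R by rewrite lef_pV2 ?posrE ?exprn_gt0// ler_weXn2l ?ler1n.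
  lra.
exists X; split => // e e0.
(* One m serves both requirements: 4^-m for the distance in K and 4 n! 4^-m for that of the random
   variables. *)
have [m hm] : exists m, 4 ^- m * (1 + 4 * n`!%:R) <= e.
  have q1 : `|4^-1 : R| < 1 by rewrite ger0_norm ?invr_ge0//; lra.
  have c0 : 0 < 1 + 4 * n`!%:R :> R by rewrite ltr_wpDr// mulr_ge0.
  have /cvgrPdist_lt /(_ (e / (1 + 4 * n`!%:R))) := @cvg_geometric R 1 _ q1.
  rewrite divr_gt0// => /(_ isT) [m _ hm]; exists m; move: (hm m (leqnn m)).
  rewrite /= sub0r normrN mul1r ger0_norm ?exprn_ge0// exprVn ltr_pdivlMr//.
  exact: ltW.
have m0 : 0 < 4 ^- m :> R by rewrite invr_gt0 exprn_gt0.
have f0 : 0 <= n`!%:R :> R by [].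
exists (h m), (T m); split; first exact: (hTP m).1.
- apply: (le_trans (hTP m).2); apply: le_trans hm; nra.
- apply: (le_trans (XT m)); apply: le_trans hm; nra.
Qed.

End random_measure.

Theorem mainTheorem7 (R : realType) (k : space_kind) (nu d : nat)
    (G : spectral_measure R k nu d) (hG : nonatomic G)
    (dO : measure_display) (Omega : measurableType dO) (P : probability Omega R)
    (Z : 'I_d -> set (nu.-tuple R) -> Omega -> R[i])
    (hZ : random_spectral_measure P G Z) :
  (* simple functions form a real linear space *)
  (forall n (j : 'I_n -> 'I_d) f h (a b : R), (0 < n)%N ->
     in_Khat G j f -> in_Khat G j h ->
     in_Khat G j (fun x => (a%:C)%C * f x + (b%:C)%C * h x)) /\
  exists I : @integral_map R dO Omega nu d,
    extends_simple_integral P G Z I /\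
    extends_by_L2_continuity P G I /\
    (* linearity *)
    (forall n (j : 'I_n -> 'I_d) f h (a b : R), (0 < n)%N ->
       in_K G j f -> in_K G j h ->
       {ae P, forall w, I n j (fun x => (a%:C)%C * f x + (b%:C)%C * h x) w
                        = (a%:C)%C * I n j f w + (b%:C)%C * I n j h w}) /\
    (* (1) *)
    (forall n (j : 'I_n -> 'I_d) f, (0 < n)%N -> in_K G j f ->
       cmeasurable setT (I n j f) /\
       {ae P, forall w, complex.Im (I n j f w) = 0}) /\
    (* (2) *)
    (forall n (j : 'I_n -> 'I_d) f, (0 < n)%N -> in_K G j f ->
       cexpectation P (I n j f) = 0) /\
    (* (3) *)
    (forall n (j j' : 'I_n -> 'I_d) f h, (0 < n)%N ->
       in_K G j f -> in_K G j' h ->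
       let integrand (s : 'S_n) (x : n.-tuple (nu.-tuple R)) : R[i] :=
         f x * conjc (h [tuple tnth x (s i) | i < n])
         * prod_density G j (fun i => j' ((s^-1)%g i)) x in
       (forall s : 'S_n, cintegrable (power_measure (sm_mu G) n)
          (space_pow R k nu n) (integrand s)) /\
       cexpectation P (fun w => I n j f w * I n j' h w) =
         \sum_(s : 'S_n) cintegral (power_measure (sm_mu G) n)
           (space_pow R k nu n) (integrand s)) /\
    (* (4) *)
    (forall n n' (j : 'I_n -> 'I_d) (j' : 'I_n' -> 'I_d) f h,
       (0 < n)%N -> (0 < n')%N -> n != n' ->
       in_K G j f -> in_K G j' h ->
       cexpectation P (fun w => I n j f w * I n' j' h w) = 0) /\
    (* (5) *)
    (forall n (j : 'I_n -> 'I_d) f, (0 < n)%N -> in_K G j f ->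
       (second_moment P (I n j f) <= (n`!%:R)%:E * sqnorm G j f)%E).
Proof.
split=> [n j f h a b _ Kf Kh|]; first exact: in_Khat_lin.
(* The integral has to be a total function; outside K its value is arbitrary and set to 0. *)
have ex n (j : 'I_n -> 'I_d) f : exists X, in_K G j f -> approximated P G Z j f X.
  have [Kf|nK] := pselect (in_K G j f); last by exists (fun=> 0).
  by have [X aX] := approximated_exists hZ hG Kf; exists X.
pose X n (j : 'I_n -> 'I_d) f := projT1 (cid (ex n j f)).
have aX n (j : 'I_n -> 'I_d) f : in_K G j f -> approximated P G Z j f (X n j f).
  exact: projT2 (cid (ex n j f)).
have sX n (j : 'I_n -> 'I_d) f : in_K G j f -> sq_integrable P (X n j f).
  by move=> /aX[].
have momentE (W : Omega -> R) : sq_integrable P W ->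
    second_moment P (fun w => (W w)%:C%C) = (inner P W W)%:E.
  move=> sW; rewrite -integral_sq//; apply: eq_integral => w _.
  by rewrite cmod_sq csq_real.
have momentB n (j : 'I_n -> 'I_d) f h : in_K G j f -> in_K G j h ->
    (second_moment P (fun w => ((X n j f w)%:C%C - (X n j h w)%:C%C)%R) <=
     (n`!%:R)%:E * sqnorm G j (fun x => (f x - h x)%R))%E.
  move=> Kf Kh; rewrite (_ : (fun w => _) = (fun w => (X n j f w - X n j h w)%:C%C)); last first.
    by apply/funext => w; rewrite rmorphB.
  rewrite momentE ?sqnorm_fin; [|exact: in_KB|by apply: sq_integrableB; exact: sX].
  by rewrite -EFinM lee_fin (approximated_dist hZ (aX _ _ _ Kf) (aX _ _ _ Kh)).
have real_pair n n' (j : 'I_n -> 'I_d) (j' : 'I_n' -> 'I_d) f h :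
    cexpectation P (fun w => (X n j f w)%:C%C * (X n' j' h w)%:C%C) =
    (inner P (X n j f) (X n' j' h))%:C%C.
  rewrite /inner -cexpectation_real; congr (cexpectation P _).
  by apply/funext => w; rewrite rmorphM.
(* Real variables embedded in the complex numbers: the imaginary part vanishes at every outcome, not
   only almost surely. *)
exists (fun n j f w => (X n j f w)%:C%C); split; last split; last split; last split;
  last split; last split; last split.
- move=> n j f n0 Kf N D u rD aD uD.
  (* A simple function and its defining sum form an approximated pair themselves, so uniqueness
     identifies that sum with the chosen variable. *)
  have eT : elementary G Z j f (fun w => complex.Re (simple_sum Z j f D u w)).
    by split => //; exists N, D, u.
  have h := approximated_unique hZ (aX _ _ _ Kf) (elementary_approximated hZ eT).
  have h' := simple_sum_Re hZ Kf rD aD uD.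
  have := simple_sumE hZ j f uD; apply: filterS3 h h' => w -> <- ->.
  by [].
- move=> n j f n0 Kf; split.
    have e0 m : 0 < m.+1%:R^-1 :> R by [].
    have ex_h m : exists h, in_Khat G j h /\
        (sqnorm G j (fun x => (h x - f x)%R) < (m.+1%:R^-1)%:E)%E.
      by have [h] := in_Khat_dense hG Kf (e0 m); exists h.
    have [h hP] := choice ex_h.
    exists h => [m|]; first by have [] := hP m.
    have hK m : in_K G j (h m) by have [[]] := hP m.
    apply: (@squeeze_cvge _ _ _ _ (fun=> 0%E) _ (fun m => (m.+1%:R^-1)%:E)).
    + apply: nearW => m; have [_ /ltW ->] := hP m; rewrite andbT.
      by apply: sqnorm_ge0; exact: (K_measurable (in_KB (hK m) Kf)).
    + exact: cvg_cst.
    + by apply: cvg_EFin; [exact: nearW|exact: cvg_harmonic].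
  move=> h hK hf.
  apply: (@squeeze_cvge _ _ _ _ (fun=> 0%E) _
    (fun m => (n`!%:R)%:E * sqnorm G j (fun x => (h m x - f x)%R))%E).
  + apply: nearW => m; rewrite momentB ?andbT//; last by have [] := hK m.
    by apply: integral_ge0 => w _; rewrite lee_fin sqr_ge0.
  + exact: cvg_cst.
  + rewrite -[X in _ --> X](mule0 (n`!%:R)%:E); exact: cvgeZl.
- move=> n j f h a b n0 Kf Kh.
  have := approximated_lin hZ (aX _ _ _ (in_K_lin a b Kf Kh)) (aX _ _ _ Kf) (aX _ _ _ Kh).
  by apply: filterS => w ->; rewrite rmorphD !rmorphM.
- move=> n j f n0 Kf; have [mX _] := sX _ _ _ Kf; split; last exact: aeW.
  by split => //=; exact: measurable_cst.
- by move=> n j f n0 Kf; rewrite cexpectation_real (approximated_mean hZ n0 (aX _ _ _ Kf)).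
- move=> n j j' f h n0 Kf Kh /=; split=> [s|]; first exact: in_K_pairing.
  by rewrite real_pair (approximated_form hZ (aX _ _ _ Kf) (aX _ _ _ Kh)).
- move=> n n' j j' f h n0 n0' nn' Kf Kh.
  by rewrite real_pair (approximated_neq hZ nn' (aX _ _ _ Kf) (aX _ _ _ Kh)).
- move=> n j f n0 Kf; rewrite momentE ?sqnorm_fin; [|exact: Kf|exact: sX].
  rewrite -EFinM lee_fin; apply: le_trans (form_diag_le Kf).
  by rewrite -(approximated_form hZ (aX _ _ _ Kf) (aX _ _ _ Kf)).
Qed.
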